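(* There exist $\epsilon>0$ and $C>0$ such that if $d\in C^\infty_{\mathbf e}(B_1^3,\mathbb{S}^2)$ satisfies $$E(d):=\frac12\int_{B_1^3}|\nabla d|^2\le\epsilon^2\qquad\text{and}\qquad\int_{B_1^3}\big|\Delta d+|\nabla d|^2 d\big|^2\le\epsilon^2,$$ then $$[d]_{C^{1/2}(B_1^3)}\le C\sqrt{\epsilon}.$$
   Context: $B_1^3$ is the open unit ball in $\mathbb{R}^3$, $\mathbb{S}^2$ the unit sphere in $\mathbb{R}^3$, $\mathbf e=(0,0,1)$, and $C^\infty_{\mathbf e}(B_1^3,\mathbb{S}^2)=\{d\in C^\infty(B_1^3,\mathbb{S}^2): d=\mathbf e\text{ on }\partial B_1^3\}$. $[d]_{C^{1/2}(U)}=\sup_{x\ne y\in U}\frac{|d(x)-d(y)|}{|x-y|^{1/2}}$ is the Hölder seminorm. *)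

(* Defs.v *)
From HB Require Import structures.
From mathcomp Require Import all_boot all_order all_algebra.
From mathcomp Require Import all_classical all_reals all_analysis.
Set Implicit Arguments. Unset Strict Implicit. Unset Printing Implicit Defensive.
Import Order.TTheory GRing.Theory Num.Theory.
Import numFieldNormedType.Exports.
Local Open Scope classical_set_scope.
Local Open Scope ring_scope.

Definition enorm {R : realType} (v : 'rV[R]_3) : R :=
  Num.sqrt (\sum_(i < 3) (v 0 i) ^+ 2).

Definition evec {R : realType} (j : 'I_3) : 'rV[R]_3 := delta_mx 0 j.

Definition e3 {R : realType} : 'rV[R]_3 := evec ord_max.

Definition vec3 {R : realType} (a b c : R) : 'rV[R]_3 :=
  \row_(i < 3) [:: a; b; c]`_i.

Definition pd {R : realType} (j : 'I_3) (f : 'rV[R]_3 -> 'rV[R]_3)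
  : 'rV[R]_3 -> 'rV[R]_3 := fun x => 'D_(evec j) f x.

Fixpoint iter_pd {R : realType} (l : seq 'I_3) (f : 'rV[R]_3 -> 'rV[R]_3)
  : 'rV[R]_3 -> 'rV[R]_3 :=
  match l with
  | [::] => f
  | j :: l' => pd j (iter_pd l' f)
  end.

Definition smooth3 {R : realType} (f : 'rV[R]_3 -> 'rV[R]_3) : Prop :=
  forall l : seq 'I_3,
    continuous (iter_pd l f) /\
    (forall (j : 'I_3) (x : 'rV[R]_3), derivable (iter_pd l f) x (evec j)).

Definition grad_sq {R : realType} (d : 'rV[R]_3 -> 'rV[R]_3) (x : 'rV[R]_3) : R :=
  \sum_(j < 3) (enorm (pd j d x)) ^+ 2.

Definition lap {R : realType} (d : 'rV[R]_3 -> 'rV[R]_3) (x : 'rV[R]_3) : 'rV[R]_3 :=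
  \sum_(j < 3) pd j (pd j d) x.

Definition tension {R : realType} (d : 'rV[R]_3 -> 'rV[R]_3) (x : 'rV[R]_3) : 'rV[R]_3 :=
  lap d x + grad_sq d x *: d x.

Definition ball1 {R : realType} : set 'rV[R]_3 := [set x | enorm x < 1].

(* Lebesgue integral over B_1^3 of a real function, written as an iterated
   integral over the three coordinates (Tonelli; used only for nonnegative
   continuous integrands). *)
Definition int_ball {R : realType} (F : 'rV[R]_3 -> R) : \bar R :=
  (\int[@lebesgue_measure R]_(a in setT)
     \int[@lebesgue_measure R]_(b in setT)
       \int[@lebesgue_measure R]_(c in setT)
         ((\1_ball1 (vec3 a b c) : R) * F (vec3 a b c))%:E)%E.

Definition energy {R : realType} (d : 'rV[R]_3 -> 'rV[R]_3) : \bar R :=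
  ((2^-1)%:E * int_ball (grad_sq d))%E.

(* Main.v *)
Require Import Defs.
From HB Require Import structures.
From mathcomp Require Import all_boot all_order all_algebra.
From mathcomp Require Import all_classical all_reals all_analysis measurable_realfun.
From mathcomp Require Import ring lra.
Import Order.TTheory GRing.Theory Num.Theory.
Import numFieldNormedType.Exports.
Local Open Scope classical_set_scope.
Local Open Scope ring_scope.
Set Implicit Arguments.
Unset Strict Implicit.

(** Write [V = |grad d|^2], [tau] for the tension field, [Q(a,s)] for cubes and extend [d] by [e]
    outside the ball. Since [eps] may be fixed, it suffices that [|d x - d y|^2 <= 4 |x - y|].

    - The stress-energy field [(|grad d|^2 z / 2 - (z . grad d) grad d) / sqrt(|z|^2 + rho^2)] with
      [z = x - a] has a boundary term of good sign because [d] is constant on the sphere; this gives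
      [int_(Q(a,s)) V <= 21 s eps^2] for [|a| <= 1].
    - Let [c] be a constant vector, [|c| <= 1], with [c . d >= 0] on a ball of radius [s] that misses
      the sphere (or with [c = e]). Testing [|d - c|^2 / 2] against a truncated fundamental solution
      gives [|d(a) - c|^2 <= C (eps + s^-3 int |d - c|^2)]. With Poincare's inequality: if [d]
      oscillates by at most 1 at scale [4 s], it oscillates by at most [4^-5] (in square) at scale
      [s], hence by at most 1 at scale [8 s]. Starting from tiny scales, [|d - e|^2 <= 1/28]
      everywhere.
    - For [|d - e|^2 <= 1/28], a Reilly-type identity bounds [int |D^2 d|^2] by [2 eps^2]: the term
      [V^2] is absorbed by integrating [div (V (d - e) . grad d)].
    - A Hardy inequality, whose field is built from [a] and its inverse point so as to have a good
      sign on the sphere, improves the first bound to [int_(Q(a,s)) V <= 322 s^2 eps^2].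
    - Comparing means over nested cubes (Morrey) concludes. *)

(** * Calculus *)

(** In dimension three, growth of order [s] of the energy on cubes is scale invariant: it gives
    smallness at every scale but no modulus of continuity. The exponent 1/2 needs growth of order
    [s^2], which comes from square-integrable second derivatives. These in turn need [d] close to
    [e], because [V^2] scales exactly like [|D^2 d|^2]. A Lipschitz constant of [d], of uncontrolled
    size, serves only to start the induction over scales and to remove remainder terms.

    The condition [c . d >= 0] gives a sign to the critical term [V (c . d)]. To have it, Poincare's
    inequality compares with a value [d(y)] and not with a mean: such a [c] is again a unit vector,
    and [2 c . d = 2 - |d - c|^2] turns a bound on the oscillation into the sign.

    Integrals are Riemann sums over grids in [[-4,4]^3], where integration by parts is a telescoping
    sum. The point [y] depends on the grid; limits along an ultrafilter make it converge without
    passing to subsequences. *)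

Definition C1 {R : realType} (f : 'rV[R]_3 -> R) (p : 'I_3 -> 'rV[R]_3 -> R) : Prop :=
  [/\ continuous f, (forall j, continuous (p j)) &
      forall j x, is_derive x (evec j) f (p j x)].

Section C1_calculus.
Context {R : realType}.
Implicit Types (f g : 'rV[R]_3 -> R) (p q : 'I_3 -> 'rV[R]_3 -> R) (x : 'rV[R]_3).

(** Reduces directional derivatives to one variable, where the chain rule and the mean value theorem
    are available. *)
Lemma is_derive_lineP (W : normedModType R) (f : 'rV[R]_3 -> W) x v df :
  is_derive x v f df <-> is_derive (0 : R) 1 (fun h : R => f (h *: v + x)) df.
Proof.
have E : 'D_v f x = 'D_1 (fun h : R => f (h *: v + x)) 0.
  rewrite /derive; set g1 := fun h => h^-1 *: _; set g2 := fun h => h^-1 *: _.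
  suff -> : g1 = g2 by [].
  by rewrite funeqE /g1 /g2 => h /=; rewrite addr0 scale0r add0r [_%:A]mulr1.
split=> -[df1 df2].
  by constructor; [exact: (derivable1P _ _ _).1|rewrite -E].
by constructor; [exact: (derivable1P _ _ _).2|rewrite E].
Qed.

(** The rules below carry partial derivatives as explicit functions, in whatever form the rule
    produces; this lemma lets [ring] or [field] bring them to the wanted form. *)
Lemma C1_ext f g p q : C1 f p -> f =1 g -> (forall j, p j =1 q j) -> C1 g q.
Proof.
move=> Cf fg pq; rewrite -(funext fg : f = g).
by have <- : p = q by apply/funext => j; apply/funext => x; rewrite pq.
Qed.

Lemma C1_cst (c : R) : C1 (fun=> c) (fun _ _ => 0).
Proof.
split=> [x|j x|j x]; [exact: cst_continuous|exact: cst_continuous|exact: is_derive_cst].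
Qed.

Lemma C1_add f g p q : C1 f p -> C1 g q ->
  C1 (fun x => f x + g x) (fun j x => p j x + q j x).
Proof.
move=> [cf cp df] [cg cq dg]; split=> [x|j x|j x].
- by apply: continuousD; [exact: cf|exact: cg].
- by apply: continuousD; [exact: cp|exact: cq].
- by apply: is_deriveD.
Qed.

Lemma C1_opp f p : C1 f p -> C1 (fun x => - f x) (fun j x => - p j x).
Proof.
move=> [cf cp df]; split=> [x|j x|j x].
- by apply: continuousN; exact: cf.
- by apply: continuousN; exact: cp.
- by apply: is_deriveN.
Qed.

Lemma C1_sub f g p q : C1 f p -> C1 g q ->
  C1 (fun x => f x - g x) (fun j x => p j x - q j x).
Proof. by move=> Cf Cg; apply: C1_add => //; apply: C1_opp. Qed.

Lemma C1_mul f g p q : C1 f p -> C1 g q ->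
  C1 (fun x => f x * g x) (fun j x => p j x * g x + f x * q j x).
Proof.
move=> [cf cp df] [cg cq dg]; split=> [x|j x|j x].
- by apply: continuousM; [exact: cf|exact: cg].
- apply: (@continuousD _ _ _ (fun x => p j x * g x) (fun x => f x * q j x)).
  + by apply: continuousM; [exact: cp|exact: cg].
  + by apply: continuousM; [exact: cf|exact: cq].
- have := @is_deriveM _ _ f g x (evec j) (p j x) (q j x) (df j x) (dg j x).
  by move=> h; apply: (is_derive_eq h); rewrite /GRing.scale /=; ring.
Qed.

Lemma C1_sum n (f : 'I_n -> 'rV[R]_3 -> R) (p : 'I_n -> 'I_3 -> 'rV[R]_3 -> R) :
  (forall i, C1 (f i) (p i)) ->
  C1 (fun x => \sum_(i < n) f i x) (fun j x => \sum_(i < n) p i j x).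
Proof.
elim: n f p => [|n IH] f p H.
  by apply: (C1_ext (C1_cst 0)) => [x|j x]; rewrite big_ord0.
have := C1_add (IH _ _ (fun i => H (widen_ord (leqnSn n) i))) (H ord_max).
by move/C1_ext; apply => [x|j x]; rewrite big_ord_recr.
Qed.

Lemma C1_coord (i : 'I_3) : C1 (fun x => x 0 i) (fun j _ => (i == j)%:R).
Proof.
split=> [x|j x|j x]; [exact: coord_continuous|exact: cst_continuous|].
apply/is_derive_lineP.
rewrite (_ : (fun h => _) = (fun h : R => h * (i == j)%:R + x 0 i)); last first.
  by apply/funext => h; rewrite !mxE eqxx /=.
have h : is_derive (0 : R) 1 ((i == j)%:R *: (id : R -> R) + cst (x 0 i)) ((i == j)%:R *: 1 + 0).
  by apply: is_deriveD; apply: is_deriveZ.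
rewrite (_ : (fun h : R => _) = (i == j)%:R *: (id : R -> R) + cst (x 0 i)); last first.
  by apply/funext => t; rewrite /cst /GRing.scale /= [in RHS]/GRing.add /= /GRing.scale /= mulrC.
by apply: (is_derive_eq h); rewrite addr0 /GRing.scale /= mulr1.
Qed.

Lemma C1_comp f p (phi dphi : R -> R) :
  C1 f p -> (forall x, is_derive (f x) 1 phi (dphi (f x))) ->
  continuous (fun x => dphi (f x)) ->
  C1 (fun x => phi (f x)) (fun j x => dphi (f x) * p j x).
Proof.
move=> [cf cp df] dphiP cphi; split=> [x|j x|j x].
- apply: (@continuous_comp _ _ _ f phi); first exact: cf.
  by apply/differentiable_continuous/derivable1_diffP; case: (dphiP x).
- by apply: continuousM; [exact: cphi|exact: cp].
- apply/is_derive_lineP.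
  have h1 := (is_derive_lineP _ _ _ _).1 (df j x).
  have h2 : is_derive (f (0 *: evec j + x)) 1 phi (dphi (f x)).
    by rewrite scale0r add0r.
  have := @is_derive1_comp _ phi (fun h : R => f (h *: evec j + x)) 0 _ _ h2 h1.
  by [].
Qed.

Lemma C1_continuous f p : C1 f p -> continuous f. Proof. by case. Qed.

Lemma C1_exp f p n : C1 f p ->
  C1 (fun x => f x ^+ n.+1) (fun j x => n.+1%:R * f x ^+ n * p j x).
Proof.
move=> Cf; elim: n => [|n IH].
  by apply: (C1_ext Cf) => [x|j x]; rewrite ?expr1 ?expr0 ?mul1r.
apply: (C1_ext (C1_mul Cf IH)) => [x|j x]; first by rewrite -exprS.
by rewrite !exprS -[n.+2%:R]natr1; ring.
Qed.

Lemma C1_inv f p : C1 f p -> (forall x, f x != 0) ->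
  C1 (fun x => (f x)^-1) (fun j x => - ((f x)^-1 ^+ 2 * p j x)).
Proof.
move=> [cf cp df] f0.
have cV : continuous (fun x => (f x)^-1).
  by move=> x; apply: continuousV; [exact: f0|exact: cf].
split=> [//|j x|j x].
- apply: (@continuousN _ _ _ (fun x => (f x)^-1 ^+ 2 * p j x)).
  apply: (@continuousM _ _ (fun x => (f x)^-1 ^+ 2) (p j)); last exact: cp.
  by apply: (@continuousM _ _ (fun x => (f x)^-1) (fun x => (f x)^-1)); exact: cV.
- have [d1 d2] := df j x; split; first exact: derivableV.
  by rewrite deriveV // d2 /GRing.scale /= exprVn mulNr.
Qed.

Lemma C1_sqrt f p : C1 f p -> (forall x, 0 < f x) ->
  C1 (fun x => Num.sqrt (f x)) (fun j x => (2 * Num.sqrt (f x))^-1 * p j x).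
Proof.
move=> Cf f0; have := @C1_comp f p Num.sqrt (fun y => (2 * Num.sqrt y)^-1) Cf.
apply; first by move=> x; apply: is_derive1_sqrt.
move=> x; apply: (@continuousV _ _ (fun x => 2 * Num.sqrt (f x))).
  by rewrite mulf_neq0 // gt_eqF // sqrtr_gt0.
apply: (@continuousM _ _ (fun=> 2) (fun x => Num.sqrt (f x))); first exact: cst_continuous.
apply: (@continuous_comp _ _ _ f Num.sqrt); last exact: sqrt_continuous.
by case: Cf => cf _ _; exact: cf.
Qed.

Definition pos (y : R) : R := Num.max y 0.

Lemma pos_ge0 y : 0 <= pos y. Proof. by rewrite /pos le_max lexx orbT. Qed.
Lemma pos_mul y : pos y * y = pos y ^+ 2.
Proof. by rewrite /pos maxEle; case: ifP => _; rewrite ?mul0r ?expr2 ?mul0r. Qed.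
Lemma pos_gt0 y : (0 < pos y) = (0 < y).
Proof. by rewrite /pos lt_max ltxx orbF. Qed.
Lemma pos_eq y : 0 <= y -> pos y = y. Proof. by move=> ?; apply/max_idPl. Qed.
Lemma pos_eq0 y : y <= 0 -> pos y = 0. Proof. by move=> ?; apply/max_idPr. Qed.

Lemma pos_continuous : continuous pos.
Proof.
move=> x; apply: (@continuous_max _ _ (id : R -> R) (fun=> 0) x).
  by move=> ?; exact: cvg_id.
exact: cst_continuous.
Qed.

(** The difference quotient is within [|z - y|] of [a]. The two-sided quadratic error handles the
    kink of [pos] without one-sided limits. *)
Lemma is_derive_quadratic (phi : R -> R) (y a : R) :
  (forall z, `|phi z - phi y - a * (z - y)| <= (z - y) ^+ 2) ->
  is_derive y 1 phi a.
Proof.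
move=> H.
have L : h^-1 *: ((phi \o shift y) (h *: (1 : R)) - phi y) @[h --> 0^'] --> a.
  apply/cvgrPdist_le => e e0; near=> h => /=.
  have h0 : h != 0 by near: h; exact: nbhs_dnbhs_neq.
  have he : `|h| < e by near: h; exact: dnbhs0_lt.
  rewrite [_%:A]mulr1 -normrN opprB.
  have -> : h^-1 *: (phi (h + y) - phi y) - a =
            h^-1 * (phi (h + y) - phi y - a * ((h + y) - y)).
    by rewrite addrK mulrBr mulrCA mulVf // mulr1.
  have := H (h + y); rewrite addrK => Hh.
  rewrite normrM normfV ler_pdivrMl ?normr_gt0 // (le_trans Hh) //.
  by rewrite -[h ^+ 2]ger0_norm ?sqr_ge0 // normrX expr2 ler_wpM2l // ltW.
split; first by apply/cvg_ex; exists a.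
exact: cvg_lim L.
Unshelve. all: by end_near. Qed.

Lemma is_derive_pos2 (y : R) : is_derive y 1 (fun y => pos y ^+ 2) (2 * pos y).
Proof.
apply: is_derive_quadratic => z; rewrite ler_norml.
have := sqr_ge0 (z - y).
case: (lerP y 0) => y0; case: (lerP z 0) => z0;
  rewrite ?(pos_eq0 y0) ?(pos_eq0 z0) ?(pos_eq (ltW y0)) ?(pos_eq (ltW z0));
  move=> ?; apply/andP; split; nra.
Qed.

Lemma C1_pos2 f p : C1 f p ->
  C1 (fun x => pos (f x) ^+ 2) (fun j x => 2 * pos (f x) * p j x).
Proof.
move=> Cf; have := @C1_comp f p (fun y => pos y ^+ 2) (fun y => 2 * pos y) Cf.
apply; first by move=> x; exact: is_derive_pos2.
move=> x; apply: (@continuousM _ _ (fun=> 2) (fun x => pos (f x))); first exact: cst_continuous.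
apply: (@continuous_comp _ _ _ f pos); last exact: pos_continuous.
by case: Cf => cf _ _; exact: cf.
Qed.

(** Since [pos y * y = pos y ^+ 2], the cube is the product of [f] and the square already
    treated. *)
Lemma C1_pos3 f p : C1 f p ->
  C1 (fun x => pos (f x) ^+ 3) (fun j x => 3 * pos (f x) ^+ 2 * p j x).
Proof.
move=> Cf; have := C1_mul Cf (C1_pos2 Cf).
move/C1_ext; apply => [x|j x].
  by have := pos_mul (f x) => E; ring: E.
by have := pos_mul (f x) => E; ring: E.
Qed.

Definition in_box (M : R) : set 'rV[R]_3 := [set x | forall i, `|x 0 i| <= M].

Lemma in_box_compact M : compact (in_box M).
Proof.
rewrite (_ : in_box M = [set v : 'rV[R]_3 | forall i, `[(- M), M]%classic (v ord0 i)]).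
  by apply: (@rV_compact _ _ (fun=> `[(- M), M]%classic)) => i; exact: segment_compact.
by apply/seteqP; split=> x /= H i; have := H i; rewrite in_itv /= ler_norml.
Qed.

Lemma norm_mxP x (e : R) : 0 <= e -> (`|x| <= e) = [forall i, `|x 0 i| <= e].
Proof.
move=> e0; apply/idP/forallP.
  move=> xe i; apply: le_trans xe.
  rewrite [leRHS]/Num.Def.normr /= mx_normrE.
  by apply: (@le_bigmax _ _ _ 0 (fun ij : 'I_1 * 'I_3 => `|x ij.1 ij.2|) (0, i)).
by move=> H; rewrite /Num.Def.normr /= mx_normrE; apply: bigmax_le => // -[i j] _ /=; rewrite (ord1 i).
Qed.

(** Only [x] is confined to the box: its neighbours, such as shifted grid points, may leave it. *)
Lemma unif_cont_box f (M e : R) : continuous f -> 0 < e ->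
  exists2 d, 0 < d & forall x (y : 'rV[R]_3), in_box M x ->
    (forall i, `|x 0 i - y 0 i| <= d) -> `|f x - f y| <= e.
Proof.
move=> cf e0.
have e2 : 0 < e / 2 by rewrite divr_gt0.
have /compact_near_coveringP /(_ R (nbhs 0^'+)
  (fun d x => forall y, `|x - y| <= d -> `|f x - f y| <= e) _) H := @in_box_compact M.
have {}H := H _.
near (0 : R)^'+ => d; exists d => //.
have Hd : in_box M `<=` (fun x => forall y, `|x - y| <= d -> `|f x - f y| <= e).
  near: d; apply: H => x xM.
  have /cvgrPdist_le /(_ _ e2) := cf x.
  rewrite -nbhs_ballE => -[r /= r0 rP].
  exists (ball x (r / 2), [set d | d < r / 2]) => /=.
    split; first by apply: nbhsx_ballx; rewrite divr_gt0.
    by apply: nbhs_right_lt; rewrite divr_gt0.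
  move=> [x' t] /= [xx' tr] y x'y.
  have h1 := rP x'; have h2 := rP y.
  rewrite -[f x' - f y](subrKA (f x)) (le_trans (ler_normD _ _)) // (splitr e) lerD //.
    rewrite distrC; apply: h1.
    have rr : r / 2 <= r by lra.
    exact: (le_ball rr).
  apply: h2; rewrite (splitr r); apply: (@ball_triangle _ _ x') => //.
  by rewrite -ball_normE /=; apply: le_lt_trans tr.
move=> x y xM xy; apply: Hd => //.
have d0 : 0 <= d by near: d; exact: nbhs_right_ge.
by rewrite norm_mxP //; apply/forallP => i; rewrite !mxE.
Unshelve. all: by end_near. Qed.

Lemma bounded_box f (M : R) : continuous f ->
  exists2 C, 0 < C & forall x, in_box M x -> `|f x| <= C.
Proof.
move=> cf.
have /compact_bounded : compact (f @` in_box M).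
  by apply: continuous_compact; [exact: continuous_subspaceT|exact: in_box_compact].
move=> [B [_ HB]]; exists (`|B| + 1); first by rewrite ltr_wpDl.
move=> x xM; apply: (HB (`|B| + 1)); last by exists x.
by rewrite (le_lt_trans (ler_norm B)) // ltrDl.
Qed.

Lemma MVT_axis f p x j (h : R) : C1 f p -> 0 <= h ->
  exists2 t, 0 <= t <= h &
    f (h *: evec j + x) - f x = h * p j (t *: evec j + x).
Proof.
move=> [cf cp df] h0.
have D (t : R) : is_derive t 1 (fun s : R => f (s *: evec j + x)) (p j (t *: evec j + x)).
  have [d1 d2] := (is_derive_lineP _ _ _ _).1 (df j (t *: evec j + x)).
  have E : (fun s : R => f (s *: evec j + x)) =
           (fun s : R => f (s *: evec j + (t *: evec j + x))) \o shift (- t).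
    by apply/funext => s /=; rewrite addrA -scalerDl addrNK.
  rewrite E.
  have := @is_derive1_comp _ (fun s : R => f (s *: evec j + (t *: evec j + x))) (shift (- t)) t (p j (t *: evec j + x)) 1.
  rewrite mulr1; apply.
    by rewrite /shift /= subrr; split.
  have h1 : is_derive t 1 ((id : R -> R) + cst (- t)) (1 + 0) by apply: is_deriveD.
  by rewrite addr0 in h1.
have [|t th E] := @MVT_segment _ (fun s : R => f (s *: evec j + x))
  (fun t => p j (t *: evec j + x)) 0 h h0 (fun t _ => D t).
  apply: continuous_subspaceT => s.
  by apply/differentiable_continuous/derivable1_diffP; case: (D s).
exists t; first by move: th; rewrite in_itv.
by move: E; rewrite scale0r add0r subr0 mulrC.
Qed.

End C1_calculus.

(** * Upper Riemann integrals *)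

Section grid.
Context {R : realType}.
Implicit Types (f g : 'rV[R]_3 -> R) (x : 'rV[R]_3) (n : nat).

Definition mesh n : R := n.+1%:R^-1.
(** The nodes with indices below [gsize n] are the lower corners of half-open cells tiling
    [[-4,4)^3]. This box leaves room for cubes of half-side 5/2 centred in the unit ball. *)
Definition gcoord n (i : nat) : R := -4 + i%:R * mesh n.
Definition gpoint n (i j k : nat) : 'rV[R]_3 :=
  vec3 (gcoord n i) (gcoord n j) (gcoord n k).
Definition gsize n := (8 * n.+1)%N.

Definition sum3 N (F : nat -> nat -> nat -> R) : R :=
  \sum_(i < N) \sum_(j < N) \sum_(k < N) F i j k.

Definition riemann n f : R := mesh n ^+ 3 * sum3 (gsize n) (fun i j k => f (gpoint n i j k)).

Lemma mesh_gt0 n : 0 < mesh n. Proof. by rewrite invr_gt0 ltr0n. Qed.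

Lemma mesh_small (d : R) : 0 < d -> \forall n \near \oo, mesh n <= d.
Proof.
move=> d0; near=> n.
rewrite /mesh -[d]invrK lef_pV2 ?posrE ?invr_gt0 ?ltr0n //.
apply: le_trans (ltW (archi_boundP _)) _; first by rewrite invr_ge0 ltW.
by rewrite ler_nat; near: n; exact: nbhs_infty_ge.
Unshelve. all: by end_near. Qed.

Lemma sum3_le N F G : (forall i j k, (i < N)%N -> (j < N)%N -> (k < N)%N -> F i j k <= G i j k) ->
  sum3 N F <= sum3 N G.
Proof.
by move=> H; apply: ler_sum => i _; apply: ler_sum => j _; apply: ler_sum => k _; apply: H.
Qed.

Lemma sum3_add N F G : sum3 N (fun i j k => F i j k + G i j k) = sum3 N F + sum3 N G.
Proof.
rewrite -big_split; apply: eq_bigr => i _; rewrite -big_split; apply: eq_bigr => j _.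
by rewrite -big_split.
Qed.

Lemma sum3_scale N (a : R) F : sum3 N (fun i j k => a * F i j k) = a * sum3 N F.
Proof.
rewrite /sum3 mulr_sumr; apply: eq_bigr => i _; rewrite mulr_sumr; apply: eq_bigr => j _.
by rewrite mulr_sumr.
Qed.

Lemma sum3_rot N F : sum3 N F = sum3 N (fun j k i => F i j k).
Proof.
rewrite /sum3 exchange_big; apply: eq_bigr => j _; exact: exchange_big.
Qed.

Lemma sum3_cst N (a : R) : sum3 N (fun _ _ _ => a) = N%:R ^+ 3 * a.
Proof. by rewrite /sum3 !sumr_const !card_ord -[in RHS]natrX mulr_natl -!mulrnA; congr (_ *+ _); rewrite !expnS expn0 muln1 mulnA. Qed.

Lemma vec3E (a b c : R) : (vec3 a b c 0 0 = a) * (vec3 a b c 0 1 = b) * (vec3 a b c 0 2%:R = c).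
Proof. by rewrite !mxE. Qed.

Lemma ord3P (j : 'I_3) : [\/ j = 0, j = 1 | j = 2%:R].
Proof.
by case: j => [[|[|[|]]]] // ?; [constructor 1|constructor 2|constructor 3]; apply/val_inj.
Qed.

Lemma eq_rV3 x (y : 'rV[R]_3) : x 0 0 = y 0 0 -> x 0 1 = y 0 1 -> x 0 2%:R = y 0 2%:R -> x = y.
Proof. by move=> h0 h1 h2; apply/rowP => j; case: (ord3P j) => ->. Qed.

Lemma sumr3 (V : nmodType) (F : 'I_3 -> V) : \sum_(j < 3) F j = F 0 + F 1 + F 2%:R.
Proof.
rewrite !big_ord_recl big_ord0 addr0 addrA; congr (F _ + F _ + F _); exact/val_inj.
Qed.

Lemma gcoordS n i : gcoord n i.+1 = mesh n + gcoord n i.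
Proof. by rewrite /gcoord -natr1; ring. Qed.

Lemma gcoord0 n : gcoord n 0 = -4. Proof. by rewrite /gcoord mul0r addr0. Qed.

Lemma gcoord_size n : gcoord n (gsize n) = 4.
Proof.
by rewrite /gcoord /gsize natrM /mesh mulfK ?pnatr_eq0 //; lra.
Qed.

Lemma gcoord_box n i : (i <= gsize n)%N -> `|gcoord n i| <= 4.
Proof.
move=> iN; have h0 := mesh_gt0 n.
have : 0 <= i%:R * mesh n by rewrite mulr_ge0 // ltW.
have : gcoord n i <= 4.
  by rewrite -(gcoord_size n) lerD2l ler_wpM2r ?ler_nat // ltW.
by rewrite /gcoord ler_norml => *; apply/andP; split; lra.
Qed.

Lemma gpoint_box n i j k : (i < gsize n)%N -> (j < gsize n)%N -> (k < gsize n)%N ->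
  in_box 4 (gpoint n i j k).
Proof.
by move=> /ltnW hi /ltnW hj /ltnW hk l; case: (ord3P l) => ->; rewrite vec3E gcoord_box.
Qed.

Lemma gpoint_shift0 n i j k : gpoint n i.+1 j k = mesh n *: evec 0 + gpoint n i j k.
Proof. by apply: eq_rV3; rewrite !mxE /= ?gcoordS ?mulr1 ?mulr0 ?add0r. Qed.
Lemma gpoint_shift1 n i j k : gpoint n i j.+1 k = mesh n *: evec 1 + gpoint n i j k.
Proof. by apply: eq_rV3; rewrite !mxE /= ?gcoordS ?mulr1 ?mulr0 ?add0r. Qed.
Lemma gpoint_shift2 n i j k : gpoint n i j k.+1 = mesh n *: evec 2%:R + gpoint n i j k.
Proof. by apply: eq_rV3; rewrite !mxE /= ?gcoordS ?mulr1 ?mulr0 ?add0r. Qed.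

Lemma riemann_le n f g : (forall x, in_box 4 x -> f x <= g x) -> riemann n f <= riemann n g.
Proof.
move=> fg; apply: ler_wpM2l; first by rewrite exprn_ge0 // ltW // mesh_gt0.
by apply: sum3_le => i j k *; apply: fg; exact: gpoint_box.
Qed.

Lemma riemann_add n f g : riemann n (fun x => f x + g x) = riemann n f + riemann n g.
Proof. by rewrite /riemann sum3_add mulrDr. Qed.

Lemma riemann_scale n a f : riemann n (fun x => a * f x) = a * riemann n f.
Proof. by rewrite /riemann sum3_scale mulrCA. Qed.

Lemma riemann_cst n a : riemann n (fun=> a) = 512 * a.
Proof.
rewrite /riemann sum3_cst mulrA -exprMn /gsize natrM /mesh mulrCA mulVf ?pnatr_eq0 //.
by rewrite mulr1; congr (_ * a); rewrite -natrX.
Qed.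

Lemma sum3_telescope N (F : nat -> nat -> nat -> R) :
  (forall j k, F N j k = F 0%N j k) -> sum3 N (fun i j k => F i.+1 j k - F i j k) = 0.
Proof.
move=> H; rewrite sum3_rot /sum3; rewrite big1 // => j _; rewrite big1 // => k _.
rewrite -(big_mkord xpredT (fun i => F i.+1 j k - F i j k)).
by rewrite (telescope_sumr (fun i => F i j k)) // H subrr.
Qed.

(** Differences along an axis telescope, and the two end layers, at [-4] and [4], lie where [f]
    vanishes. *)
Lemma riemann_shift n f (j : 'I_3) :
  (forall x, ~ in_box 2 x -> f x = 0) ->
  riemann n (fun x => f (mesh n *: evec j + x) - f x) = 0.
Proof.
move=> f0.
have out i k l : [\/ (i == 0)%N || (i == gsize n)%N, (k == 0)%N || (k == gsize n)%N |
    (l == 0)%N || (l == gsize n)%N] -> f (gpoint n i k l) = 0.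
  have B m : (m == 0)%N || (m == gsize n)%N -> 2 < `|gcoord n m|.
    by case/orP=> /eqP ->; rewrite ?gcoord0 ?gcoord_size ?normrN normr_nat ltr_nat.
  move=> H; apply: f0 => bx.
  by case: H => /B; rewrite ltNge => /negP; apply;
    [have := bx 0|have := bx 1|have := bx 2%:R]; rewrite vec3E.
rewrite /riemann; case: (ord3P j) => ->.
  have -> : (fun i k l => f (mesh n *: evec 0 + gpoint n i k l) - f (gpoint n i k l)) =
    (fun i k l => f (gpoint n i.+1 k l) - f (gpoint n i k l)).
    by apply/funext => i; apply/funext => k; apply/funext => l; rewrite gpoint_shift0.
  rewrite (@sum3_telescope _ (fun i k l => f (gpoint n i k l))) ?mulr0 // => k l.
  by rewrite !out //; constructor 1; rewrite eqxx ?orbT.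
- have -> : (fun i k l => f (mesh n *: evec 1 + gpoint n i k l) - f (gpoint n i k l)) =
    (fun i k l => f (gpoint n i k.+1 l) - f (gpoint n i k l)).
    by apply/funext => i; apply/funext => k; apply/funext => l; rewrite gpoint_shift1.
  rewrite sum3_rot (@sum3_telescope _ (fun k l i => f (gpoint n i k l))) ?mulr0 // => k l.
  by rewrite !out //; constructor 2; rewrite eqxx ?orbT.
- have -> : (fun i k l => f (mesh n *: evec 2%:R + gpoint n i k l) - f (gpoint n i k l)) =
    (fun i k l => f (gpoint n i k l.+1) - f (gpoint n i k l)).
    by apply/funext => i; apply/funext => k; apply/funext => l; rewrite gpoint_shift2.
  rewrite 2!sum3_rot (@sum3_telescope _ (fun l i k => f (gpoint n i k l))) ?mulr0 // => k l.
  by rewrite !out //; constructor 3; rewrite eqxx ?orbT.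
Qed.

End grid.

(* Limits along an ultrafilter finer than [\oo] exist for every bounded sequence. *)
Definition ultra : set_system nat := projT1 (cid (ultraFilterLemma eventually_filter)).

#[global] Instance ultra_ultra : UltraFilter ultra.
Proof. by rewrite /ultra; case: cid => /= U []. Qed.

Lemma oo_ultra : \oo `<=` ultra.
Proof. by rewrite /ultra; case: cid => /= U []. Qed.

Section upper_integral.
Context {R : realType}.
Implicit Types (f g : 'rV[R]_3 -> R) (x : 'rV[R]_3) (n : nat).

(* "The upper integral of [f] over [-4,4]^3 is at most [c]": a monotone sublinear substitute for
   integration that needs no measurability, as [f] ranges over arbitrary functions. *)
Definition upint f (c : R) : Prop := forall e, 0 < e -> ultra [set n | riemann n f <= c + e].

Lemma upint_le f g c : (forall x, in_box 4 x -> f x <= g x) -> upint g c -> upint f c.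
Proof.
move=> fg gc e e0; apply: filterS (gc e e0) => n /=; apply: le_trans; exact: riemann_le.
Qed.

Lemma upint_weak f c d : c <= d -> upint f c -> upint f d.
Proof.
move=> cd fc e e0; apply: filterS (fc e e0) => n /= /le_trans; apply; exact: lerD.
Qed.

Lemma upint_add f g c d : upint f c -> upint g d -> upint (fun x => f x + g x) (c + d).
Proof.
move=> fc gd e e0; have e2 : 0 < e / 2 by rewrite divr_gt0.
apply: filterS2 (fc _ e2) (gd _ e2) => n /= h1 h2; rewrite riemann_add.
by have := lerD h1 h2; lra.
Qed.

Lemma upint_scale a f c : 0 <= a -> upint f c -> upint (fun x => a * f x) (a * c).
Proof.
rewrite le_eqVlt => /orP[/eqP <-|a0] fc e e0.
  by apply: filterE => n /=; rewrite riemann_scale !mul0r add0r ltW.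
have ea : 0 < e / a by rewrite divr_gt0.
apply: filterS (fc _ ea) => n /= H; rewrite riemann_scale.
apply: le_trans (_ : a * (c + e / a) <= _); first by rewrite ler_wpM2l // ltW.
by rewrite mulrDr mulrCA divff ?mulr1 // gt_eqF.
Qed.

Lemma upint_cst a : upint (fun=> a) (512 * a).
Proof. by move=> e e0; apply: filterE => n /=; rewrite riemann_cst lerDl ltW. Qed.

Lemma upint_cst_le a c : upint (fun=> a) c -> 512 * a <= c.
Proof.
move=> H; apply/ler_addgt0Pr => e e0.
have /filter_ex[n /=] := H e e0; by rewrite riemann_cst.
Qed.

Lemma upint_approx f c : (forall e, 0 < e -> upint f (c + e)) -> upint f c.
Proof.
move=> H e e0; have e2 : 0 < e / 2 by rewrite divr_gt0.
apply: filterS (H _ e2 _ e2) => n /=; rewrite -addrA; by rewrite -splitr.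
Qed.

Lemma upint_sum m (f : 'I_m -> 'rV[R]_3 -> R) c : (forall i, upint (f i) (c i)) ->
  upint (fun x => \sum_(i < m) f i x) (\sum_(i < m) c i).
Proof.
elim: m f c => [|m IH] f c H.
  rewrite big_ord0; have := upint_cst 0; rewrite mulr0; apply: upint_le => x _.
  by rewrite big_ord0.
rewrite big_ord_recr /=.
have := upint_add (IH _ _ (fun i => H (widen_ord (leqnSn m) i))) (H ord_max).
by apply: upint_le => x _; rewrite big_ord_recr.
Qed.

Lemma upint_near f c : (forall e, 0 < e -> \forall n \near \oo, riemann n f <= c + e) -> upint f c.
Proof. by move=> H e e0; apply: oo_ultra; exact: H. Qed.

(** By the mean value theorem and uniform continuity, [p j] is within [e / 512] of a forward
    difference quotient whose Riemann sum is exactly 0; 512 is the volume of the box. *)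
Lemma upint_parts f p j : C1 f p -> (forall x, ~ in_box 2 x -> f x = 0) -> upint (p j) 0.
Proof.
move=> Cf f0; apply: upint_near => e e0; rewrite add0r.
have e1 : 0 < e / 512 by lra.
have [cf cp df] := Cf.
have [d d0 dP] := unif_cont_box 4 (cp j) e1.
near=> n.
have hd : mesh n <= d by near: n; exact: mesh_small.
have h0 : 0 < mesh n :> R by apply: mesh_gt0.
have -> : e = riemann n (fun x => e / 512 + (mesh n)^-1 * (f (mesh n *: evec j + x) - f x)).
  rewrite riemann_add riemann_cst riemann_scale riemann_shift //; lra.
apply: riemann_le => x bx.
have [t /andP[t0 th] ->] := MVT_axis x j Cf (ltW h0).
rewrite mulKf ?gt_eqF // -lerBlDr.
apply: le_trans (ler_norm _) _; apply: dP => // i.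
rewrite distrC !mxE addrK normrM eqxx /=.
case: eqP => _; rewrite ?normr0 ?mulr0 ?normr1 ?mulr1 ?(ltW d0) //.
by rewrite ger0_norm // (le_trans th).
Unshelve. all: by end_near. Qed.

End upper_integral.

(** * Divergence inequality on the ball *)

Section cutoffs.
Context {R : realType}.
Implicit Types (f g : 'rV[R]_3 -> R) (x : 'rV[R]_3) (n : nat).

Definition sqn x : R := \sum_(i < 3) x 0 i ^+ 2.

Definition inball x : bool := sqn x < 1.
Definition inshell (d : R) x : bool := 1 - d <= sqn x <= 1 + d.

Lemma sqnE x : sqn x = x 0 0 ^+ 2 + x 0 1 ^+ 2 + x 0 2%:R ^+ 2.
Proof. by rewrite /sqn sumr3. Qed.

Lemma sqn_ge0 x : 0 <= sqn x.
Proof. by apply: sumr_ge0 => i _; exact: sqr_ge0. Qed.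

Lemma sqr_coord_le x i : x 0 i ^+ 2 <= sqn x.
Proof.
rewrite sqnE; have := sqr_ge0 (x 0 0); have := sqr_ge0 (x 0 1); have := sqr_ge0 (x 0 2%:R).
by case: (ord3P i) => -> *; lra.
Qed.

Lemma coord_le x i (M : R) : 0 <= M -> sqn x <= M ^+ 2 -> `|x 0 i| <= M.
Proof.
move=> M0 H; rewrite -ler_sqr ?nnegrE // real_normK ?num_real //.
exact: le_trans (sqr_coord_le x i) H.
Qed.

Lemma C1_sqn : C1 sqn (fun j x => 2 * x 0 j).
Proof.
apply: (C1_ext (C1_sum (fun i => C1_exp 1 (C1_coord i)))) => // j x.
by rewrite sumr3; case: (ord3P j) => -> /=; rewrite expr1; ring.
Qed.

(* Quadratic spline increasing from 0 on y <= 0 to 1 on y >= 1; [hat] is its derivative. *)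
Definition ramp (y : R) : R := 2 * pos y ^+ 2 - 4 * pos (y - 2^-1) ^+ 2 + 2 * pos (y - 1) ^+ 2.
Definition hat (y : R) : R := 4 * (pos y - 2 * pos (y - 2^-1) + pos (y - 1)).

Lemma ramp_hat (y : R) : [\/ [/\ y <= 0, ramp y = 0 & hat y = 0],
  [/\ 0 <= y <= 1, 0 <= ramp y <= 1, 0 <= hat y & (4^-1 <= y <= 3 / 4) -> 1 <= hat y] |
  [/\ 1 <= y, ramp y = 1 & hat y = 0]].
Proof.
rewrite /ramp /hat; case: (lerP y 0) => y0; last case: (lerP y 2^-1) => y2; last case: (lerP y 1) => y1.
- constructor 1; rewrite !pos_eq0; try lra.
  by split=> //; ring.
- constructor 2; rewrite (@pos_eq _ y) ?(@pos_eq0 _ (y - 2^-1)) ?(@pos_eq0 _ (y - 1)); try lra.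
  split; [lra|apply/andP; split; nra|lra|move=> /andP[]; lra].
- constructor 2; rewrite (@pos_eq _ y) ?(@pos_eq _ (y - 2^-1)) ?(@pos_eq0 _ (y - 1)); try lra.
  split; [lra|apply/andP; split; nra|lra|move=> /andP[]; lra].
- constructor 3; rewrite !pos_eq; try lra.
  by split; [lra|field|field].
Qed.

Lemma ramp_le0 (y : R) : y <= 0 -> ramp y = 0.
Proof. by move=> y0; rewrite /ramp !pos_eq0; try lra; ring. Qed.

Lemma ramp_ge1 (y : R) : 1 <= y -> ramp y = 1.
Proof. by move=> y0; rewrite /ramp !pos_eq; try lra; field. Qed.

Lemma C1_ramp f p : C1 f p -> C1 (fun x => ramp (f x)) (fun j x => hat (f x) * p j x).
Proof.
move=> Cf.
have C2 (c k : R) : C1 (fun x => k * pos (f x - c) ^+ 2)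
    (fun j x => k * (2 * pos (f x - c) * p j x)).
  apply: (C1_ext (C1_mul (C1_cst k) (C1_pos2 (C1_sub Cf (C1_cst c))))) => // j x.
  by rewrite mul0r add0r subr0.
apply: (C1_ext (C1_add (C1_sub (C2 0 2) (C2 2^-1 4)) (C2 1 2))) => [x|j x].
  by rewrite subr0.
by rewrite /hat subr0; ring.
Qed.

Lemma not_in_box (M : R) x : 0 <= M -> ~ in_box M x -> M ^+ 2 <= sqn x.
Proof.
move=> M0 /existsNP[i /negP]; rewrite -ltNge => /ltW Mi.
apply: le_trans (sqr_coord_le x i); rewrite -(@real_normK _ (x 0 i)) ?num_real //.
by rewrite ler_sqr ?nnegrE.
Qed.

(** For [g > 0], [ramp (radial b g x)] is a cutoff equal to 1 where [|x|^2 <= b - g] and to 0 where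
    [|x|^2 >= b]. *)
Definition radial (b g : R) x : R := (b - sqn x) / g.

Lemma C1_radial (b g : R) : C1 (radial b g) (fun j x => - (2 * x 0 j / g)).
Proof.
apply: (C1_ext (C1_mul (C1_sub (C1_cst b) C1_sqn) (C1_cst g^-1))) => // j x.
by ring.
Qed.

End cutoffs.

Section divergence.
Context {R : realType}.
Implicit Types (f : 'rV[R]_3 -> R) (x : 'rV[R]_3).

(** The field [x ramp(y)], with [y = radial b g x], has divergence [3 ramp(y) - 2 |x|^2 hat(y) / g],
    whose integral vanishes; and [3 * 512 = 1536]. The bound on [b] puts the support in
    [[-2,2]^3]. *)
Lemma upint_hat (b g : R) : 0 < g -> b <= 4 ->
  upint (fun x => 2 * sqn x / g * hat (radial b g x)) 1536.
Proof.
move=> g0 b4.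
have Cr := C1_ramp (C1_radial b g).
have D (j : 'I_3) := upint_parts j (C1_opp (C1_mul (C1_coord j) Cr)).
have := upint_add (upint_sum (fun j => D j _)) (upint_cst 3).
rewrite sumr3 !add0r => H.
apply: upint_weak (upint_le _ (H _)) => [|x _|j x nb]; first by lra.
  rewrite sumr3 !eqxx /= sqnE.
  have : ramp (radial b g x) <= 1 by case: (ramp_hat (radial b g x)) => -[]; lra.
  set r := ramp _; set h := hat _ => r1.
  have -> : 2 * (x 0 0 ^+ 2 + x 0 1 ^+ 2 + x 0 2%:R ^+ 2) / g * h =
   -(x 0 0 * (h * - (2 * x 0 0 / g)) + x 0 1 * (h * - (2 * x 0 1 / g)) + x 0 2%:R * (h * - (2 * x 0 2%:R / g))) by ring.
  by rewrite !mulr1n; lra.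
have : radial b g x <= 0.
  rewrite /radial pmulr_lle0 ?invr_gt0 // subr_le0 (le_trans b4) //.
  by have := not_in_box (ler0n _ _) nb; rewrite -natrX.
by move/ramp_le0 ->; rewrite mulr0 oppr0.
Qed.

(** With [b = 1 + 2 d] and [g = 4 d] the argument of [hat] runs through [[1/4, 3/4]] on the shell,
    where [hat >= 1]; moreover [2 |x|^2 >= 1] there. *)
Lemma upint_shell (d : R) : 0 < d -> d <= 2^-1 ->
  upint (fun x => (inshell d x)%:R) (6144 * d).
Proof.
move=> d0 d1.
have g0 : 0 < 4 * d by lra.
have b4 : 1 + 2 * d <= 4 by lra.
have H := upint_scale (ltW g0) (upint_hat g0 b4).
apply: upint_weak (upint_le _ H); first by lra.
move=> x _; set y := radial _ _ x.
have yE : y * (4 * d) = 1 + 2 * d - sqn x by rewrite /y /radial divfK // gt_eqF.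
have -> : 4 * d * (2 * sqn x / (4 * d) * hat y) = 2 * sqn x * hat y.
  by field; rewrite gt_eqF.
have s0 := sqn_ge0 x.
rewrite /inshell; case: andP => [[h1 h2]|_] /=; last first.
  by apply: mulr_ge0; [lra|case: (ramp_hat y) => -[] => *; lra].
have y1 : 4^-1 <= y by nra.
have y2 : y <= 3 / 4 by nra.
have : 1 <= hat y.
  by case: (ramp_hat y) => -[]; [lra|move=> _ _ _; apply; rewrite y1 y2|lra].
by move=> h; rewrite mulr1n; nra.
Qed.

Lemma near_sphere f (e : R) : continuous f -> (forall x, sqn x = 1 -> f x <= 0) -> 0 < e ->
  exists d, [/\ 0 < d, d <= 2^-1 & forall x, 1 - d <= sqn x <= 1 -> f x <= e].
Proof.
move=> cf f0 e0; have [d d0 dP] := unif_cont_box 1 cf e0.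
exists (Num.min (d / 2) 2^-1); split.
- by rewrite lt_min divr_gt0 //= invr_gt0 ltr0n.
- by rewrite ge_min lexx orbT.
move=> x /andP[x1 x2].
set m := Num.min _ _ in x1.
have m1 : m <= d / 2 by rewrite /m ge_min lexx.
have m2 : m <= 2^-1 by rewrite /m ge_min lexx orbT.
have s0 : 0 < sqn x by lra.
set r := Num.sqrt (sqn x).
have r0 : 0 < r by rewrite sqrtr_gt0.
have rE : r ^+ 2 = sqn x by rewrite sqr_sqrtr // ltW.
have y1 : sqn (r^-1 *: x) = 1.
  rewrite sqnE !mxE !exprMn -!mulrDr -sqnE -rE -exprMn mulVf ?expr1n //.
  by rewrite gt_eqF.
have bx : in_box 1 x by move=> i; apply: coord_le => //; rewrite expr1n.
have : forall i : 'I_3, `|x 0 i - (r^-1 *: x) 0 i| <= d; last first.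
  by move=> /(dP _ _ bx); have := f0 _ y1; move=> h1; rewrite ler_norml => /andP[]; lra.
move=> i.
have xi : `|x 0 i| <= r.
  by apply: coord_le; [exact: ltW|rewrite rE].
have -> : x 0 i - (r^-1 *: x) 0 i = x 0 i * (1 - r^-1) by rewrite !mxE; ring.
have r1 : r <= 1 by nra.
rewrite normrM; have -> : `|1 - r^-1| = r^-1 - 1.
  by rewrite ler0_norm ?opprB // subr_le0 invf_ge1 //.
apply: le_trans (_ : r * (r^-1 - 1) <= d).
  by rewrite ler_wpM2r // subr_ge0 invf_ge1.
rewrite mulrBr divff ?gt_eqF // mulr1; nra.
Qed.

(** Multiply [F] by a cutoff that falls from 1 to 0 in a thin shell inside the sphere. Replacing the
    cutoff by the indicator of the ball costs at most the volume of the shell times a bound for the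
    divergence. The derivative of the cutoff contributes [(2 / m) hat (x . F)], where [x . F] is
    almost nonpositive near the sphere. No surface integral is needed. *)
Lemma divergence_le (F : 'I_3 -> 'rV[R]_3 -> R) (P : 'I_3 -> 'I_3 -> 'rV[R]_3 -> R) :
  (forall j, C1 (F j) (P j)) ->
  (forall x, sqn x = 1 -> \sum_(j < 3) x 0 j * F j x <= 0) ->
  upint (fun x => (inball x)%:R * \sum_(j < 3) P j j x) 0.
Proof.
move=> CF Fb; apply: upint_approx => e e0; rewrite add0r.
(* [k] will bound [x . F] near the sphere: through [upint_hat] it costs [2 k * 1536 = e / 2], and
   the shell takes the other half. *)
have [k k0 kE] : exists2 k, 0 < k & e = k * (4 * 1536) by exists (e / (4 * 1536)); lra.
have Cf1 : C1 (fun x => \sum_(j < 3) x 0 j * F j x) _ := C1_sum (fun j => C1_mul (C1_coord j) (CF j)).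
have [d [d0 d1 dP]] := near_sphere (C1_continuous Cf1) Fb k0.
have cdiv : continuous (fun x => P 0 0 x + P 1 1 x + P 2%:R 2%:R x).
  move=> x; apply: (@continuousD _ _ _ (fun x => P 0 0 x + P 1 1 x) (P 2%:R 2%:R)).
    by apply: (@continuousD _ _ _ (P 0 0) (P 1 1)); [case: (CF 0)|case: (CF 1)] => _ + _; apply.
  by case: (CF 2%:R) => _ + _; apply.
have [M M0 MP] := bounded_box 4 cdiv.
have M1 : 0 < 2 * M * 6144 by lra.
have [m [m0 md mM]] : exists m, [/\ 0 < m, m <= d & M * (6144 * m) <= e / 2].
  exists (Num.min d (e / (2 * M * 6144))); split.
  - by rewrite lt_min d0 divr_gt0.
  - by rewrite ge_min lexx.
  - have : Num.min d (e / (2 * M * 6144)) <= e / (2 * M * 6144) by rewrite ge_min lexx orbT.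
    by rewrite ler_pdivlMr //; lra.
have Cr := C1_ramp (C1_radial 1 m).
have D (j : 'I_3) := upint_parts j (C1_mul Cr (CF j)).
have k2 : 0 <= 2 * k by rewrite mulr_ge0 // ltW.
have b4 : 1 <= 4 :> R by rewrite ler1n.
have H := upint_add (upint_add (upint_sum (fun j => D j _))
   (upint_scale (ltW M0) (upint_shell m0 (le_trans md d1))))
   (upint_scale k2 (upint_hat m0 b4)).
apply: upint_weak (upint_le _ (H _)); rewrite ?sumr3.
- by clear -kE mM; lra.
- move=> x bx; rewrite !sumr3; set y := radial 1 m x.
  have yE : y * m = 1 - sqn x by rewrite /y /radial divfK // gt_eqF.
  have s0 := sqn_ge0 x.
  set f1 := P 0 0 x + P 1 1 x + P 2%:R 2%:R x.
  set f2 := \sum_(j < 3) x 0 j * F j x.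
  have MPx : `|f1| <= M by exact: MP.
  rewrite (_ : hat y * - (2 * x 0 0 / m) * F 0 x + ramp y * P 0 0 x +
     (hat y * - (2 * x 0 1 / m) * F 1 x + ramp y * P 1 1 x) +
     (hat y * - (2 * x 0 2%:R / m) * F 2%:R x + ramp y * P 2%:R 2%:R x) =
     ramp y * f1 - 2 / m * hat y * f2); last first.
    by rewrite /f1 /f2 sumr3; ring.
  have -> : 2 * k * (2 * sqn x / m * hat y) = 2 / m * hat y * (2 * k * sqn x) by ring.
  have m2 : 0 < 2 / m by rewrite divr_gt0.
  have [h0 h1] : 0 <= hat y /\ (hat y != 0 -> f2 <= 2 * k * sqn x).
    case: (ramp_hat y) => -[] => [_ _ ->|/andP[y0 y1] _ h _|_ _ ->]; rewrite ?eqxx //.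
    have ym0 : 0 <= y * m by rewrite mulr_ge0 // ltW.
    have ym1 : y * m <= m by rewrite ger_pMl.
    have s1 : 1 <= 2 * sqn x by clear -yE ym1 md d1; lra.
    split=> // _; apply: (@le_trans _ _ k); last first.
      by rewrite -[X in X <= _]mulr1 -mulrA mulrCA ler_wpM2l // ltW.
    by apply: dP; clear -yE ym1 ym0 md d1; apply/andP; split; lra.
  have {h1} : 2 / m * hat y * f2 <= 2 / m * hat y * (2 * k * sqn x).
    have [->|/h1 ?] := eqVneq (hat y) 0; first by rewrite !(mulr0, mul0r).
    by rewrite ler_wpM2l // mulr_ge0 // ltW.
  move: MPx; rewrite ler_norml => /andP[M1' M2].
  have Ms : 0 <= M * (inshell m x)%:R by rewrite mulr_ge0 ?ler0n // ltW.
  move: (2 / m * hat y * f2) (2 / m * hat y * (2 * k * sqn x)) => u v.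
  case: (ramp_hat y) => -[] => [y0 -> _|/andP[y0 y1] /andP[r0 r1] _ _|y1 -> _] uv.
  + have -> : inball x = false.
      rewrite /inball; apply/negbTE; rewrite -leNgt.
      have : y * m <= 0 by rewrite pmulr_lle0.
      by clear -yE; lra.
    by rewrite !mul0r; clear -Ms uv; lra.
  + have ym0 : 0 <= y * m by rewrite mulr_ge0 // ltW.
    have ym1 : y * m <= m by rewrite ger_pMl.
    have -> : inshell m x by rewrite /inshell; clear -yE ym1 ym0 m0; apply/andP; split; lra.
    move: (ramp y) r0 r1 => r r0 r1; clear -M1' M2 r0 r1 uv.
    by case: (inball x); rewrite /= ?mulr1n ?mul1r ?mul0r ?mulr1; nra.
  + have -> : inball x.
      rewrite /inball; have : m <= y * m by rewrite ler_peMl // ltW.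
      by clear -yE m0; lra.
    by rewrite mulr1n !mul1r; clear -Ms uv; lra.
- move=> j x nb.
  have : radial 1 m x <= 0.
    rewrite /radial pmulr_lle0 ?invr_gt0 // subr_le0.
    by have := not_in_box (ler0n _ _) nb; rewrite -natrX; lra.
  by move/ramp_le0 ->; rewrite mul0r.
Qed.

End divergence.

(** * Comparison with the Lebesgue integral *)

Section lebesgue_lower_sums.
Context {R : realType}.
Implicit Types (n : nat).
Local Notation mu := (@lebesgue_measure R).

(* No measurability is needed: both sides are suprema over simple functions. *)
Lemma ge0_le_integralT (f g : R -> \bar R) : (forall x, 0 <= f x)%E ->
  (forall x, f x <= g x)%E -> (\int[mu]_(x in setT) f x <= \int[mu]_(x in setT) g x)%E.
Proof.
move=> f0 fg; rewrite !ge0_integralTE //; last by move=> x; exact: le_trans (fg x).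
apply: le_ereal_sup => _ [h /= hf <-].
by exists h => //= x; exact: le_trans (hf x) (fg x).
Qed.

Lemma gcoord_lt n (i j : nat) : (gcoord n i <= gcoord n j :> R) = (i <= j)%N.
Proof. by rewrite /gcoord lerD2l ler_pM2r ?mesh_gt0 // ler_nat. Qed.

Definition cell n (i : nat) : set (measurableTypeR R) := [set` `[gcoord n i, gcoord n i.+1[].

Lemma cell_disj n (i j : nat) (t : R) : cell n i t -> cell n j t -> i = j.
Proof.
rewrite /cell /= !in_itv /= => /andP[i1 i2] /andP[j1 j2].
have := le_lt_trans i1 j2; have := le_lt_trans j1 i2.
rewrite !ltNge !gcoord_lt -!ltnNge !ltnS => h1 h2.
by apply/eqP; rewrite eqn_leq h1 h2.
Qed.

(** The cells are disjoint, so the step function with value [c i] on the cell [i] stays below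
    [f]. *)
Lemma lower_sum1 n N (c : nat -> R) (f : R -> \bar R) :
  (forall i, 0 <= c i) -> (forall t, 0 <= f t)%E ->
  (forall i t, (i < N)%N -> cell n i t -> (c i)%:E <= f t)%E ->
  ((\sum_(i < N) mesh n * c i)%:E <= \int[mu]_(t in setT) f t)%E.
Proof.
move=> c0 f0 cf.
have mc i : measurable (cell n i) by exact: measurable_itv.
have mI i : measurable_fun [set: measurableTypeR R]
    (fun t => (\1_(cell n i) t : R)%:E).
  by apply/measurable_EFinP; apply: measurable_indic; exact: mc.
have -> : (\sum_(i < N) mesh n * c i)%:E =
    (\int[mu]_(t in setT) (\sum_(i < N) ((c i)%:E * (\1_(cell n i) t)%:E)))%E.
  rewrite ge0_integral_sum //; last 2 first.
  - move=> i; apply: measurable_funeM; exact: mI.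
  - by move=> i t _; rewrite mule_ge0 ?lee_fin.
  rewrite -sumEFin; apply: eq_bigr => i _.
  rewrite ge0_integralZl_EFin; [|exact: measurableT|by move=> ? _; rewrite lee_fin|exact: mI|exact: c0].
  have mu_cell : mu (cell n i) = (mesh n)%:E.
    rewrite lebesgue_measure_itv /= lte_fin ltNge gcoord_lt ltnn /=.
    by rewrite -EFinB gcoordS addrK.
  rewrite integral_indic // setIT EFinM muleC; congr (_ * _)%E.
  exact: esym mu_cell.
apply: ge0_le_integralT => t.
  by apply: sume_ge0 => i _; rewrite mule_ge0 ?lee_fin.
have [[i [iN ti]]|H] := pselect (exists i, (i < N)%N /\ cell n i t); last first.
  rewrite big1 // => i _; rewrite indicE memNset ?mule0 // => ti.
  by apply: H; exists i.
rewrite (bigD1 (Ordinal iN)) //= big1 ?adde0.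
  by rewrite indicE mem_set // mule1; exact: cf.
move=> j ji; rewrite indicE memNset ?mule0 // => tj.
by move/eqP: ji; apply; apply/val_inj => /=; exact: cell_disj tj ti.
Qed.

Lemma lower_sum3 n N (m : nat -> nat -> nat -> R) (f : 'rV[R]_3 -> R) :
  (forall i j k, 0 <= m i j k) -> (forall x, 0 <= f x) ->
  (forall i j k a b c, (i < N)%N -> (j < N)%N -> (k < N)%N ->
     cell n i a -> cell n j b -> cell n k c -> m i j k <= f (vec3 a b c)) ->
  ((mesh n ^+ 3 * sum3 N m)%:E <= \int[mu]_(a in setT) \int[mu]_(b in setT)
     \int[mu]_(c in setT) (f (vec3 a b c))%:E)%E.
Proof.
move=> m0 f0 mf.
have h0 : 0 <= mesh n :> R by rewrite ltW // mesh_gt0.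
pose m2 i j := \sum_(k < N) mesh n * m i j k.
pose m1 i := \sum_(j < N) mesh n * m2 i j.
have m20 i j : 0 <= m2 i j by apply: sumr_ge0 => k _; rewrite mulr_ge0.
have m10 i : 0 <= m1 i by apply: sumr_ge0 => k _; rewrite mulr_ge0.
have -> : mesh n ^+ 3 * sum3 N m = \sum_(i < N) mesh n * m1 i.
  rewrite /sum3 mulr_sumr; apply: eq_bigr => i _.
  rewrite /m1 !mulr_sumr; apply: eq_bigr => j _.
  by rewrite /m2 !mulr_sumr; apply: eq_bigr => k _; ring.
apply: lower_sum1 => // [a|i a iN ai].
  by apply: integral_ge0 => b _; apply: integral_ge0 => c _; rewrite lee_fin.
apply: lower_sum1 => // [b|j b jN bj].
  by apply: integral_ge0 => c _; rewrite lee_fin.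
apply: lower_sum1 => // [c|k c kN ck]; first by rewrite lee_fin.
by rewrite lee_fin; exact: mf.
Qed.

Lemma enorm_lt1 (x : 'rV[R]_3) : (enorm x < 1) = inball x.
Proof.
rewrite /enorm /inball -/(sqn x) -[X in _ < X]sqrtr1.
by rewrite ltr_sqrt.
Qed.

(** The indicator of the ball is discontinuous, so it is first replaced by a continuous cutoff from
    below. The lower sums of [G] are bounded by the iterated integral, and the part lost near the
    sphere is paid for by [upint_shell]. *)
Lemma int_ball_upint (f : 'rV[R]_3 -> R) c : continuous f -> (forall x, 0 <= f x) ->
  (int_ball f <= c%:E)%E -> upint (fun x => (inball x)%:R * f x) c.
Proof.
move=> cf f0 fc; apply: upint_approx => e e0.
have [M M0 MP] := bounded_box 4 cf.
have [m [m0 md mM]] : exists m, [/\ 0 < m, m <= 2^-1 & M * (6144 * m) <= e / 2].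
  have M1 : 0 < 2 * M * 6144 by lra.
  exists (Num.min 2^-1 (e / (2 * M * 6144))); split.
  - by rewrite lt_min invr_gt0 ltr0n divr_gt0.
  - by rewrite ge_min lexx.
  - have : Num.min 2^-1 (e / (2 * M * 6144)) <= e / (2 * M * 6144) by rewrite ge_min lexx orbT.
    by rewrite ler_pdivlMr //; lra.
have Cr := C1_ramp (C1_radial 1 m).
pose G x := ramp (radial 1 m x) * f x.
have cG : continuous G.
  move=> x; apply: (@continuousM _ _ (fun x => ramp (radial 1 m x)) f); last exact: cf.
  by case: Cr => cr _ _; exact: cr.
have G0 x : 0 <= G x.
  rewrite mulr_ge0 //; case: (ramp_hat (radial 1 m x)) => -[_]; [by move->|by move=> /andP[]|by move->].
have GB x : G x <= (inball x)%:R * f x.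
  rewrite ler_wpM2r // /inball; case: (ltP (sqn x) 1) => x1 /=; rewrite ?mulr1n ?mulr0n.
    case: (ramp_hat (radial 1 m x)) => -[_]; [by move->|by move=> /andP[]|by move->].
  by rewrite ramp_le0 // /radial pmulr_lle0 ?invr_gt0 // subr_le0.
have uG : upint G c.
  apply: upint_near => k k0.
  have k1 : 0 < k / 512 by lra.
  have [d d0 dP] := unif_cont_box 4 cG k1.
  near=> n.
  have hd : mesh n <= d by near: n; exact: mesh_small.
  have h0 : 0 < mesh n :> R by apply: mesh_gt0.
  (* By uniform continuity and [G >= 0], the value of [pos (G - k / 512)] at a node is a lower bound
     for [G] on the whole cell. *)
  have : riemann n (fun x => pos (G x - k / 512)) <= c.
    rewrite -lee_fin; apply: le_trans fc.
    apply: (@lower_sum3 n (gsize n) (fun i j l => pos (G (gpoint n i j l) - k / 512))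
      (fun x => \1_ball1 x * f x)) => [i j l|x|i j l a b t iN jN lN ai bj tl].
    - exact: pos_ge0.
    - by rewrite mulr_ge0.
    have -> : \1_ball1 (vec3 a b t) = (inball (vec3 a b t))%:R :> R.
      by rewrite indicE; congr ((nat_of_bool _)%:R); rewrite -enorm_lt1; apply/idP/idP; rewrite inE.
    apply: le_trans (GB _).
    rewrite /pos ge_max G0 andbT.
    have H z i' : cell n i' z -> `|gcoord n i' - z| <= d.
      rewrite /cell /= in_itv /= gcoordS => /andP[z1 z2].
      by rewrite ler0_norm ?subr_le0 // opprB; apply: le_trans hd; rewrite lerBlDr ltW.
    have : `|G (gpoint n i j l) - G (vec3 a b t)| <= k / 512.
      apply: dP; first exact: gpoint_box.
      by move=> q; case: (ord3P q) => ->; rewrite !vec3E; exact: H.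
    by rewrite ler_norml => /andP[_]; lra.
  move=> h1; apply: le_trans (_ : riemann n (fun x => k / 512 + pos (G x - k / 512)) <= _).
    by apply: riemann_le => x _; rewrite -lerBlDl /pos le_max lexx.
  by rewrite riemann_add riemann_cst; lra.
have H := upint_add uG (upint_scale (ltW M0) (upint_shell m0 md)).
apply: upint_weak (upint_le _ H); first by lra.
move=> x bx; have fM : f x <= M by apply: le_trans (ler_norm _) (MP _ bx).
rewrite /inball /G; case: (ltP (sqn x) 1) => x1 /=; last first.
  rewrite mul0r; apply: addr_ge0; first exact: G0.
  by rewrite mulr_ge0 ?ler0n // ltW.
rewrite mulr1n mul1r; set y := radial 1 m x.
have yE : y * m = 1 - sqn x by rewrite /y /radial divfK // gt_eqF.
have Ms : 0 <= M * (inshell m x)%:R by rewrite mulr_ge0 ?ler0n // ltW.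
have [y1|y1] := lerP 1 y.
  by rewrite ramp_ge1 // mul1r lerDl.
have -> : inshell m x.
  rewrite /inshell; apply/andP; split; last by lra.
  have : y * m <= m by rewrite ger_pMl // ltW.
  lra.
have G0x := G0 x; rewrite /G -/y in G0x.
by rewrite mulr1n mulr1 -[leLHS]add0r lerD.
Unshelve. all: by end_near. Qed.

End lebesgue_lower_sums.

(** * Poincare inequality *)

Section discrete_poincare.
Context {R : realType}.
Implicit Types (N : nat) (A B C : pred nat).

Definition wcount N A : R := \sum_(i < N) (A i)%:R.

Lemma wcount_ge0 N A : 0 <= wcount N A.
Proof. by apply: sumr_ge0 => i _; exact: ler0n. Qed.

Lemma wsum_sqr_le N A (f : nat -> R) :
  (\sum_(i < N) (A i)%:R * f i) ^+ 2 <= wcount N A * \sum_(i < N) (A i)%:R * f i ^+ 2.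
Proof.
set m := wcount N A; set s := \sum_(i < N) (A i)%:R * f i; set q := \sum_(i < N) _ * _ ^+ 2.
have : 0 <= \sum_(i < N) \sum_(j < N) ((A i)%:R * (A j)%:R) * (f i - f j) ^+ 2.
  by apply: sumr_ge0 => i _; apply: sumr_ge0 => j _; apply: mulr_ge0; [apply: mulr_ge0; exact: ler0n|exact: sqr_ge0].
rewrite (eq_bigr (fun i : 'I_N => m * ((A i)%:R * f i ^+ 2) + q * (A i)%:R - 2 * s * ((A i)%:R * f i))); last first.
  move=> i _; rewrite (eq_bigr (fun j : 'I_N => ((A i)%:R * f i ^+ 2) * (A j)%:R +
     (A i)%:R * ((A j)%:R * f j ^+ 2) - 2 * ((A i)%:R * f i) * ((A j)%:R * f j))); last first.
    by move=> j _; ring.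
  rewrite big_split big_split /= sumrN -!mulr_sumr -/(wcount N A) -/q -/s -/m; ring.
rewrite big_split big_split /= sumrN -!mulr_sumr -/(wcount N A) -/q -/s -/m.
by lra.
Qed.

Definition convex_pred A := forall i j l : nat, A i -> A j -> (i <= l <= j)%N -> A l.

(** Telescope along the indices between [i] and [j], which all lie in [A] by convexity, and apply
    Cauchy-Schwarz. *)
Lemma path_sqr_le N A (f : nat -> R) (i j : nat) : convex_pred A ->
  (i < N)%N -> (j < N)%N -> A i -> A j ->
  (f i - f j) ^+ 2 <= wcount N A * \sum_(l < N) (A l)%:R * (f l.+1 - f l) ^+ 2.
Proof.
move=> cA; wlog ij : i j / (i <= j)%N.
  move=> H iN jN Ai Aj; case/orP: (leq_total i j) => ij; first exact: H.
  by rewrite -sqrrN opprB; apply: H.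
move=> iN jN Ai Aj; have := wsum_sqr_le N A (fun l => `|f l.+1 - f l|).
under [X in _ <= _ * X -> _]eq_bigr => l _ do rewrite real_normK ?num_real //.
apply: le_trans.
rewrite -(@real_normK _ (f i - f j)) ?num_real // ler_sqr ?nnegrE //; last first.
  by apply: sumr_ge0 => l _; rewrite mulr_ge0.
rewrite distrC -(telescope_sumr f ij).
apply: le_trans (ler_norm_sum _ _ _) _.
rewrite -(big_mkord xpredT (fun l => (A l)%:R * `|f l.+1 - f l|)).
rewrite [leRHS](big_cat_nat (n := i)) //=; last exact: ltnW.
rewrite [X in _ <= _ + X](big_cat_nat (n := j)) //=; last exact: ltnW.
apply: le_trans (_ : \sum_(i <= l < j) (A l)%:R * `|f l.+1 - f l| <= _).
  rewrite big_nat [leRHS]big_nat; apply: ler_sum => l /andP[il lj].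
  by rewrite (cA i j) ?mul1r // il ltnW.
by rewrite addrCA lerDl addr_ge0 //; apply: sumr_ge0 => l _; rewrite mulr_ge0.
Qed.

Lemma pick_below_average N A (g : nat -> R) (i0 : nat) : (i0 < N)%N -> A i0 ->
  exists i, [/\ (i < N)%N, A i & wcount N A * g i <= \sum_(l < N) (A l)%:R * g l].
Proof.
move=> i0N Ai0; apply: contrapT => H.
have H' i : (i < N)%N -> A i -> \sum_(l < N) (A l)%:R * g l < wcount N A * g i.
  by move=> iN Ai; rewrite ltNge; apply/negP => h; apply: H; exists i.
set s := \sum_(l < N) _ in H'.
have : \sum_(l < N) (A l)%:R * s < \sum_(l < N) (A l)%:R * (wcount N A * g l).
  rewrite (bigD1 (Ordinal i0N)) //= [ltRHS](bigD1 (Ordinal i0N)) //=.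
  apply: ltr_leD; first by rewrite Ai0 !mul1r H'.
  apply: ler_sum => l _; case Al: (A l); rewrite ?mul0r ?lexx // !mul1r ltW // H' // Al.
rewrite -mulr_suml -/(wcount N A).
rewrite (eq_bigr (fun l : 'I_N => wcount N A * ((A l)%:R * g l))); last by move=> l _; ring.
by rewrite -mulr_sumr -/s ltxx.
Qed.

End discrete_poincare.

(** * Cubes and slabs on the grid *)

Section grid_cubes.
Context {R : realType}.
Implicit Types (n : nat) (c x : 'rV[R]_3) (a b y s : R).

Definition incube c (s : R) x : bool := [forall i, `|x 0 i - c 0 i| <= s].

Lemma incubeP c s x : reflect (forall i, `|x 0 i - c 0 i| <= s) (incube c s x).
Proof. exact: forallP. Qed.

Definition slab n (a s : R) : pred nat := fun i => `|gcoord n i - a| <= s.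

Lemma incube_gpoint n c s i j k : incube c s (gpoint n i j k) =
  [&& slab n (c 0 0) s i, slab n (c 0 1) s j & slab n (c 0 2%:R) s k].
Proof.
apply/incubeP/and3P => [H|[h0 h1 h2] l].
  by split; [have := H 0|have := H 1|have := H 2%:R]; rewrite vec3E.
by case: (ord3P l) => ->; rewrite vec3E.
Qed.

Lemma convex_slab n a s : convex_pred (slab n a s).
Proof.
move=> i j l; rewrite /slab !ler_distl => /andP[i1 i2] /andP[j1 j2] /andP[il lj].
apply/andP; split.
  by apply: le_trans i1 _; rewrite gcoord_lt.
by apply: le_trans _ j2; rewrite gcoord_lt.
Qed.

(** Increments of [clamp a b] over the grid telescope to a length; comparing them with [mesh n]
    counts the nodes in an interval. *)
Definition clamp (a b y : R) : R := Num.max a (Num.min y b).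

Lemma clamp_id a b y : a <= y <= b -> clamp a b y = y.
Proof. by move=> /andP[ay yb]; rewrite /clamp (min_idPl yb) (max_idPr ay). Qed.
Lemma clamp_lo a b y : y <= a -> a <= b -> clamp a b y = a.
Proof.
by move=> ya ab; rewrite /clamp (min_idPl (le_trans ya ab)) (max_idPl ya).
Qed.
Lemma clamp_hi a b y : b <= y -> a <= b -> clamp a b y = b.
Proof. by move=> ya ab; rewrite /clamp (min_idPr ya) (max_idPr ab). Qed.
Lemma clamp_mono a b : {homo clamp a b : x y / x <= y}.
Proof.
move=> x y xy; rewrite /clamp; have [h1|h1] := lerP x b; have [h2|h2] := lerP y b;
have [h3|h3] := lerP a x; have [h4|h4] := lerP a y; have [h5|h5] := lerP a b; lra.
Qed.

Lemma clamp_bound a b y : a <= b -> a <= clamp a b y <= b.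
Proof. by move=> ab; rewrite /clamp le_max lexx ge_max ab ge_min lexx orbT. Qed.

Lemma sum_clamp n a b : \sum_(i < gsize n) (clamp a b (gcoord n i.+1) - clamp a b (gcoord n i))
  = clamp a b 4 - clamp a b (-4).
Proof.
rewrite -(big_mkord xpredT (fun i => clamp a b (gcoord n i.+1) - clamp a b (gcoord n i))).
by rewrite (telescope_sumr (fun i => clamp a b (gcoord n i))) // gcoord_size gcoord0.
Qed.

Lemma wcount_slab_le n a s : 0 <= s -> mesh n * wcount (gsize n) (slab n a s) <= 2 * s + mesh n.
Proof.
move=> s0; have h0 : 0 < mesh n :> R by exact: mesh_gt0.
pose lo := a - s; pose hi := a + s + mesh n.
have lohi : lo <= hi by rewrite /lo /hi; lra.
apply: le_trans (_ : clamp lo hi 4 - clamp lo hi (-4) <= _); last first.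
  have /andP[_ h1] := clamp_bound 4 lohi; have /andP[h2 _] := clamp_bound (-4) lohi.
  apply: le_trans (lerB h1 h2) _; rewrite /lo /hi; lra.
rewrite -(sum_clamp n) mulr_sumr; apply: ler_sum => i _.
rewrite /slab; case: (boolP (_ <= s)) => /= [|_]; last first.
  by rewrite mulr0 subr_ge0 clamp_mono // gcoord_lt.
rewrite ler_distl => /andP[h1 h2].
by rewrite !clamp_id ?gcoordS ?addrK ?mulr1 // /lo /hi; apply/andP; split; lra.
Qed.

Lemma wcount_slab_ge n a s : 0 <= s -> `|a| + s <= 4 ->
  2 * s - mesh n <= mesh n * wcount (gsize n) (slab n a s).
Proof.
move=> s0 as4; have h0 : 0 < mesh n :> R by exact: mesh_gt0.
have := ler_norm a; have := ler_norm (- a); rewrite normrN => a1 a2.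
have [hs|hs] := lerP (2 * s) (mesh n).
  by apply: le_trans (_ : 0 <= _); [lra|rewrite mulr_ge0 ?wcount_ge0 // ltW].
(* With the lower end raised by one mesh width, every node outside the slab has increment zero. *)
pose lo := a - s + mesh n; pose hi := a + s.
have lohi : lo <= hi by rewrite /lo /hi; lra.
apply: le_trans (_ : clamp lo hi 4 - clamp lo hi (-4) <= _).
  by rewrite clamp_hi ?clamp_lo // /lo /hi; lra.
rewrite -(sum_clamp n) mulr_sumr; apply: ler_sum => i _.
rewrite gcoordS; set y := gcoord n i.
rewrite /slab -/y; case: (boolP (_ <= s)) => /= [|]; last first.
  rewrite mulr0 ler_distl negb_and -!ltNge => /orP[] h.
    by rewrite !clamp_lo ?subrr // /lo; lra.
  by rewrite !clamp_hi ?subrr // /hi; lra.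
move=> _; rewrite mulr1 /clamp.
have [h1|h1] := lerP y hi; have [h2|h2] := lerP (mesh n + y) hi;
have [h3|h3] := lerP lo y; have [h4|h4] := lerP lo (mesh n + y); rewrite ?(max_idPr lohi); lra.
Qed.

Lemma riemann_cube n c s : riemann n (fun x => (incube c s x)%:R) =
  (mesh n * wcount (gsize n) (slab n (c 0 0) s)) *
  (mesh n * wcount (gsize n) (slab n (c 0 1) s)) *
  (mesh n * wcount (gsize n) (slab n (c 0 2%:R) s)).
Proof.
rewrite /riemann /sum3.
rewrite (eq_bigr (fun i : 'I_(gsize n) => (slab n (c 0 0) s i)%:R *
   (wcount (gsize n) (slab n (c 0 1) s) * wcount (gsize n) (slab n (c 0 2%:R) s)))).
  by rewrite -mulr_suml -/(wcount _ _); ring.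
move=> i _; rewrite /wcount mulr_suml mulr_sumr; apply: eq_bigr => j _.
rewrite !mulr_sumr; apply: eq_bigr => k _; rewrite incube_gpoint.
by rewrite -!natrM !mulnb.
Qed.

(** Once [mesh n <= s], each side contributes between [s] and [3 s], hence the crude volume bounds
    [27 s^3] here and [s^3] in [upint_cube_ge]. *)
Lemma upint_cube c s : 0 < s -> upint (fun x => (incube c s x)%:R) (27 * s ^+ 3).
Proof.
move=> s0; apply: upint_near => e e0; near=> n.
have hs : mesh n <= s by near: n; exact: mesh_small.
apply: le_trans (_ : 27 * s ^+ 3 <= _); last by rewrite lerDl ltW.
have h0 : 0 < mesh n :> R by exact: mesh_gt0.
have H a : 0 <= (mesh n * wcount (gsize n) (slab n a s) : R) <= 3 * s.
  apply/andP; split; first by apply: mulr_ge0; [exact: ltW|exact: wcount_ge0].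
  by apply: le_trans (wcount_slab_le _ _ (ltW s0)) _; lra.
have -> : 27 * s ^+ 3 = (3 * s) * (3 * s) * (3 * s) by ring.
have /andP[a0 a1] := H (c 0 0); have /andP[b0 b1] := H (c 0 1); have /andP[c0 c1] := H (c 0 2%:R).
rewrite riemann_cube; apply: ler_pM => //; first exact: mulr_ge0.
exact: ler_pM.
Unshelve. all: by end_near. Qed.

Lemma upint_cube_ge c s (k v : R) : 0 < s -> (forall i, `|c 0 i| + s <= 4) -> 0 <= k ->
  upint (fun x => k * (incube c s x)%:R) v -> k * s ^+ 3 <= v.
Proof.
move=> s0 cs k0 H; apply/ler_addgt0Pr => e e0.
have /filterI /(_ (oo_ultra (mesh_small s0))) /filter_ex[n /= [Hn hs]] := H e e0.
apply: le_trans Hn; rewrite riemann_scale ler_wpM2l //.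
have h0 : 0 < mesh n :> R by exact: mesh_gt0.
have B i : s <= mesh n * wcount (gsize n) (slab n (c 0 i) s).
  by apply: le_trans (wcount_slab_ge n (ltW s0) (cs i)); lra.
have -> : s ^+ 3 = s * s * s by ring.
by rewrite riemann_cube !ler_pM ?B ?mulr_ge0 // ltW.
Qed.

End grid_cubes.

Section grid_poincare.
Context {R : realType} (N : nat) (A B C : pred nat).
Hypotheses (cA : convex_pred A) (cB : convex_pred B) (cC : convex_pred C).
Variable F : 'I_3 -> nat -> nat -> nat -> R.
Let mA : R := wcount N A.
Let mB : R := wcount N B.
Let mC : R := wcount N C.
Let q i j k i' j' k' : R := \sum_(c < 3) (F c i j k - F c i' j' k') ^+ 2.
Let D0 i j k : R := q i.+1 j k i j k.
Let D1 i j k : R := q i j.+1 k i j k.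
Let D2 i j k : R := q i j k.+1 i j k.

Definition wsum3 (g : nat -> nat -> nat -> R) : R :=
  \sum_(i < N) (A i)%:R * \sum_(j < N) (B j)%:R * \sum_(k < N) (C k)%:R * g i j k.

Lemma wsum3E g : wsum3 g = sum3 N (fun i j k => (A i)%:R * (B j)%:R * (C k)%:R * g i j k).
Proof.
apply: eq_bigr => i _; rewrite mulr_sumr; apply: eq_bigr => j _; rewrite mulrA mulr_sumr.
by apply: eq_bigr => k _; rewrite !mulrA.
Qed.

Lemma weight_le (b : bool) (x y : R) : (b -> x <= y) -> b%:R * x <= b%:R * y.
Proof. by case: b => H; rewrite ?mul0r // !mul1r; apply: H. Qed.

Lemma wsum_cst (P : pred nat) (a : R) : \sum_(i < N) (P i)%:R * a = wcount N P * a.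
Proof. by rewrite -mulr_suml. Qed.

Lemma vpath_sqr_le P (f : 'I_3 -> nat -> R) (i j : nat) : convex_pred P ->
  (i < N)%N -> (j < N)%N -> P i -> P j ->
  \sum_(c < 3) (f c i - f c j) ^+ 2 <=
  wcount N P * \sum_(l < N) (P l)%:R * \sum_(c < 3) (f c l.+1 - f c l) ^+ 2.
Proof.
move=> cP iN jN Pi Pj.
apply: le_trans (_ : \sum_(c < 3) wcount N P * \sum_(l < N) (P l)%:R * (f c l.+1 - f c l) ^+ 2 <= _).
  by apply: ler_sum => c _; exact: path_sqr_le.
rewrite -mulr_sumr exchange_big /=; apply: ler_wpM2l; first exact: wcount_ge0.
by under eq_bigr do rewrite -mulr_sumr.
Qed.

Lemma poincare_axis0 i' : (i' < N)%N -> A i' ->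
  wsum3 (fun i j k => q i j k i' j k) <= mA ^+ 2 * wsum3 D0.
Proof.
move=> iN Ai.
apply: le_trans (_ : wsum3 (fun _ j k => mA * \sum_(l < N) (A l)%:R * D0 l j k) <= _).
  apply: ler_sum => i _; apply: weight_le => Ai'; apply: ler_sum => j _; apply: weight_le => _.
  apply: ler_sum => k _; apply: weight_le => _; exact: (@vpath_sqr_le A (fun c l => F c l j k)).
rewrite /wsum3 wsum_cst -/mA expr2 -mulrA ler_wpM2l ?wcount_ge0 //.
rewrite le_eqVlt; apply/orP; left; apply/eqP.
rewrite -/(wsum3 D0) wsum3E sum3_rot /sum3 mulr_sumr; apply: eq_bigr => j _.
rewrite !mulr_sumr; apply: eq_bigr => k _.
by rewrite !mulr_sumr; apply: eq_bigr => l _; ring.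
Qed.

Lemma poincare_axis1 i' j' : (j' < N)%N -> B j' ->
  wsum3 (fun i j k => q i' j k i' j' k) <=
  mA * (mB ^+ 2 * \sum_(j < N) (B j)%:R * \sum_(k < N) (C k)%:R * D1 i' j k).
Proof.
move=> jN Bj; rewrite /wsum3 wsum_cst -/mA ler_wpM2l ?wcount_ge0 //.
apply: le_trans (_ : \sum_(j < N) (B j)%:R * (\sum_(k < N) (C k)%:R *
    (mB * \sum_(l < N) (B l)%:R * D1 i' l k)) <= _).
  apply: ler_sum => j _; apply: weight_le => Bj'; apply: ler_sum => k _; apply: weight_le => _.
  exact: (@vpath_sqr_le B (fun c l => F c i' l k)).
rewrite wsum_cst -/mB expr2 -mulrA ler_wpM2l ?wcount_ge0 //.
rewrite le_eqVlt; apply/orP; left; apply/eqP.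
rewrite [RHS]mulr_sumr; under [RHS]eq_bigr => j _ do rewrite mulrCA mulr_sumr mulr_sumr.
rewrite [RHS]exchange_big; apply: eq_bigr => k _.
by rewrite !mulr_sumr; apply: eq_bigr => l _; ring.
Qed.

Lemma poincare_axis2 i' j' k' : (k' < N)%N -> C k' ->
  wsum3 (fun i j k => q i' j' k i' j' k') <=
  mA * (mB * (mC ^+ 2 * \sum_(k < N) (C k)%:R * D2 i' j' k)).
Proof.
move=> kN Ck; rewrite /wsum3 wsum_cst -/mA ler_wpM2l ?wcount_ge0 //.
rewrite wsum_cst -/mB ler_wpM2l ?wcount_ge0 //.
apply: le_trans (_ : \sum_(k < N) (C k)%:R * (mC * \sum_(l < N) (C l)%:R * D2 i' j' l) <= _).
  by apply: ler_sum => k _; apply: weight_le => Ck'; exact: (@vpath_sqr_le C (fun c l => F c i' j' l)).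
by rewrite wsum_cst -/mC expr2 -mulrA.
Qed.

(** Join [(i,j,k)] to [(i',j',k0)] by the axis legs [(i,j,k) -> (i',j,k) -> (i',j',k) ->
    (i',j',k0)]. The first leg is controlled for every [i']. The others see only the slice [i'] and
    the line [(i',j')]; choosing these to carry at most the average turns their sums back into sums
    over the whole cube. The factor 3 counts the legs. *)
Lemma grid_poincare (i0 j0 k0 : nat) : (i0 < N)%N -> A i0 -> (j0 < N)%N -> B j0 ->
  (k0 < N)%N -> C k0 ->
  exists i' j' k', [/\ (i' < N)%N && A i', (j' < N)%N && B j', (k' < N)%N && C k' &
    wsum3 (fun i j k => q i j k i' j' k') <=
    3 * (mA ^+ 2 * wsum3 D0 + mB ^+ 2 * wsum3 D1 + mC ^+ 2 * wsum3 D2)].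
Proof.
move=> i0N Ai0 j0N Bj0 k0N Ck0.
pose G1 i := \sum_(j < N) (B j)%:R * \sum_(k < N) (C k)%:R * D1 i j k.
pose G2 i j := \sum_(k < N) (C k)%:R * D2 i j k.
(* One [i'] has to serve both remaining legs, so their bounds are averaged jointly. *)
have [i' [iN Ai hi]] := pick_below_average
  (fun i => mB ^+ 2 * G1 i + mC ^+ 2 * \sum_(j < N) (B j)%:R * G2 i j) i0N Ai0.
have [j' [jN Bj hj]] := pick_below_average (G2 i') j0N Bj0.
exists i', j', k0; rewrite iN Ai jN Bj k0N Ck0; split=> //.
have T1 := poincare_axis0 iN Ai.
have T2 := poincare_axis1 i' jN Bj.
have T3 := poincare_axis2 i' j' k0N Ck0.
have EE : mB ^+ 2 * wsum3 D1 + mC ^+ 2 * wsum3 D2 =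
    \sum_(l < N) (A l)%:R * (mB ^+ 2 * G1 l + mC ^+ 2 * \sum_(j < N) (B j)%:R * G2 l j) :> R.
  rewrite /wsum3 !mulr_sumr -big_split; apply: eq_bigr => l _ /=.
  by rewrite /G1 /G2; ring.
rewrite -/mA -EE in hi; rewrite -/mB in hj; rewrite -/(G1 i') in T2; rewrite -/(G2 i' j') in T3.
have mA0 : 0 <= mA by exact: wcount_ge0.
have hj' : mA * (mB * (mC ^+ 2 * G2 i' j')) <= mA * (mC ^+ 2 * \sum_(j < N) (B j)%:R * G2 i' j).
  rewrite ler_wpM2l // mulrCA -[leRHS]mulr1 -[leLHS]mulr1 !mulr1 ler_wpM2l //.
  exact: sqr_ge0.
apply: le_trans (_ : 3 * (wsum3 (fun i j k => q i j k i' j k) +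
   wsum3 (fun i j k => q i' j k i' j' k) + wsum3 (fun i j k => q i' j' k i' j' k0)) <= _); last first.
  rewrite ler_wpM2l //; move: hi T1 T2 T3 hj'; rewrite mulrDr.
  move: (wsum3 _) (wsum3 _) (wsum3 _) (mA ^+ 2 * _) (mB ^+ 2 * wsum3 _) (mC ^+ 2 * wsum3 _).
  move: (mA * (mB ^+ 2 * _)) (mA * (mC ^+ 2 * _)) (mA * (mB * _)).
  clear; move=> *; lra.
rewrite /wsum3 -!big_split mulr_sumr; apply: ler_sum => i _ /=.
rewrite -!mulrDr mulrCA ler_wpM2l // -!big_split mulr_sumr; apply: ler_sum => j _ /=.
rewrite -!mulrDr mulrCA ler_wpM2l // -!big_split mulr_sumr; apply: ler_sum => k _ /=.
rewrite -!mulrDr mulrCA ler_wpM2l // -!big_split mulr_sumr; apply: ler_sum => c _ /=.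
set a := F c i j k; set b := F c i' j k; set d := F c i' j' k; set e := F c i' j' k0.
have := sqr_ge0 ((a - b) - (b - d)); have := sqr_ge0 ((a - b) - (d - e)).
have := sqr_ge0 ((b - d) - (d - e)).
nra.
Qed.

End grid_poincare.

(** * Extension by the boundary value *)

Section extension.
Context {R : realType}.
Implicit Types (f : 'rV[R]_3 -> R) (x y : 'rV[R]_3).

(** The map is constrained only in the closed ball. With the boundary value put outside, cubes that
    stick out of the ball can be treated like interior ones. *)
Definition ext f (k : R) x : R := if inball x then f x else k.

Lemma axis_lip f p (M : R) x j (h : R) : C1 f p ->
  (forall z, in_box 1 z -> `|p j z| <= M) -> in_box 1 x -> in_box 1 (h *: evec j + x) ->
  `|f (h *: evec j + x) - f x| <= M * `|h|.
Proof.
move=> Cf; wlog h0 : x h / 0 <= h.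
  move=> H Mp bx bhx; case: (lerP 0 h) => h0; first exact: H.
  have E : x = (- h) *: evec j + (h *: evec j + x) by rewrite addrA -scalerDl addNr scale0r add0r.
  rewrite distrC {1}E -[in leRHS]normrN; apply: H => //; first by rewrite oppr_ge0 ltW.
  by rewrite -E.
move=> Mp bx bhx; have [t /andP[t0 th] ->] := MVT_axis x j Cf h0.
rewrite normrM mulrC ler_wpM2r //; apply: Mp => i.
have := bx i; have := bhx i; rewrite !mxE eqxx /=.
case: eqP => _; rewrite ?mulr0 ?mulr1 ?add0r // !ler_norml => /andP[h1 h2] /andP[h3 h4].
by apply/andP; split; lra.
Qed.

Lemma box_lip f p : C1 f p -> exists2 M, 0 < M & forall x y (d : R),
  in_box 1 x -> in_box 1 y -> (forall i, `|x 0 i - y 0 i| <= d) -> `|f x - f y| <= M * d.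
Proof.
move=> Cf; have [cf cp df] := Cf.
have [M0 M00 B0] := bounded_box 1 (cp 0).
have [M1 M10 B1] := bounded_box 1 (cp 1).
have [M2 M20 B2] := bounded_box 1 (cp 2%:R).
exists (M0 + M1 + M2) => [|x y d bx bly xy]; first by rewrite !addr_gt0.
pose z1 := (y 0 0 - x 0 0) *: evec 0 + x.
pose z2 := (y 0 1 - x 0 1) *: evec 1 + z1.
have Ey : y = (y 0 2%:R - x 0 2%:R) *: evec 2%:R + z2.
  by apply: eq_rV3; rewrite !mxE /= ?mulr1 ?mulr0; ring.
have bz1 : in_box 1 z1.
  move=> i; have := bx i; have := bly i.
  by case: (ord3P i) => ->; rewrite !mxE /= ?mulr1 ?mulr0 ?add0r ?subrK.
have bz2 : in_box 1 z2.
  move=> i; have := bx i; have := bly i.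
  by case: (ord3P i) => ->; rewrite !mxE /= ?mulr1 ?mulr0 ?add0r ?subrK.
have h0 : `|f z1 - f x| <= M0 * d.
  apply: le_trans (axis_lip Cf B0 bx bz1) _.
  by rewrite ler_wpM2l ?(ltW M00) // distrC.
have h1 : `|f z2 - f z1| <= M1 * d.
  apply: le_trans (axis_lip Cf B1 bz1 bz2) _.
  by rewrite ler_wpM2l ?(ltW M10) // distrC.
have h2 : `|f y - f z2| <= M2 * d.
  rewrite Ey in bly *; apply: le_trans (axis_lip Cf B2 bz2 bly) _.
  by rewrite ler_wpM2l ?(ltW M20) // distrC.
have -> : f x - f y = - ((f y - f z2) + (f z2 - f z1) + (f z1 - f x)) by ring.
rewrite normrN; apply: le_trans (ler_normD _ _) _.
have := ler_normD (f y - f z2) (f z2 - f z1); lra.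
Qed.

Definition proj1 y : 'rV[R]_3 := (Num.sqrt (sqn y))^-1 *: y.

Lemma sqnZ (a : R) x : sqn (a *: x) = a ^+ 2 * sqn x.
Proof. by rewrite !sqnE !mxE; ring. Qed.

Lemma sqn_proj1 y : 0 < sqn y -> sqn (proj1 y) = 1.
Proof. by move=> y0; rewrite sqnZ exprVn sqr_sqrtr ?ltW // mulVf // gt_eqF. Qed.

(** For [y = r pi] with [|pi| = 1] and [r >= 1], the difference of the two sides is
    [(r - 1) (r + 1 - 2 x . pi)], and [2 x . pi <= 2]. *)
Lemma proj1_contract x y : sqn x <= 1 -> 1 <= sqn y -> sqn (x - proj1 y) <= sqn (x - y).
Proof.
move=> x1 y1; have y0 : 0 < sqn y by lra.
have p1 := sqn_proj1 y0.
set r := Num.sqrt (sqn y).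
have r0 : 0 < r by rewrite sqrtr_gt0.
have rE : r ^+ 2 = sqn y by rewrite sqr_sqrtr // ltW.
have r1 : 1 <= r by rewrite -sqrtr1 ler_psqrt ?nnegrE // ltW.
have yE : y = r *: proj1 y by rewrite scalerA divff ?scale1r // gt_eqF.
have E : sqn (x - y) - sqn (x - proj1 y) =
    (r - 1) * ((r + 1) * sqn (proj1 y) - (sqn x + sqn (proj1 y) - sqn (x - proj1 y))).
  by rewrite {1}yE; move: (proj1 y) => z; rewrite !sqnE !mxE; ring.
have : 0 <= sqn (x - proj1 y) by exact: sqn_ge0.
move=> h; rewrite -subr_ge0 E p1; apply: mulr_ge0; lra.
Qed.

Lemma sqn_box x (d : R) : (forall i, `|x 0 i| <= d) -> sqn x <= 3 * d ^+ 2.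
Proof.
move=> H; rewrite sqnE.
have S i : x 0 i ^+ 2 <= d ^+ 2.
  by rewrite -(@real_normK _ (x 0 i)) ?num_real // ler_sqr ?nnegrE // (le_trans _ (H i)).
by have := S 0; have := S 1; have := S 2%:R; lra.
Qed.

Lemma sqn_le1_box x : sqn x <= 1 -> in_box 1 x.
Proof. by move=> x1 i; apply: coord_le => //; rewrite expr1n. Qed.

(** For a pair on different sides of the sphere, the outer point is replaced by its projection,
    where [f = k]. The factor 2 bounds the square root of 3 lost between the maximum norm and the
    Euclidean norm. *)
Lemma ext_lip f p k : C1 f p -> (forall x, sqn x = 1 -> f x = k) ->
  exists2 L, 0 < L & forall x y (d : R), (forall i, `|x 0 i - y 0 i| <= d) ->
    `|ext f k x - ext f k y| <= L * d.
Proof.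
move=> Cf fk; have [M M0 ML] := box_lip Cf.
exists (2 * M) => [|x y d xy]; first by rewrite mulr_gt0.
have d0 : 0 <= d by apply: le_trans (xy 0).
have Md : M * d <= 2 * M * d by nra.
have key (u v : 'rV[R]_3) : (forall i, `|u 0 i - v 0 i| <= d) -> inball u -> ~~ inball v -> `|f u - k| <= 2 * M * d.
  rewrite /inball -leNgt => uv u1 v1.
  have v0 : 0 < sqn v by lra.
  rewrite -(fk _ (sqn_proj1 v0)) [2 * M]mulrC -mulrA; apply: ML => [||i].
  - exact/sqn_le1_box/ltW.
  - by apply: sqn_le1_box; rewrite sqn_proj1.
  have -> : u 0 i - proj1 v 0 i = (u - proj1 v) 0 i by rewrite !mxE.
  apply: coord_le; first by rewrite mulr_ge0.
  apply: le_trans (proj1_contract (ltW u1) v1) _.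
  apply: (@le_trans _ _ (3 * d ^+ 2)); last by nra.
  by apply: sqn_box => j; have := uv j; rewrite !mxE.
rewrite /ext; case: (boolP (inball x)) => hx; case: (boolP (inball y)) => hy.
- apply: le_trans Md; apply: ML => //; exact/sqn_le1_box/ltW.
- exact: key hx hy.
- rewrite distrC; apply: key hy hx => i; by rewrite distrC.
- by rewrite subrr normr0 mulr_ge0 // mulr_ge0 // ltW.
Qed.

(** A step that stays on one side is handled by the mean value theorem; a step across the sphere
    starts in the shell, where the Lipschitz bound suffices because the shell has small volume. *)
Lemma ext_quotient f p k (L e d : R) : C1 f p ->
  (forall x y (t : R), (forall i, `|x 0 i - y 0 i| <= t) -> `|ext f k x - ext f k y| <= L * t) ->
  0 < e -> 0 < d -> \forall n \near \oo, forall x j, in_box 4 x ->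
    (ext f k (mesh n *: evec j + x) - ext f k x) ^+ 2 <=
    mesh n ^+ 2 * ((inball x)%:R * p j x ^+ 2 + e + L ^+ 2 * (inshell d x)%:R).
Proof.
move=> Cf Lf e0 d0; have [cf cp df] := Cf.
have cp2 j : continuous (fun x => p j x ^+ 2).
  by move=> x; apply: (@continuousM _ _ (p j) (p j)); exact: cp.
have [t0 t00 T0] := unif_cont_box 4 (cp2 0) e0.
have [t1 t10 T1] := unif_cont_box 4 (cp2 1) e0.
have [t2 t20 T2] := unif_cont_box 4 (cp2 2%:R) e0.
near=> n => x j bx.
have h0 : 0 < mesh n :> R by exact: mesh_gt0.
have ht0 : mesh n <= t0 by near: n; exact: mesh_small.
have ht1 : mesh n <= t1 by near: n; exact: mesh_small.
have ht2 : mesh n <= t2 by near: n; exact: mesh_small.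
(* In the box, a step of length [h <= 1] changes [|x|^2] by at most [8 h + h^2 <= 9 h]. *)
have hd : mesh n <= d / 9 by near: n; apply: mesh_small; lra.
have h1 : mesh n <= 1 :> R by near: n; exact: mesh_small.
have L0 : 0 <= L.
  by have := Lf 0 0 1 => /(_ _)/le_trans; rewrite subrr normr0 mulr1; apply => // i; rewrite subrr normr0.
set y := mesh n *: evec j + x.
have xy i : `|x 0 i - y 0 i| <= mesh n.
  rewrite distrC !mxE addrK normrM eqxx /=.
  by case: eqP => _; rewrite ?normr0 ?mulr0 ?normr1 ?mulr1 ?ger0_norm // ltW.
have sh0 : 0 <= L ^+ 2 * (inshell d x)%:R :> R by rewrite mulr_ge0 ?sqr_ge0.
have pp0 : 0 <= (inball x)%:R * p j x ^+ 2 by rewrite mulr_ge0 ?sqr_ge0.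
have R0 : 0 <= (inball x)%:R * p j x ^+ 2 + e + L ^+ 2 * (inshell d x)%:R.
  by rewrite !addr_ge0 // ltW.
case: (boolP (inball x == inball y)) => [/eqP Exy|Nxy].
  rewrite /ext -Exy; case: (boolP (inball x)) R0 => [ix|_] R0; last first.
    by rewrite subrr expr0n mulr_ge0 ?sqr_ge0.
  have [t /andP[tt0 th] ->] := MVT_axis x j Cf (ltW h0).
  rewrite exprMn ler_wpM2l ?sqr_ge0 //; rewrite ix mulr1n mul1r in pp0 *.
  have H : `|p j x ^+ 2 - p j (t *: evec j + x) ^+ 2| <= e.
    have D i : `|x 0 i - (t *: evec j + x) 0 i| <= mesh n.
      rewrite distrC !mxE addrK normrM eqxx /=.
      by case: eqP => _; rewrite ?normr0 ?mulr0 ?normr1 ?mulr1 ?(ltW h0) // ger0_norm.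
    case: (ord3P j) => Ej; rewrite Ej in D *; [apply: T0|apply: T1|apply: T2] => // i;
      by apply: le_trans (D i) _.
  by move: H; rewrite ler_norml => /andP[]; lra.
have sxy : `|sqn y - sqn x| <= d.
  have -> : sqn y - sqn x = 2 * mesh n * x 0 j + mesh n ^+ 2.
    by rewrite !sqnE !mxE; case: (ord3P j) => -> /=; ring.
  have := bx j; rewrite !ler_norml => /andP[b1 b2].
  by apply/andP; split; nra.
have ish : inshell d x.
  move: Nxy sxy; rewrite /inshell /inball ler_norml => Nxy /andP[s1 s2].
  by case: (ltP (sqn x) 1) (ltP (sqn y) 1) Nxy => a1 [] b1 //= _; apply/andP; split; lra.
rewrite ish mulr1 in sh0 *.
apply: le_trans (_ : mesh n ^+ 2 * L ^+ 2 <= _); last first.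
  by rewrite ler_wpM2l ?sqr_ge0 // lerDr addr_ge0 // ltW.
rewrite -exprMn -(@real_normK _ (ext _ _ _ - _)) ?num_real // ler_sqr ?nnegrE //; last first.
  by rewrite mulr_ge0 // ltW.
by rewrite [mesh n * L]mulrC; apply: Lf => i; rewrite distrC.
Unshelve. all: by end_near. Qed.

End extension.

Section poincare.
Context {R : realType}.
Implicit Types (x y z : 'rV[R]_3).

(** The cube is compact, and a cluster point of an ultrafilter is its limit. Applied to the
    grid-dependent base points of Poincare's inequality. *)
Lemma ultra_limit (S : nat -> 'rV[R]_3) z (s : R) :
  (forall n, incube z s (S n)) ->
  exists2 y, incube z s y & forall N, nbhs y N -> ultra [set n | N (S n)].
Proof.
move=> Sz.
have cQ : compact [set x | incube z s x].
  rewrite (_ : [set x | _] = [set v : 'rV[R]_3 | forall i, `[z 0 i - s, z 0 i + s]%classic (v ord0 i)]).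
    by apply: (@rV_compact _ _ (fun i => `[z 0 i - s, z 0 i + s]%classic)) => i; exact: segment_compact.
  apply/seteqP; split=> x /=.
    by move=> /incubeP H i; have := H i; rewrite in_itv /= ler_distl.
  by move=> H; apply/incubeP => i; have := H i; rewrite in_itv /= ler_distl.
have [|y [Qy cy]] := cQ (S @ ultra) _.
  by apply: (@filterE _ ultra _ (S @^-1` _)); exact: Sz.
exists y => // N nN.
have [//|H] := in_ultra_setVsetC [set n | N (S n)] ultra_ultra.
by have [z' []] := cy (~` N) N H nN.
Qed.

Lemma upint_ext f (g : 'rV[R]_3 -> R) (c : R) : upint f c -> f =1 g -> upint g c.
Proof. by move=> H /funext <-. Qed.

Lemma riemann_incube n z (s : R) (g : 'rV[R]_3 -> R) :
  riemann n (fun x => (incube z s x)%:R * g x) =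
  mesh n ^+ 3 * wsum3 (gsize n) (slab n (z 0 0) s) (slab n (z 0 1) s) (slab n (z 0 2%:R) s)
     (fun i j k => g (gpoint n i j k)).
Proof.
rewrite wsum3E /riemann; congr (_ * _); apply: eq_bigr => i _; apply: eq_bigr => j _.
by apply: eq_bigr => k _; rewrite incube_gpoint -!natrM !mulnb -andbA.
Qed.

Lemma slab_nonempty n (a s : R) : 0 < s -> `|a| + s <= 4 -> mesh n <= s ->
  exists2 i, (i < gsize n)%N & slab n a s i.
Proof.
move=> s0 as4 hs; apply: contrapT => H.
have h0 : 0 < mesh n :> R by exact: mesh_gt0.
have := wcount_slab_ge n (ltW s0) as4.
rewrite /wcount big1 ?mulr0; first by lra.
by move=> i _; case: (boolP (slab n a s i)) => // h; case: H; exists i.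
Qed.

Variables (f : 'I_3 -> 'rV[R]_3 -> R) (p : 'I_3 -> 'I_3 -> 'rV[R]_3 -> R) (k : 'I_3 -> R).
Hypothesis Cf : forall c, C1 (f c) (p c).
Hypothesis fk : forall c x, sqn x = 1 -> f c x = k c.

Definition energy_density x : R := \sum_(c < 3) \sum_(j < 3) p c j x ^+ 2.
Definition extv c x := ext (f c) (k c) x.
Definition dist2 x y : R := \sum_(c < 3) (extv c x - extv c y) ^+ 2.
Definition shift2 n x : R := \sum_(j < 3) dist2 (mesh n *: evec j + x) x.

Lemma extv_lip : exists2 L, 0 < L & forall c x y (d : R),
  (forall i, `|x 0 i - y 0 i| <= d) -> `|extv c x - extv c y| <= L * d.
Proof.
have [L0 L00 H0] := ext_lip (Cf 0) (@fk 0).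
have [L1 L10 H1] := ext_lip (Cf 1) (@fk 1).
have [L2 L20 H2] := ext_lip (Cf 2%:R) (@fk 2%:R).
exists (L0 + L1 + L2) => [|c x y d xy]; first by rewrite !addr_gt0.
have d0 : 0 <= d by apply: le_trans (xy 0).
have := H0 _ _ _ xy; have := H1 _ _ _ xy; have := H2 _ _ _ xy.
have := mulr_ge0 (ltW L00) d0; have := mulr_ge0 (ltW L10) d0; have := mulr_ge0 (ltW L20) d0.
by case: (ord3P c) => -> *; rewrite /extv !mulrDl; lra.
Qed.

(** Each side carries at most [3 s / mesh n] nodes; the squared count gives [9 s^2], and
    [grid_poincare] a further factor 3. *)
Lemma poincare_grid n z (s : R) : 0 < s -> (forall i, `|z 0 i| + s <= 4) -> mesh n <= s ->
  exists2 y, incube z s y &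
    riemann n (fun x => (incube z s x)%:R * dist2 x y) <=
    27 * s ^+ 2 * riemann n (fun x => (incube z s x)%:R * ((mesh n)^-2 * shift2 n x)).
Proof.
move=> s0 zs hs.
have h0 : 0 < mesh n :> R by exact: mesh_gt0.
have [i0 i0N Ai0] := slab_nonempty s0 (zs 0) hs.
have [j0 j0N Aj0] := slab_nonempty s0 (zs 1) hs.
have [l0 l0N Al0] := slab_nonempty s0 (zs 2%:R) hs.
have [i [j [l [/andP[iN Ai] /andP[jN Aj] /andP[lN Al] H]]]] :=
  grid_poincare (@convex_slab _ n (z 0 0) s) (@convex_slab _ n (z 0 1) s)
    (@convex_slab _ n (z 0 2%:R) s) (fun c i j l => extv c (gpoint n i j l))
    i0N Ai0 j0N Aj0 l0N Al0.
exists (gpoint n i j l); first by rewrite incube_gpoint Ai Aj Al.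
rewrite !riemann_incube.
have h3 : 0 <= mesh n ^+ 3 :> R by rewrite exprn_ge0 // ltW.
apply: le_trans (ler_wpM2l h3 H) _.
set mA := wcount _ _; set mB := wcount _ (slab n (z 0 1) s); set mC := wcount _ (slab n (z 0 2%:R) s).
have B a : 0 <= (mesh n * wcount (gsize n) (slab n a s) : R) <= 3 * s.
  apply/andP; split; first by apply: mulr_ge0; [exact: ltW|exact: wcount_ge0].
  by apply: le_trans (wcount_slab_le _ _ (ltW s0)) _; lra.
have B2 a : (wcount (gsize n) (slab n a s) : R) ^+ 2 <= 9 * s ^+ 2 * (mesh n)^-2.
  have /andP[b0 b1] := B a; rewrite -[(mesh n)^-2]/((mesh n ^+ 2)^-1) ler_pdivlMr ?exprn_gt0 //.
  by rewrite -exprMn mulrC; nra.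
set W0 := wsum3 _ _ _ _ _; set W1 := wsum3 _ _ _ _ _; set W2 := wsum3 _ _ _ _ _.
have wge0 (g : nat -> nat -> nat -> R) : (forall i j l, 0 <= g i j l) -> 0 <= wsum3 (gsize n)
    (slab n (z 0 0) s) (slab n (z 0 1) s) (slab n (z 0 2%:R) s) g.
  move=> g0; apply: sumr_ge0 => ? _; apply: mulr_ge0 => //; apply: sumr_ge0 => ? _.
  by apply: mulr_ge0 => //; apply: sumr_ge0 => ? _; apply: mulr_ge0.
have W00 : 0 <= W0 by apply: wge0 => *; apply: sumr_ge0 => *; exact: sqr_ge0.
have W10 : 0 <= W1 by apply: wge0 => *; apply: sumr_ge0 => *; exact: sqr_ge0.
have W20 : 0 <= W2 by apply: wge0 => *; apply: sumr_ge0 => *; exact: sqr_ge0.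
set W := wsum3 _ _ _ _ (fun i j k => (mesh n)^-2 * _).
have WE : W = (mesh n)^-2 * (W0 + W1 + W2).
  rewrite /W /W0 /W1 /W2 !wsum3E -!sum3_add -sum3_scale.
  apply: eq_bigr => a _; apply: eq_bigr => b _; apply: eq_bigr => c _.
  rewrite /shift2 sumr3 gpoint_shift0 gpoint_shift1 gpoint_shift2 /dist2; ring.
rewrite WE [leRHS]mulrCA ler_wpM2l ?exprn_ge0 ?(ltW h0) //.
have X0 := ler_wpM2r W00 (B2 (z 0 0)); have X1 := ler_wpM2r W10 (B2 (z 0 1)).
have X2 := ler_wpM2r W20 (B2 (z 0 2%:R)).
rewrite -/mA in X0; rewrite -/mB in X1; rewrite -/mC in X2.
have -> : 27 * s ^+ 2 * ((mesh n)^-2 * (W0 + W1 + W2)) =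
  3 * (9 * s ^+ 2 / mesh n ^+ 2 * W0 + 9 * s ^+ 2 / mesh n ^+ 2 * W1 + 9 * s ^+ 2 / mesh n ^+ 2 * W2) by ring.
by rewrite ler_wpM2l // lerD // lerD.
Qed.

Lemma shift2_le : exists2 M, 0 <= M & forall d e, 0 < d -> 0 < e ->
  \forall n \near \oo, forall x, in_box 4 x ->
    (mesh n)^-2 * shift2 n x <= (inball x)%:R * energy_density x + e + M * (inshell d x)%:R.
Proof.
have [L L0 LP] := extv_lip.
exists (9 * L ^+ 2) => [|d e d0 e0]; first by rewrite mulr_ge0 ?sqr_ge0.
have e9 : 0 < e / 9 by lra.
near=> n => x bx.
have h0 : 0 < mesh n :> R by exact: mesh_gt0.
have Q0 j : (ext (f 0) (k 0) (mesh n *: evec j + x) - ext (f 0) (k 0) x) ^+ 2 <=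
    mesh n ^+ 2 * ((inball x)%:R * p 0 j x ^+ 2 + e / 9 + L ^+ 2 * (inshell d x)%:R).
  by move: x j bx; near: n; exact: (ext_quotient (Cf 0) (LP 0) e9 d0).
have Q1 j : (ext (f 1) (k 1) (mesh n *: evec j + x) - ext (f 1) (k 1) x) ^+ 2 <=
    mesh n ^+ 2 * ((inball x)%:R * p 1 j x ^+ 2 + e / 9 + L ^+ 2 * (inshell d x)%:R).
  by move: x j bx {Q0}; near: n; exact: (ext_quotient (Cf 1) (LP 1) e9 d0).
have Q2 j : (ext (f 2%:R) (k 2%:R) (mesh n *: evec j + x) - ext (f 2%:R) (k 2%:R) x) ^+ 2 <=
    mesh n ^+ 2 * ((inball x)%:R * p 2%:R j x ^+ 2 + e / 9 + L ^+ 2 * (inshell d x)%:R).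
  by move: x j bx {Q0 Q1}; near: n; exact: (ext_quotient (Cf 2%:R) (LP 2%:R) e9 d0).
rewrite mulrC -[(mesh n)^-2]/((mesh n ^+ 2)^-1) ler_pdivrMr ?exprn_gt0 // [leRHS]mulrC.
rewrite /shift2 /dist2 /energy_density.
apply: (@le_trans _ _ (\sum_(j < 3) \sum_(c < 3) mesh n ^+ 2 *
    ((inball x)%:R * p c j x ^+ 2 + e / 9 + L ^+ 2 * (inshell d x)%:R))).
  by apply: ler_sum => j _; apply: ler_sum => c _; case: (ord3P c) => ->; [exact: Q0|exact: Q1|exact: Q2].
by rewrite !sumr3 le_eqVlt; apply/orP; left; apply/eqP; field.
Unshelve. all: by end_near. Qed.

Lemma dist2_triangle x y z : dist2 x z <= 2 * dist2 x y + 2 * dist2 y z.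
Proof.
rewrite /dist2 !mulr_sumr -big_split; apply: ler_sum => c _ /=.
have := sqr_ge0 ((extv c x - extv c y) - (extv c y - extv c z)); nra.
Qed.

(** The closing arithmetic of [poincare], isolated so that products become atoms for [lra]; there
    [T = 54 s^2]. *)
Lemma poincare_constants (x1 x2 x3 x4 x5 T M K a d e : R) :
  x1 <= 2 * x2 + 1024 * a -> x2 <= T / 2 * x3 -> T * x3 <= T * (x4 + 512 * a + M * x5) ->
  T * x4 <= T * (K + a) -> T * (M * x5) <= T * (M * (6144 * d + a)) ->
  (T * (513 + M) + 1024) * a <= e / 2 -> T * (M * (6144 * d)) <= e / 2 ->
  x1 <= T * K + e.
Proof. by move=> *; lra. Qed.

(** Each grid yields a base point [S n], and [y] is their limit along [ultra]. Passing from [S n] to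
    [y] by the triangle inequality doubles 27 to 54 and leaves an error that is small because the
    extension is Lipschitz. *)
Lemma poincare z (s K : R) : 0 < s -> (forall i, `|z 0 i| + s <= 4) ->
  upint (fun x => (incube z s x)%:R * ((inball x)%:R * energy_density x)) K ->
  exists2 y, incube z s y & upint (fun x => (incube z s x)%:R * dist2 x y) (54 * s ^+ 2 * K).
Proof.
move=> s0 zs HK.
pose good n y := incube z s y /\ (mesh n <= s ->
    riemann n (fun x => (incube z s x)%:R * dist2 x y) <=
    27 * s ^+ 2 * riemann n (fun x => (incube z s x)%:R * ((mesh n)^-2 * shift2 n x))).
have zz : incube z s z by apply/incubeP => i; rewrite subrr normr0 ltW.
have /choice[S SP] : forall n, exists y, good n y.
  move=> n; have [hs|hs] := lerP (mesh n : R) s; last by exists z; split=> //; lra.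
  by have [y] := poincare_grid s0 zs hs; exists y; split.
have [y Qy yP] := ultra_limit (fun n => (SP n).1).
exists y => //.
have [L L0 LP] := extv_lip.
have [M M0 MP] := shift2_le.
have small (c e : R) : 0 <= c -> 0 < e -> exists2 a, 0 < a & c * a <= e.
  move=> c0 e0; exists (e / (c + 1)); first by rewrite divr_gt0 // ltr_wpDl.
  have c1 : 0 < c + 1 by lra.
  rewrite mulrA ler_pdivrMr //; nra.
move=> e e0; have e2 : 0 < e / 2 by rewrite divr_gt0.
have [T TE] : exists T, T = 54 * s ^+ 2 by exists (54 * s ^+ 2).
have T0 : 0 <= T by rewrite TE mulr_ge0 // sqr_ge0.
have TM := mulr_ge0 T0 M0.
have [|a a0 aP] := small (T * (513 + M) + 1024) _ _ e2.
  lra.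
have [|d1 d10 dP] := small (T * (M * 6144)) _ _ e2; first lra.
have [d [d0 dh dd]] : exists d : R, [/\ 0 < d, d <= 2^-1 & T * (M * (6144 * d)) <= e / 2].
  exists (Num.min d1 2^-1); split.
  - by rewrite lt_min d10 invr_gt0 ltr0n.
  - by rewrite ge_min lexx orbT.
  - have : Num.min d1 2^-1 <= d1 by rewrite ge_min lexx.
    move=> /(ler_wpM2l TM); clear -dP; lra.
have L2 : 0 <= 3 * L ^+ 2 by rewrite mulr_ge0 // sqr_ge0.
have [r1 r10 rP] := small _ _ L2 a0.
have [r [r0 rl rP']] : exists r : R, [/\ 0 < r, r <= 1 & 3 * L ^+ 2 * r <= a].
  exists (Num.min r1 1); split.
  - by rewrite lt_min r10 ltr01.
  - by rewrite ge_min lexx orbT.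
  - by apply: le_trans rP; rewrite ler_wpM2l // ge_min lexx.
have U1 := oo_ultra (mesh_small s0).
have U2 := oo_ultra (MP d a d0 a0).
have U3 := yP _ (nbhsx_ballx y r r0).
have U4 := HK a a0.
have U5 := upint_shell d0 dh a0.
apply: filterS (filterI (filterI U1 U2) (filterI U3 (filterI U4 U5))).
move=> n [[/= hs V2] [V3 [V4 V5]]].
have Sy : dist2 (S n) y <= a.
  apply: (@le_trans _ _ (3 * (L * r) ^+ 2)).
    have Lr : 0 <= L * r by rewrite mulr_ge0 // ltW.
    have D c : (extv c (S n) - extv c y) ^+ 2 <= (L * r) ^+ 2.
      rewrite -(@real_normK _ (_ - _)) ?num_real // ler_sqr ?nnegrE //.
      apply: LP => i; move: V3; rewrite -ball_normE /= => /ltW; rewrite norm_mxP ?(ltW r0) //.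
      by move/forallP => /(_ i); rewrite !mxE distrC.
    by rewrite /dist2 sumr3; move: (D 0) (D 1) (D 2%:R); clear; lra.
  apply: le_trans rP'; rewrite exprMn mulrA ler_wpM2l //.
  by rewrite expr2 ler_piMr // ltW.
have Sn := (SP n).2 hs.
have E1 : riemann n (fun x => (incube z s x)%:R * dist2 x y) <=
    2 * riemann n (fun x => (incube z s x)%:R * dist2 x (S n)) + 1024 * a.
  have -> : 1024 * a = 512 * (2 * a) by ring.
  rewrite -(riemann_cst n) -(riemann_scale n 2) -riemann_add; apply: riemann_le => x _.
  have := dist2_triangle x (S n) y.
  clear -Sy a0; case: (incube z s x); rewrite /= ?mulr1n ?mulr0n ?mul1r ?mul0r ?mulr0; lra.
have E2 : riemann n (fun x => (incube z s x)%:R * ((mesh n)^-2 * shift2 n x)) <=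
    riemann n (fun x => (incube z s x)%:R * ((inball x)%:R * energy_density x)) + 512 * a
     + M * riemann n (fun x => (inshell d x)%:R).
  rewrite -(riemann_cst n) -(riemann_scale n M) -!riemann_add; apply: riemann_le => x bx.
  have := V2 x bx.
  have : 0 <= M * (inshell d x)%:R by rewrite mulr_ge0.
  clear -a0; case: (incube z s x); rewrite /= ?mulr1n ?mulr0n ?mul1r ?mul0r ?mulr0; lra.
have E3 := ler_wpM2l M0 V5.
have E4 := ler_wpM2l T0 E2.
have E5 : T * riemann n (fun x => (incube z s x)%:R * ((inball x)%:R * energy_density x)) <= T * (K + a).
  by rewrite ler_wpM2l.
have E6 := ler_wpM2l T0 E3.
have TE2 : 27 * s ^+ 2 = T / 2 by rewrite TE; field.
rewrite -TE; rewrite TE2 in Sn.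
exact: poincare_constants E1 Sn E4 E5 E6 aP dd.
Qed.

End poincare.

(** * Symmetry of second derivatives *)

Section pointwise_calculus.
Context {R : realType}.
Implicit Types (f : 'rV[R]_3 -> R) (x y : 'rV[R]_3).

Lemma C1_shift f p v : C1 f p -> C1 (fun x => f (v + x)) (fun j x => p j (v + x)).
Proof.
move=> [cf cp df].
have cv : continuous (fun x => v + x).
  by move=> x; apply: (@continuousD _ _ _ (fun=> v) id); [exact: cst_continuous|exact: cvg_id].
split=> [x|j x|j x].
- by apply: (@continuous_comp _ _ _ (fun x => v + x) f); [exact: cv|exact: cf].
- by apply: (@continuous_comp _ _ _ (fun x => v + x) (p j)); [exact: cv|exact: cp].
apply/is_derive_lineP; have /is_derive_lineP := df j (v + x).
by congr (is_derive _ _ _ _); apply/funext => h; rewrite addrCA.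
Qed.

Lemma MVT_axis_sym f p x j (h : R) : C1 f p ->
  exists2 t, `|t| <= `|h| & f (h *: evec j + x) - f x = h * p j (t *: evec j + x).
Proof.
move=> Cf; case: (lerP 0 h) => h0.
  have [t /andP[t0 th] E] := MVT_axis x j Cf h0.
  by exists t => //; rewrite !ger0_norm.
have h0' : 0 <= - h by rewrite oppr_ge0 ltW.
have [t /andP[t0 th] E] := MVT_axis (h *: evec j + x) j Cf h0'.
exists (t + h).
  have th' : t + h <= 0 by lra.
  by rewrite (ler0_norm th') (ler0_norm (ltW h0)); lra.
move: E; rewrite !addrA -!scalerDl addNr scale0r add0r => E.
by rewrite -[LHS]opprK opprB E mulNr opprK.
Qed.

Lemma cts_near f x (e : R) : continuous f -> 0 < e ->
  exists2 d, 0 < d & forall y, (forall i, `|x 0 i - y 0 i| <= d) -> `|f x - f y| <= e.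
Proof.
move=> cf e0; have [d d0 H] := unif_cont_box `|x| cf e0.
exists d => // y; apply: H => i.
by move: i; apply/forallP; rewrite -norm_mxP.
Qed.

Lemma eq0_small (a C : R) : (forall e, 0 < e -> `|a| <= C * e) -> a = 0.
Proof.
move=> H; apply/eqP; rewrite -normr_eq0; apply/eqP/le_anti; rewrite normr_ge0 andbT.
apply/ler_addgt0Pr => e e0; rewrite add0r.
have c0 : 0 < `|C| + 1 by rewrite ltr_wpDl.
apply: le_trans (H (e / (`|C| + 1)) _) _; first by rewrite divr_gt0.
rewrite mulrA ler_pdivrMr // mulrC ler_wpM2l ?(ltW e0) //.
by apply: le_trans (ler_norm _) _; rewrite lerDl.
Qed.

Lemma coord_axis (s : R) (j : 'I_3) x (i : 'I_3) : (s *: evec j + x) 0 i = s * (i == j)%:R + x 0 i.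
Proof. by rewrite !mxE eqxx. Qed.

Lemma axis_dist (s : R) (j i : 'I_3) : `|s * (i == j)%:R| <= `|s| :> R.
Proof. by case: (i == j); rewrite ?mulr1 ?mulr0 ?normr0. Qed.

(** The second difference is symmetric in its two directions, and the mean value theorem, applied in
    either order, makes it [t^2] times a mixed derivative near [x]. *)
Lemma mixed_partials f p (H : 'I_3 -> 'I_3 -> 'rV[R]_3 -> R) i j : C1 f p ->
  (forall i, C1 (p i) (H i)) -> forall x, H i j x = H j i x.
Proof.
move=> Cf Cp x; apply/eqP; rewrite -subr_eq0; apply/eqP.
apply: (@eq0_small _ 2) => e e0.
have [_ ch _] := Cp i; have [_ ch' _] := Cp j.
have [d d0 dP] := cts_near x (ch j) e0.
have [d' d'0 dP'] := cts_near x (ch' i) e0.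
pose t := Num.min d d' / 2.
have t0 : 0 < t by rewrite divr_gt0 // lt_min d0.
have td : 2 * t <= d by rewrite /t mulrC divfK // ge_min lexx.
have td' : 2 * t <= d' by rewrite /t mulrC divfK // ge_min lexx orbT.
have key (a b : 'I_3) : exists2 z : 'rV[R]_3, (forall i, `|x 0 i - z 0 i| <= 2 * t) &
   f (t *: evec a + (t *: evec b + x)) - f (t *: evec b + x) - (f (t *: evec a + x) - f x)
   = t * (t * H b a z).
  have Cg := C1_sub (C1_shift (t *: evec a) Cf) Cf.
  have [s /andP[s0 st] E] := MVT_axis x b Cg (ltW t0).
  have [r /andP[r0 rt] E'] := MVT_axis (s *: evec b + x) a (Cp b) (ltW t0).
  exists (r *: evec a + (s *: evec b + x)).
    move=> l; rewrite !coord_axis.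
    have -> : x 0 l - (r * (l == a)%:R + (s * (l == b)%:R + x 0 l)) =
      - (r * (l == a)%:R + s * (l == b)%:R) by ring.
    rewrite normrN; apply: le_trans (ler_normD _ _) _.
    have := axis_dist r a l; have := axis_dist s b l.
    by rewrite !(ger0_norm r0) !(ger0_norm s0); lra.
  by rewrite E E'.
have [z zP Ez] := key i j; have [w wP Ew] := key j i.
have : t * (t * H j i z) = t * (t * H i j w).
  by rewrite -Ez -Ew addrCA; ring.
move=> /(mulfI (lt0r_neq0 t0)) /(mulfI (lt0r_neq0 t0)) E.
have h1 : `|H i j x - H i j w| <= e by apply: dP => l; apply: le_trans (wP l) td.
have h2 : `|H j i x - H j i z| <= e by apply: dP' => l; apply: le_trans (zP l) td'.
have -> : H i j x - H j i x = (H i j x - H i j w) - (H j i x - H j i z) by rewrite E; ring.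
by apply: le_trans (ler_normB _ _) _; lra.
Qed.

(** Rotate [x] in the [(i,j)] plane by the angle whose half has tangent [s]: its sine is [c], its
    cosine [1 - c s]. The rotated point [z] stays on the sphere and is reached by two axis steps, of
    lengths [b] and [a]. The mean value theorem on both steps with [f z = f x = 0] gives the
    identity up to terms that vanish with [s]. *)
Lemma tangential_derivative f p i j x : C1 f p -> (forall y, sqn y = 1 -> f y = 0) ->
  sqn x = 1 -> x 0 i * p j x = x 0 j * p i x.
Proof.
move=> Cf f0 x1; case: (eqVneq i j) => [->//|ij].
have [cf cp df] := Cf.
have xb l : `|x 0 l| <= 1 by apply: coord_le; rewrite ?expr1n ?x1.
apply/eqP; rewrite -subr_eq0; apply/eqP.
apply: (@eq0_small _ (4 + `|p i x| + `|p j x|)) => e e0.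
have [d d0 dP] := cts_near x (cp i) e0.
have [d' d'0 dP'] := cts_near x (cp j) e0.
have [s [s0 s1 se sd sd']] : exists s : R, [/\ 0 < s, s <= 1, s <= e, 8 * s <= d & 8 * s <= d'].
  pose m := Num.min (Num.min 1 e) (Num.min (d / 8) (d' / 8)).
  have m0 : 0 < m by rewrite !lt_min ltr01 e0 !divr_gt0.
  exists m; split=> //.
  - by rewrite /m !ge_min lexx.
  - by rewrite /m !ge_min lexx !orbT.
  - have : m <= d / 8 by rewrite /m !ge_min lexx !orbT.
    lra.
  - have : m <= d' / 8 by rewrite /m !ge_min lexx !orbT.
    lra.
have D0 : 0 < 1 + s ^+ 2 by rewrite ltr_wpDr ?sqr_ge0.
pose c := 2 * s / (1 + s ^+ 2).
have c0 : 0 < c by rewrite divr_gt0 // mulr_gt0.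
have c2 : c <= 2 * s.
  by rewrite ler_pdivrMr // ler_peMr ?mulr_ge0 ?(ltW s0) // lerDl sqr_ge0.
pose a := - (c * (x 0 j + s * x 0 i)); pose b := c * (x 0 i - s * x 0 j).
have ab (u v : R) : `|u| <= 1 -> `|v| <= 1 -> `|c * (u + s * v)| <= 4 * s.
  rewrite !ler_norml => /andP[u1 u2] /andP[v1 v2].
  have : -2 <= u + s * v <= 2 by apply/andP; split; nra.
  by move=> /andP[h1 h2]; apply/andP; split; nra.
have a4 : `|a| <= 4 * s by rewrite normrN; apply: ab.
have b4 : `|b| <= 4 * s.
  by rewrite /b -mulrN; apply: ab; rewrite ?normrN.
pose y := b *: evec j + x; pose z := a *: evec i + y.
have z1 : sqn z = 1.
  have E : sqn z = sqn x + (2 * a * x 0 i + a ^+ 2) + (2 * b * x 0 j + b ^+ 2).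
    rewrite !sqnE /z /y !coord_axis; move: ij.
    by case: (ord3P i) => ->; case: (ord3P j) => -> //= _; ring.
  by rewrite E x1 /a /b /c; field; rewrite gt_eqF.
have [t ta Et] := MVT_axis_sym y i a Cf.
have [r rb Er] := MVT_axis_sym x j b Cf.
have E : a * p i (t *: evec i + y) + b * p j (r *: evec j + x) = 0.
  by rewrite -Et -Er -/y -/z (f0 z z1) (f0 x x1); ring.
set P := p i _ in E; set Q := p j _ in E.
have {}E : (x 0 i - s * x 0 j) * Q = (x 0 j + s * x 0 i) * P.
  apply: (mulfI (lt0r_neq0 c0)); move: E; rewrite /a /b => E; lra.
have hP : `|p i x - P| <= e.
  apply: dP => l; rewrite /y !coord_axis.
  have -> : x 0 l - (t * (l == i)%:R + (b * (l == j)%:R + x 0 l)) =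
     - (t * (l == i)%:R + b * (l == j)%:R) by ring.
  rewrite normrN; apply: le_trans (ler_normD _ _) _.
  have := axis_dist t i l; have := axis_dist b j l; lra.
have hQ : `|p j x - Q| <= e.
  apply: dP' => l; rewrite !coord_axis opprD addrCA subrr addr0 normrN.
  by apply: le_trans (axis_dist r j l) _; lra.
have -> : x 0 i * p j x - x 0 j * p i x =
   (x 0 i - s * x 0 j) * (p j x - Q) - (x 0 j + s * x 0 i) * (p i x - P) +
   s * (x 0 j * p j x + x 0 i * p i x).
  by rewrite !mulrBr E; ring.
have n1 (u v : R) : `|u| <= 1 -> `|v| <= 1 -> `|u + s * v| <= 2.
  rewrite !ler_norml => /andP[u1 u2] /andP[v1 v2]; apply/andP; split; nra.
have m1 : `|(x 0 i - s * x 0 j) * (p j x - Q)| <= 2 * e.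
  by rewrite normrM ler_pM //; rewrite -mulrN; apply: n1; rewrite ?normrN.
have m2 : `|(x 0 j + s * x 0 i) * (p i x - P)| <= 2 * e.
  by rewrite normrM ler_pM //; apply: n1.
have m3 : `|s * (x 0 j * p j x + x 0 i * p i x)| <= e * (`|p j x| + `|p i x|).
  rewrite normrM (ger0_norm (ltW s0)) ler_pM // ?(ltW s0) //.
  apply: le_trans (ler_normD _ _) _; rewrite !normrM lerD //; by rewrite ler_piMl.
apply: le_trans (ler_normD _ _) _.
have := ler_normB ((x 0 i - s * x 0 j) * (p j x - Q)) ((x 0 j + s * x 0 i) * (p i x - P)).
move: m1 m2 m3; clear; move: (`|_ * _|) (`|_ * _|) (`|s * _|) => *; nra.
Qed.

Lemma locally_constant f p (k : R) j x : C1 f p -> (forall y, inball y -> f y = k) ->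
  inball x -> p j x = 0.
Proof.
move=> Cf fk x1; apply: (@eq0_small _ 1) => e e0; rewrite mul1r.
have [cf cp df] := Cf; have [d d0 dP] := cts_near x (cp j) e0.
have [s [s0 sd sx]] : exists s : R, [/\ 0 < s, s <= d & inball (s *: evec j + x)].
  have Cs := @C1_sqn R; have [cs _ _] := Cs.
  have g0 : 0 < (1 - sqn x) / 2 by rewrite divr_gt0 // subr_gt0.
  have [r r0 rP] := cts_near x cs g0.
  exists (Num.min r d); split; first by rewrite lt_min r0.
    by rewrite ge_min lexx orbT.
  have : `|sqn x - sqn (Num.min r d *: evec j + x)| <= (1 - sqn x) / 2.
    apply: rP => i; rewrite coord_axis opprD addrCA subrr addr0 normrN.
    apply: le_trans (axis_dist _ _ _) _; rewrite ger0_norm ?ge_min ?lexx //.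
    by rewrite le_min !ltW.
  rewrite /inball ler_norml => /andP[h1 h2]; move: x1; rewrite /inball; lra.
have [t /andP[t0 ts]] := MVT_axis x j Cf (ltW s0).
rewrite !fk // subrr => /esym/eqP; rewrite mulf_eq0 gt_eqF //= => /eqP E.
have := dP (t *: evec j + x); rewrite E subr0; apply => i.
rewrite coord_axis opprD addrCA subrr addr0 normrN.
by apply: le_trans (axis_dist _ _ _) _; rewrite ger0_norm // (le_trans ts).
Qed.

End pointwise_calculus.

(** * Energy growth and Hardy inequality *)

Section newton_kernel.
Context {R : realType} (a : 'rV[R]_3) (rho : R).
Hypothesis rho0 : 0 < rho.
Implicit Types x : 'rV[R]_3.

Definition rel i x : R := x 0 i - a 0 i.
Definition sqr_dist x : R := \sum_(i < 3) rel i x ^+ 2.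
Definition kern x : R := (Num.sqrt (sqr_dist x + rho ^+ 2))^-1.

Lemma C1_rel i : C1 (rel i) (fun j _ => (i == j)%:R).
Proof.
by apply: (C1_ext (C1_sub (C1_coord i) (C1_cst (a 0 i)))) => // j x; rewrite subr0.
Qed.

Lemma C1_sqr_dist : C1 sqr_dist (fun j x => 2 * rel j x).
Proof.
apply: (C1_ext (C1_sum (fun i => C1_exp 1 (C1_rel i)))) => // j x.
by rewrite sumr3; case: (ord3P j) => -> /=; rewrite expr1; ring.
Qed.

Lemma sqr_dist_ge0 x : 0 <= sqr_dist x.
Proof. by apply: sumr_ge0 => i _; exact: sqr_ge0. Qed.

Lemma kern_den x : 0 < sqr_dist x + rho ^+ 2.
Proof. by rewrite ltr_wpDl ?sqr_dist_ge0 // exprn_gt0. Qed.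

Lemma kern_gt0 x : 0 < kern x.
Proof. by rewrite invr_gt0 sqrtr_gt0 kern_den. Qed.

Lemma kern_sqr x : kern x ^+ 2 * (sqr_dist x + rho ^+ 2) = 1.
Proof. by rewrite exprVn sqr_sqrtr ?(ltW (kern_den x)) // mulVf // gt_eqF // kern_den. Qed.

Lemma C1_kern : C1 kern (fun j x => - (rel j x * kern x ^+ 3)).
Proof.
have C := C1_sqrt (C1_add C1_sqr_dist (C1_cst (rho ^+ 2))) kern_den.
apply: (C1_ext (C1_inv C _)) => // [x|j x]; first by rewrite gt_eqF // sqrtr_gt0 kern_den.
have k0 : Num.sqrt (sqr_dist x + rho ^+ 2) != 0 by rewrite gt_eqF // sqrtr_gt0 kern_den.
by rewrite /kern; field.
Qed.

Lemma kern_dist_le1 x : kern x ^+ 2 * sqr_dist x <= 1.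
Proof.
rewrite -(kern_sqr x) ler_wpM2l ?sqr_ge0 // lerDl sqr_ge0 //.
Qed.

End newton_kernel.

Section stress.
Context {R : realType} (f : 'rV[R]_3 -> R) (p : 'I_3 -> 'rV[R]_3 -> R)
  (H : 'I_3 -> 'I_3 -> 'rV[R]_3 -> R).
Hypotheses (Cp : forall i, C1 (p i) (H i)) (Hsym : forall i j x, H i j x = H j i x).
Variables (a : 'rV[R]_3) (rho : R).
Hypothesis rho0 : 0 < rho.
Implicit Types x : 'rV[R]_3.
Let w := kern a rho.
Let z := rel a.

Definition grad2 x : R := \sum_(i < 3) p i x ^+ 2.
Definition laplacian x : R := \sum_(i < 3) H i i x.
Definition radial_grad x : R := \sum_(i < 3) p i x * z i x.

Definition stress_field i x : R := (2^-1 * grad2 x * z i x - p i x * radial_grad x) * w x.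
Definition stress_deriv i l x : R :=
  (\sum_(m < 3) p m x * H m l x * z i x + 2^-1 * grad2 x * (i == l)%:R - H i l x * radial_grad x
   - p i x * \sum_(m < 3) (H m l x * z m x + p m x * (m == l)%:R)) * w x
  - (2^-1 * grad2 x * z i x - p i x * radial_grad x) * (z l x * w x ^+ 3).

Lemma C1_grad2 : C1 grad2 (fun l x => \sum_(m < 3) 2 * p m x * H m l x).
Proof.
exact: (C1_ext (C1_sum (fun i => C1_exp 1 (Cp i)))).
Qed.

Lemma C1_radial_grad : C1 radial_grad (fun l x => \sum_(m < 3) (H m l x * z m x + p m x * (m == l)%:R)).
Proof. exact: C1_sum (fun i => C1_mul (Cp i) (C1_rel a i)). Qed.

Lemma C1_stress i : C1 (stress_field i) (stress_deriv i).
Proof.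
have C := C1_mul (C1_sub (C1_mul (C1_mul (C1_cst 2^-1) C1_grad2) (C1_rel a i))
   (C1_mul (Cp i) C1_radial_grad)) (C1_kern a rho0).
apply: (C1_ext C) => // l x; rewrite /stress_deriv -/z -/w.
rewrite -mulr_suml (_ : \sum_(m < 3) 2 * p m x * H m l x = 2 * \sum_(m < 3) p m x * H m l x); last first.
  by rewrite mulr_sumr; apply: eq_bigr => m _; rewrite mulrA.
by field.
Qed.

Lemma stress_divergence x : \sum_(i < 3) stress_deriv i i x =
  2^-1 * rho ^+ 2 * w x ^+ 3 * grad2 x + w x ^+ 3 * radial_grad x ^+ 2
  - w x * laplacian x * radial_grad x.
Proof.
have wE : w x = w x ^+ 3 * (sqr_dist a x + rho ^+ 2).
  by rewrite exprSr -mulrA [_ * (_ * _)]mulrCA kern_sqr // mulr1.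
transitivity (w x * (2^-1 * grad2 x - laplacian x * radial_grad x) -
   w x ^+ 3 * (2^-1 * grad2 x * sqr_dist a x - radial_grad x ^+ 2)).
  rewrite /stress_deriv /grad2 /laplacian /radial_grad /sqr_dist !sumr3 !eqxx /=.
  by rewrite -/z (Hsym 1 0) (Hsym 2%:R 0) (Hsym 2%:R 1) !mulr0n !mulr1n; field.
by have := congr1 (fun t => t * grad2 x) wE; lra.
Qed.

(** On the sphere the gradient is the normal vector [W x], so the flux is [- w W^2 (x . z) / 2],
    where [2 x . z = |x - a|^2 + 1 - |a|^2 >= 0]. *)
Lemma stress_boundary x : sqn x = 1 -> sqn a <= 1 ->
  (forall i j, x 0 i * p j x = x 0 j * p i x) -> \sum_(j < 3) x 0 j * stress_field j x <= 0.
Proof.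
move=> x1 a1 tang.
set W := \sum_(i < 3) x 0 i * p i x.
have pE j : p j x = x 0 j * W.
  rewrite -[LHS]mul1r -x1 /sqn /W mulr_suml mulr_sumr; apply: eq_bigr => i _.
  by rewrite expr2 -mulrA tang; ring.
pose v := \sum_(i < 3) x 0 i * z i x.
have -> : \sum_(j < 3) x 0 j * stress_field j x = - (2^-1 * w x * W ^+ 2 * v).
  have g2 : grad2 x = W ^+ 2.
    rewrite /grad2 (eq_bigr (fun i => x 0 i ^+ 2 * W ^+ 2)); last by move=> i _; rewrite pE exprMn.
    by rewrite -mulr_suml -/(sqn x) x1 mul1r.
  have rg : radial_grad x = W * v.
    by rewrite /radial_grad /v mulr_sumr; apply: eq_bigr => i _; rewrite pE; ring.
  rewrite (eq_bigr (fun j => w x * (2^-1 * W ^+ 2) * (x 0 j * z j x) - w x * (W * v) * (x 0 j * p j x))).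
    by rewrite sumrB -!mulr_sumr -/v -/W; field.
  by move=> j _; rewrite /stress_field g2 rg; ring.
rewrite oppr_le0; apply: mulr_ge0.
  apply: mulr_ge0; last exact: sqr_ge0.
  by apply: mulr_ge0 => //; exact: ltW (kern_gt0 a rho0 x).
have -> : v = 2^-1 * (\sum_(i < 3) (x 0 i - a 0 i) ^+ 2 + (sqn x - sqn a)).
  by rewrite /v /z /rel !sqnE !sumr3; field.
by rewrite mulr_ge0 // addr_ge0 ?subr_ge0 ?x1 // sumr_ge0 // => i _; exact: sqr_ge0.
Qed.

Lemma radial_grad_le x : radial_grad x ^+ 2 <= grad2 x * sqr_dist a x.
Proof.
rewrite /radial_grad /grad2 /sqr_dist -/z !sumr3.
move: (p 0 x) (p 1 x) (p 2%:R x) (z 0 x) (z 1 x) (z 2%:R x) => p0 p1 p2 z0 z1 z2.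
have := sqr_ge0 (p0 * z1 - p1 * z0); have := sqr_ge0 (p0 * z2 - p2 * z0).
have := sqr_ge0 (p1 * z2 - p2 * z1); nra.
Qed.

End stress.

Section hardy.
Context {R : realType} (a : 'rV[R]_3) (rho : R).
Hypothesis rho0 : 0 < rho.
Implicit Types x : 'rV[R]_3.
Let A : R := sqn a.
Let z := rel a.

(* [img_den] is |a|^2 |x - a/|a|^2|^2, the (rescaled) squared distance to the
   inversion of a in the sphere; it coincides with |x - a|^2 on the sphere. *)
Definition img_den x : R := A * sqn x - 2 * (\sum_(i < 3) a 0 i * x 0 i) + 1.
Definition img i x : R := A * x 0 i - a 0 i.
Definition W1 x : R := (sqr_dist a x + rho ^+ 2)^-1.
Definition W2 x : R := (img_den x + rho ^+ 2)^-1.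
(** The flux of the first term alone is unbounded as [a] nears the sphere and [rho] tends to 0. On
    the sphere both denominators agree and [x . z + x . img = |x - a|^2], so the first two terms
    together have flux at most 1; subtracting [x] makes it nonpositive and costs 3 in the
    divergence. *)
Definition hardy_field i x : R := z i x * W1 x + img i x * W2 x - x 0 i.
Definition hardy_deriv i l x : R :=
  (i == l)%:R * W1 x - z i x * (W1 x ^+ 2 * (2 * z l x)) +
  (A * (i == l)%:R * W2 x - img i x * (W2 x ^+ 2 * (2 * img l x))) - (i == l)%:R.
Definition hardy_weight x : R := W1 x + A * W2 x.

Lemma C1_img i : C1 (img i) (fun l _ => A * (i == l)%:R).
Proof.
apply: (C1_ext (C1_sub (C1_mul (C1_cst A) (C1_coord i)) (C1_cst (a 0 i)))) => // l x.
by rewrite mul0r add0r subr0.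
Qed.

Lemma C1_img_den : C1 img_den (fun l x => 2 * img l x).
Proof.
have C := C1_add (C1_sub (C1_mul (C1_cst A) C1_sqn)
  (C1_mul (C1_cst 2) (C1_sum (fun i => C1_mul (C1_cst (a 0 i)) (C1_coord i))))) (C1_cst 1).
apply: (C1_ext C) => // l x; rewrite !sumr3 /img.
by case: (ord3P l) => -> /=; ring.
Qed.

Lemma img_den_ge0 x : 0 <= img_den x.
Proof.
have -> : img_den x = (A * sqn x - (\sum_(i < 3) a 0 i * x 0 i) ^+ 2) + ((\sum_(i < 3) a 0 i * x 0 i) - 1) ^+ 2.
  by rewrite /img_den; ring.
apply: addr_ge0; last exact: sqr_ge0.
rewrite subr_ge0 /A !sqnE sumr3.
move: (a 0 0) (a 0 1) (a 0 2%:R) (x 0 0) (x 0 1) (x 0 2%:R) => a0 a1 a2 x0 x1 x2.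
have := sqr_ge0 (a0 * x1 - a1 * x0); have := sqr_ge0 (a0 * x2 - a2 * x0).
have := sqr_ge0 (a1 * x2 - a2 * x1); nra.
Qed.

Lemma den1_gt0 x : 0 < sqr_dist a x + rho ^+ 2.
Proof. exact: kern_den. Qed.
Lemma den2_gt0 x : 0 < img_den x + rho ^+ 2.
Proof. by rewrite ltr_wpDl ?img_den_ge0 // exprn_gt0. Qed.
Lemma W1_gt0 x : 0 < W1 x. Proof. by rewrite invr_gt0 den1_gt0. Qed.
Lemma W2_gt0 x : 0 < W2 x. Proof. by rewrite invr_gt0 den2_gt0. Qed.
Lemma W1E x : W1 x * (sqr_dist a x + rho ^+ 2) = 1.
Proof. by rewrite mulVf // gt_eqF // den1_gt0. Qed.
Lemma W2E x : W2 x * (img_den x + rho ^+ 2) = 1.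
Proof. by rewrite mulVf // gt_eqF // den2_gt0. Qed.

Lemma C1_W1 : C1 W1 (fun l x => - (W1 x ^+ 2 * (2 * z l x))).
Proof.
have C := C1_add (C1_sqr_dist a) (C1_cst (rho ^+ 2)).
apply: (C1_ext (C1_inv C _)) => // [x|l x]; first by rewrite gt_eqF // den1_gt0.
by rewrite addr0.
Qed.

Lemma C1_W2 : C1 W2 (fun l x => - (W2 x ^+ 2 * (2 * img l x))).
Proof.
have C := C1_add C1_img_den (C1_cst (rho ^+ 2)).
apply: (C1_ext (C1_inv C _)) => // [x|l x]; first by rewrite gt_eqF // den2_gt0.
by rewrite addr0.
Qed.

Lemma C1_hardy i : C1 (hardy_field i) (hardy_deriv i).
Proof.
have C := C1_sub (C1_add (C1_mul (C1_rel a i) C1_W1) (C1_mul (C1_img i) C1_W2)) (C1_coord i).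
by apply: (C1_ext C) => // l x; rewrite /hardy_deriv -/z; ring.
Qed.

Lemma img_sqr x : \sum_(i < 3) img i x ^+ 2 = A * img_den x.
Proof. by rewrite /img_den /img /A !sqnE !sumr3; ring. Qed.

(** Of the 3 copies of each weight given by the dimension, differentiating the weight removes at
    most 2. *)
Lemma hardy_divergence_ge x : hardy_weight x - 3 <= \sum_(i < 3) hardy_deriv i i x.
Proof.
have -> : \sum_(i < 3) hardy_deriv i i x = 3 * W1 x - 2 * W1 x ^+ 2 * sqr_dist a x
   + (3 * A * W2 x - 2 * W2 x ^+ 2 * (\sum_(i < 3) img i x ^+ 2)) - 3.
  by rewrite /hardy_deriv /sqr_dist -/z !sumr3 /= !mulr1n; ring.
rewrite img_sqr /hardy_weight.
have h1 : W1 x ^+ 2 * sqr_dist a x <= W1 x.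
  rewrite -[leRHS]mulr1 -(W1E x) mulrA ler_wpM2l ?sqr_ge0 // lerDl sqr_ge0 //.
have h2 : W2 x ^+ 2 * img_den x <= W2 x.
  rewrite -[leRHS]mulr1 -(W2E x) mulrA ler_wpM2l ?sqr_ge0 // lerDl sqr_ge0 //.
have h3 := ler_wpM2l (sqn_ge0 a) h2.
by rewrite -/A in h3; lra.
Qed.

Lemma hardy_field_sqr_le x : inball x ->
  \sum_(i < 3) hardy_field i x ^+ 2 <= 4 * hardy_weight x + 2.
Proof.
move=> x1.
apply: (@le_trans _ _ (4 * (W1 x ^+ 2 * sqr_dist a x) + 4 * (W2 x ^+ 2 * \sum_(i < 3) img i x ^+ 2) + 2 * sqn x)).
  rewrite /sqr_dist /sqn -/z !mulr_sumr -!big_split /=; apply: ler_sum => i _.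
  rewrite /hardy_field; have := sqr_ge0 (z i x * W1 x - img i x * W2 x).
  have := sqr_ge0 (z i x * W1 x + img i x * W2 x + x 0 i); nra.
have h1 : W1 x ^+ 2 * sqr_dist a x <= W1 x.
  rewrite -[leRHS]mulr1 -(W1E x) mulrA ler_wpM2l ?sqr_ge0 // lerDl sqr_ge0 //.
have h2 : W2 x ^+ 2 * img_den x <= W2 x.
  rewrite -[leRHS]mulr1 -(W2E x) mulrA ler_wpM2l ?sqr_ge0 // lerDl sqr_ge0 //.
have h3 := ler_wpM2l (sqn_ge0 a) h2.
by move: x1; rewrite img_sqr /inball /hardy_weight -/A in h3 *; lra.
Qed.

Lemma hardy_boundary x : sqn x = 1 -> \sum_(i < 3) x 0 i * hardy_field i x <= 0.
Proof.
move=> x1.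
have E : img_den x = sqr_dist a x.
  have -> : sqr_dist a x = sqn x - 2 * (\sum_(i < 3) a 0 i * x 0 i) + sqn a.
    by rewrite /sqr_dist /rel !sqnE !sumr3; ring.
  by rewrite /img_den /A x1; ring.
have -> : \sum_(i < 3) x 0 i * hardy_field i x = sqr_dist a x * W1 x - 1.
  have EW : W2 x = W1 x by rewrite /W1 /W2 E.
  transitivity (2^-1 * (sqr_dist a x + sqn x - sqn a) * W1 x +
     2^-1 * (2 * A * sqn x + sqr_dist a x - sqn x - sqn a) * W2 x - sqn x).
    by rewrite /hardy_field /img /z /sqr_dist /rel /A !sqnE !sumr3; field.
  by rewrite EW x1 /A; field.
rewrite subr_le0 mulrC -(W1E x) ler_wpM2l ?(ltW (W1_gt0 x)) //.
by rewrite lerDl sqr_ge0.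
Qed.

Lemma hardy_le (g : 'rV[R]_3 -> R) q : C1 g q -> (forall x, 0 <= g x) ->
  upint (fun x => (inball x)%:R * \sum_(i < 3) (q i x * hardy_field i x + g x * hardy_deriv i i x)) 0.
Proof.
move=> Cg g0; apply: (divergence_le (fun i => C1_mul Cg (C1_hardy i))) => x x1.
rewrite (eq_bigr (fun j => g x * (x 0 j * hardy_field j x))); last by move=> j _; ring.
by rewrite -mulr_sumr mulr_ge0_le0 // hardy_boundary.
Qed.

(** The Hardy inequality for [g = 1], with [1536 = 3 * 512]. It bounds the square of the kernel in
    the mean value inequality, uniformly in [a] and [rho]. *)
Lemma upint_W1 : upint (fun x => (inball x)%:R * W1 x) 1536.
Proof.
have H := upint_add (hardy_le (C1_cst 1) (fun _ => ler01)) (upint_cst 3).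
apply: upint_weak (upint_le _ H) => [|x _]; first by lra.
have := hardy_divergence_ge x; rewrite /hardy_weight.
have h0 : 0 <= A * W2 x by rewrite mulr_ge0 ?sqn_ge0 // ltW // W2_gt0.
have -> : \sum_(i < 3) (0 * hardy_field i x + 1 * hardy_deriv i i x) = \sum_(i < 3) hardy_deriv i i x.
  by apply: eq_bigr => i _; rewrite mul0r add0r mul1r.
by case: (inball x); rewrite /= ?mulr1n ?mulr0n ?mul1r ?mul0r; lra.
Qed.

End hardy.

(** * Estimates for sphere-valued maps *)

Section map_estimates.
Context {R : realType}.
Implicit Types x : 'rV[R]_3.

Lemma cauchy_schwarz n (a b : 'I_n -> R) :
  (\sum_(i < n) a i * b i) ^+ 2 <= (\sum_(i < n) a i ^+ 2) * (\sum_(i < n) b i ^+ 2).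
Proof.
set A := \sum_(i < n) a i ^+ 2; set B := \sum_(i < n) b i ^+ 2; set P := \sum_(i < n) _ * _.
have A0 : 0 <= A by apply: sumr_ge0 => i _; exact: sqr_ge0.
have E (t : R) : 0 <= A - 2 * t * P + t ^+ 2 * B.
  have -> : A - 2 * t * P + t ^+ 2 * B = \sum_(i < n) (a i - t * b i) ^+ 2.
    rewrite /A /P /B !mulr_sumr -sumrB -big_split; apply: eq_bigr => i _ /=; ring.
  by apply: sumr_ge0 => i _; exact: sqr_ge0.
have B0 : 0 <= B by apply: sumr_ge0 => i _; exact: sqr_ge0.
have [B1|B1] := eqVneq B 0.
  have [->|P0] := eqVneq P 0; first by rewrite expr0n mulr_ge0.
  have := E ((A + 1) / (2 * P)); rewrite B1.
  have -> : A - 2 * ((A + 1) / (2 * P)) * P + ((A + 1) / (2 * P)) ^+ 2 * 0 = -1 by field.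
  by rewrite lerNr oppr0 ler10.
have Bp : 0 < B by rewrite lt_def B1.
have := E (P / B).
have -> : A - 2 * (P / B) * P + (P / B) ^+ 2 * B = (A * B - P ^+ 2) / B by field.
by rewrite pmulr_lge0 ?invr_gt0 // subr_ge0.
Qed.

Variables (u : 'I_3 -> 'rV[R]_3 -> R) (p : 'I_3 -> 'I_3 -> 'rV[R]_3 -> R)
  (H : 'I_3 -> 'I_3 -> 'I_3 -> 'rV[R]_3 -> R)
  (T : 'I_3 -> 'I_3 -> 'I_3 -> 'I_3 -> 'rV[R]_3 -> R) (k : 'I_3 -> R).
Hypotheses (Cu : forall c, C1 (u c) (p c)) (Cp : forall c i, C1 (p c i) (H c i))
  (CH : forall c i j, C1 (H c i j) (T c i j)).
Hypothesis u_unit : forall x, inball x -> \sum_(c < 3) u c x ^+ 2 = 1.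
Hypothesis u_bdry : forall c x, sqn x = 1 -> u c x = k c.

Lemma hess_sym c i j x : H c i j x = H c j i x.
Proof. exact: mixed_partials (Cu c) (Cp c) x. Qed.

Lemma third_sym c i j l x : T c i j l x = T c i l j x.
Proof. exact: mixed_partials (Cp c i) (CH c i) x. Qed.

Lemma u_tangential c i j x : sqn x = 1 -> x 0 i * p c j x = x 0 j * p c i x.
Proof.
move=> x1; have := tangential_derivative i j (C1_sub (Cu c) (C1_cst (k c))) _ x1.
by rewrite !subr0; apply => y y1; rewrite u_bdry // subrr.
Qed.

Local Notation V := (energy_density p).
Definition lap_comp c x : R := laplacian (H c) x.
Definition tau c x : R := lap_comp c x + V x * u c x.
Definition tau2 x : R := \sum_(c < 3) tau c x ^+ 2.
Definition hess2 x : R := \sum_(c < 3) \sum_(i < 3) \sum_(j < 3) H c i j x ^+ 2.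

Lemma energy_densityE x : V x = \sum_(c < 3) grad2 (p c) x.
Proof. by []. Qed.

Lemma energy_density_ge0 x : 0 <= V x.
Proof. by apply: sumr_ge0 => c _; apply: sumr_ge0 => j _; exact: sqr_ge0. Qed.

Lemma u_grad_orth j x : inball x -> \sum_(c < 3) u c x * p c j x = 0.
Proof.
move=> x1; have := locally_constant j (C1_sum (fun c => C1_exp 1 (Cu c))) u_unit x1.
rewrite (eq_bigr (fun c => 2 * (u c x * p c j x))); last by move=> c _; rewrite expr1 mulrA.
by rewrite -mulr_sumr => /eqP; rewrite mulf_eq0 pnatr_eq0 /= => /eqP.
Qed.

Lemma u_lap x : inball x -> \sum_(c < 3) u c x * lap_comp c x = - V x.
Proof.
move=> x1.
have E j : \sum_(c < 3) (p c j x * p c j x + u c x * H c j j x) = 0.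
  exact: (locally_constant j (C1_sum (fun c => C1_mul (Cu c) (Cp c j))) (fun y => @u_grad_orth j y) x1).
have : \sum_(j < 3) \sum_(c < 3) (p c j x * p c j x + u c x * H c j j x) = 0.
  by rewrite big1 // => j _; exact: E.
rewrite exchange_big /= => E0; apply/eqP; rewrite -addr_eq0; apply/eqP; rewrite -[RHS]E0.
rewrite energy_densityE -big_split /=; apply: eq_bigr => c _ /=.
rewrite /lap_comp /laplacian mulr_sumr -big_split; apply: eq_bigr => j _ /=.
by rewrite expr2 addrC.
Qed.

(** In the ball [tau] is the part of the Laplacian orthogonal to [u], the other part being
    [- V u]. *)
Lemma tau2E x : inball x -> \sum_(c < 3) lap_comp c x ^+ 2 = tau2 x + V x ^+ 2.
Proof.
move=> x1; have E1 := u_unit x1; have E2 := u_lap x1.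
have -> : tau2 x = \sum_(c < 3) lap_comp c x ^+ 2 + 2 * V x * \sum_(c < 3) u c x * lap_comp c x
    + V x ^+ 2 * \sum_(c < 3) u c x ^+ 2.
  by rewrite /tau2 /tau !sumr3; ring.
by rewrite E1 E2; ring.
Qed.

Section growth.
Variable eps : R.
Hypotheses (eps0 : 0 < eps) (EV : upint (fun x => (inball x)%:R * V x) (2 * eps ^+ 2))
  (ET : upint (fun x => (inball x)%:R * tau2 x) (eps ^+ 2)).

(** Because [u] is orthogonal to its derivatives, [tau] may replace the Laplacian in the last term
    of [stress_divergence]. As [w |z| <= 1], that term is at most [tau2 / 2 + V / 2], which
    contributes [eps^2 / 2 + eps^2]. *)
Lemma energy_monotonicity a rho : 0 < rho -> sqn a <= 1 ->
  upint (fun x => (inball x)%:R * (2^-1 * rho ^+ 2 * kern a rho x ^+ 3 * V x)) (3 / 2 * eps ^+ 2).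
Proof.
move=> rho0 a1; pose w := kern a rho.
have D c : upint (fun x => (inball x)%:R * \sum_(i < 3) stress_deriv (p c) (H c) a rho i i x) 0.
  apply: (divergence_le (C1_stress (Cp c) a rho0)) => x x1.
  by apply: stress_boundary => // i j; exact: u_tangential.
have h2 : 0 <= 2^-1 :> R by [].
have B := upint_add (upint_sum D) (upint_add (upint_scale h2 ET) (upint_scale h2 EV)).
apply: upint_weak (upint_le _ B) => [|x _]; first by rewrite sumr3; lra.
case: (boolP (inball x)) => x1; rewrite /= ?mulr0n ?mulr1n; last first.
  by rewrite !mul0r mulr0 !addr0 big1 // => c _; rewrite mul0r.
rewrite !mul1r.
rewrite (eq_bigr (fun c => 2^-1 * rho ^+ 2 * w x ^+ 3 * grad2 (p c) x +
  (w x ^+ 3 * radial_grad (p c) a x ^+ 2 - w x * lap_comp c x * radial_grad (p c) a x))); last first.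
  by move=> c _; rewrite mul1r stress_divergence ?addrA // => i j y; exact: hess_sym.
rewrite big_split -mulr_sumr -energy_densityE /= -addrA lerDl sumrB.
have w0 : 0 < w x by exact: kern_gt0.
have h3 : 0 <= \sum_(c < 3) w x ^+ 3 * radial_grad (p c) a x ^+ 2.
  by apply: sumr_ge0 => c _; rewrite mulr_ge0 ?sqr_ge0 // exprn_ge0 // ltW.
have E : \sum_(c < 3) w x * lap_comp c x * radial_grad (p c) a x =
    \sum_(c < 3) tau c x * (w x * radial_grad (p c) a x).
  rewrite [RHS](eq_bigr (fun c => w x * lap_comp c x * radial_grad (p c) a x +
     V x * w x * (u c x * radial_grad (p c) a x))); last by move=> c _; rewrite /tau; ring.
  rewrite big_split -mulr_sumr /= (_ : \sum_(c < 3) u c x * radial_grad (p c) a x = 0) ?mulr0 ?addr0 //.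
  under eq_bigr => c _ do rewrite /radial_grad mulr_sumr.
  rewrite exchange_big big1 //= => j _.
  under eq_bigr => c _ do rewrite mulrA.
  by rewrite -mulr_suml u_grad_orth // mul0r.
have h4 : \sum_(c < 3) (w x * radial_grad (p c) a x) ^+ 2 <= V x.
  rewrite energy_densityE; apply: ler_sum => c _; rewrite exprMn.
  have g0 : 0 <= grad2 (p c) x by apply: sumr_ge0 => i _; exact: sqr_ge0.
  apply: le_trans (_ : w x ^+ 2 * (grad2 (p c) x * sqr_dist a x) <= _).
    by rewrite ler_wpM2l ?sqr_ge0 // radial_grad_le.
  rewrite mulrCA -[leRHS]mulr1 ler_wpM2l //; exact: kern_dist_le1.
have h5 : \sum_(c < 3) tau c x * (w x * radial_grad (p c) a x) <=
    2^-1 * tau2 x + 2^-1 * \sum_(c < 3) (w x * radial_grad (p c) a x) ^+ 2.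
  rewrite /tau2 !mulr_sumr -big_split; apply: ler_sum => c _ /=.
  have := sqr_ge0 (tau c x - w x * radial_grad (p c) a x); nra.
rewrite E; lra.
Qed.

Lemma sqr_dist_incube a (s : R) x : incube a s x -> sqr_dist a x <= 3 * s ^+ 2.
Proof.
move=> /incubeP Q; have := @sqn_box R (x - a) s.
have -> : sqn (x - a) = sqr_dist a x by rewrite /sqn /sqr_dist; apply: eq_bigr => i _; rewrite !mxE.
by apply => i; rewrite !mxE.
Qed.

(** For [rho = 2 s] the cube satisfies [|z|^2 + rho^2 <= 7 s^2], so [3 s w >= 1]; the constant comes
    from [27/2 * 3/2 <= 21]. *)
Lemma energy_growth a s : 0 < s -> sqn a <= 1 ->
  upint (fun x => (incube a s x)%:R * ((inball x)%:R * V x)) (21 * s * eps ^+ 2).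
Proof.
move=> s0 a1; have rho0 : 0 < 2 * s by rewrite mulr_gt0.
have c0 : 0 <= 27 / 2 * s by rewrite mulr_ge0 // ltW.
have B := upint_scale c0 (energy_monotonicity rho0 a1).
have e2 : 0 <= s * eps ^+ 2 by rewrite mulr_ge0 ?sqr_ge0 // ltW.
apply: upint_weak (upint_le _ B) => [|x _]; first by lra.
have w0 := kern_gt0 a rho0 x; set w := kern a (2 * s) x in w0 *.
have V0 := energy_density_ge0 x.
have i0 : 0 <= (inball x)%:R * V x by rewrite mulr_ge0.
have w3 : 0 <= w ^+ 3 by rewrite exprn_ge0 // ltW.
case: (boolP (incube a s x)) => Q; rewrite /= ?mulr0n ?mulr1n ?mul0r ?mul1r; last first.
  rewrite !mulr_ge0 ?sqr_ge0 //; exact: ltW.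
have -> : 27 / 2 * s * ((inball x)%:R * (2^-1 * (2 * s) ^+ 2 * w ^+ 3 * V x)) =
  (3 * s * w) ^+ 3 * ((inball x)%:R * V x) by field.
rewrite -[leLHS]mul1r ler_wpM2r // exprn_ege1 //.
have wE := kern_sqr a rho0 x; rewrite -/w in wE.
have := sqr_dist_incube Q => Qd.
have wp : 0 < w * s by rewrite mulr_gt0.
have : 1 <= (3 * s * w) ^+ 2.
  rewrite -[leLHS]wE; have -> : (3 * s * w) ^+ 2 = w ^+ 2 * (9 * s ^+ 2) by ring.
  by rewrite ler_wpM2l ?sqr_ge0 //; have := sqr_ge0 s; lra.
nra.
Qed.

(** Take [g = |grad u_c|^2] in [hardy_le], with field [X]. The term with the gradient of [g] costs
    [g |X|^2 / 8 + 8 |D^2 u_c|^2], and [|X|^2 <= 4 weight + 2]: half of the weight survives, against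
    [13/4 = 3 + 1/4] copies of [g]. On the cube [W1 >= 1 / (7 s^2)] for [rho = 2 s]. *)
Lemma hardy_growth a s K : 0 < s -> 0 <= K -> upint (fun x => (inball x)%:R * hess2 x) K ->
  upint (fun x => (incube a s x)%:R * ((inball x)%:R * V x)) (14 * s ^+ 2 * (7 * eps ^+ 2 + 8 * K)).
Proof.
move=> s0 K0 EK; have rho0 : 0 < 2 * s by rewrite mulr_gt0.
have g20 c x : 0 <= grad2 (p c) x by apply: sumr_ge0 => i _; exact: sqr_ge0.
have D c := hardy_le a rho0 (C1_grad2 (Cp c)) (@g20 c).
have h1 : 0 <= 13 / 4 :> R by [].
have h8 : 0 <= 8 :> R by [].
have h14 : 0 <= 14 * s ^+ 2 by rewrite mulr_ge0 // sqr_ge0.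
have B := upint_scale h14 (upint_add (upint_sum D) (upint_add (upint_scale h1 EV) (upint_scale h8 EK))).
apply: upint_weak (upint_le _ B) => [|x _].
  by rewrite sumr3 ler_wpM2l //; have := sqr_ge0 eps; lra.
have V0 := energy_density_ge0 x.
have Hess0 : 0 <= hess2 x.
  by apply: sumr_ge0 => c _; apply: sumr_ge0 => i _; apply: sumr_ge0 => j _; exact: sqr_ge0.
have W1p := W1_gt0 a rho0 x; set w := W1 a (2 * s) x in W1p.
case: (boolP (inball x)) => x1; rewrite /= ?mulr0n ?mulr1n; last first.
  rewrite !mul0r !mulr0 !addr0 big1 ?mulr0 // => c _; by rewrite mul0r.
rewrite !mul1r.
have key : 2^-1 * w * V x <= \sum_(c < 3) \sum_(i < 3) ((\sum_(m < 3) 2 * p c m x * H c m i x) *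
   hardy_field a (2 * s) i x + grad2 (p c) x * hardy_deriv a (2 * s) i i x) + (13 / 4 * V x + 8 * hess2 x).
  rewrite energy_densityE /hess2 !mulr_sumr -!big_split; apply: ler_sum => c _ /=.
  rewrite big_split /= -mulr_sumr.
  have W2p : 0 <= sqn a * W2 a (2 * s) x by rewrite mulr_ge0 ?sqn_ge0 // ltW // W2_gt0.
  have P1 := ler_wpM2l (g20 c x) (hardy_divergence_ge a rho0 x).
  have P2 := ler_wpM2l (g20 c x) (hardy_field_sqr_le a rho0 x1).
  rewrite /hardy_weight -/w in P1 P2.
  have P3 : - (\sum_(i < 3) (\sum_(m < 3) 2 * p c m x * H c m i x) * hardy_field a (2 * s) i x) <=
     8^-1 * (grad2 (p c) x * \sum_(i < 3) hardy_field a (2 * s) i x ^+ 2) + 8 * \sum_(i < 3) \sum_(j < 3) H c i j x ^+ 2.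
    rewrite [X in 8 * X]exchange_big /= -sumrN !mulr_sumr -big_split; apply: ler_sum => i _ /=.
    rewrite mulr_suml mulrA [X in 8^-1 * X]/grad2 -sumrN mulr_sumr mulr_suml mulr_sumr -big_split.
    apply: ler_sum => m _ /=; set y := hardy_field _ _ _ _.
    have := sqr_ge0 (p c m x * y + 8 * H c m i x); nra.
  have W2g := mulr_ge0 (g20 c x) W2p.
  move: P1 P2 P3 W2g; move: (\sum_(i < 3) _ * _) (\sum_(i < 3) _ ^+ 2) (\sum_(i < 3) hardy_deriv _ _ _ _ _).
  move: (sqn a * _) => b S1 S2 S3; lra.
have dn0 : 0 <= \sum_(c < 3) \sum_(i < 3) ((\sum_(m < 3) 2 * p c m x * H c m i x) *
   hardy_field a (2 * s) i x + grad2 (p c) x * hardy_deriv a (2 * s) i i x) + (13 / 4 * V x + 8 * hess2 x).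
  by apply: le_trans key; rewrite !mulr_ge0 // ltW.
under eq_bigr => c _ do rewrite mul1r.
case: (boolP (incube a s x)) => Q; rewrite /= ?mulr0n ?mulr1n ?mul0r ?mul1r; last exact: mulr_ge0.
apply: le_trans (ler_wpM2l h14 key).
have -> : 14 * s ^+ 2 * (2^-1 * w * V x) = (7 * s ^+ 2 * w) * V x by field.
rewrite -[leLHS]mul1r ler_wpM2r //.
have := W1E a rho0 x; rewrite -/w => E; rewrite -[leLHS]E.
by rewrite mulrC ler_wpM2r ?(ltW W1p) //; have := sqr_dist_incube Q; lra.
Qed.

End growth.

(* [sum_c reilly_field c] is [Delta d . d_i d - d_j d . d_ij d], whose divergence is
   [|Delta d|^2 - |D^2 d|^2]. *)
Definition reilly_field c i x : R := lap_comp c x * p c i x - \sum_(j < 3) p c j x * H c i j x.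
Definition reilly_deriv c i l x : R :=
  (\sum_(j < 3) T c j j l x) * p c i x + lap_comp c x * H c i l x -
  \sum_(j < 3) (H c j l x * H c i j x + p c j x * T c i j l x).

Lemma C1_reilly c i : C1 (reilly_field c i) (reilly_deriv c i).
Proof.
exact: C1_sub (C1_mul (C1_sum (fun j => CH c j j)) (Cp c i)) (C1_sum (fun j => C1_mul (Cp c j) (CH c i j))).
Qed.

Lemma reilly_divergence c x : \sum_(i < 3) reilly_deriv c i i x =
  lap_comp c x ^+ 2 - \sum_(i < 3) \sum_(j < 3) H c i j x ^+ 2.
Proof.
rewrite /reilly_deriv /lap_comp /laplacian !sumr3.
rewrite (hess_sym c 1 0) (hess_sym c 2%:R 0) (hess_sym c 2%:R 1).
rewrite (third_sym c 0 1 0) (third_sym c 0 2%:R 0) (third_sym c 1 0 1) (third_sym c 1 2%:R 1).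
by rewrite (third_sym c 2%:R 0 2%:R) (third_sym c 2%:R 1 2%:R); ring.
Qed.

(** The gradient is [W x] on the sphere, so the flux is [W] times the Laplacian minus the second
    normal derivative. For a function constant on the unit sphere this difference is the mean
    curvature term [2 W]. *)
Lemma reilly_boundary c x : sqn x = 1 -> 0 <= \sum_(j < 3) x 0 j * reilly_field c j x.
Proof.
move=> x1; set W := \sum_(i < 3) x 0 i * p c i x.
have pE j : p c j x = x 0 j * W.
  rewrite -[LHS]mul1r -x1 /sqn /W mulr_suml mulr_sumr; apply: eq_bigr => i _.
  by rewrite expr2 -mulrA u_tangential //; ring.
(* The tangential identity is applied once more, to [x_i p_j - x_j p_i], which itself vanishes on
   the sphere. *)
have second i j : i != j -> x 0 i ^+ 2 * H c j j x + x 0 j ^+ 2 * H c i i x - 2 * x 0 i * x 0 j * H c i j x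
    = x 0 i * p c i x + x 0 j * p c j x.
  move=> ij.
  have Cg := C1_sub (C1_mul (C1_coord i) (Cp c j)) (C1_mul (C1_coord j) (Cp c i)).
  have := tangential_derivative i j Cg _ x1.
  have g0 (y : 'rV[R]_3) : sqn y = 1 -> y 0 i * p c j y - y 0 j * p c i y = 0.
    by move=> y1; rewrite u_tangential // subrr.
  move=> /(_ g0); rewrite !eqxx (negbTE ij) eq_sym (negbTE ij) /= !mulr0n !mulr1n.
  by rewrite (hess_sym c j i) => E; lra.
have S := f_equal2 +%R (f_equal2 +%R (second 0 1 isT) (second 0 2%:R isT)) (second 1 2%:R isT).
have E : \sum_(j < 3) x 0 j * reilly_field c j x = 2 * W ^+ 2; last first.
  by rewrite E mulr_ge0 // sqr_ge0.
transitivity (W * (lap_comp c x * sqn x - \sum_(i < 3) \sum_(j < 3) x 0 i * x 0 j * H c i j x)).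
  rewrite /reilly_field (eq_bigr (fun j => W * (lap_comp c x * x 0 j ^+ 2 - \sum_(l < 3) x 0 j * x 0 l * H c j l x))).
    by rewrite -mulr_sumr sumrB -mulr_sumr.
  move=> j _.
  have -> : \sum_(l < 3) p c l x * H c j l x = W * \sum_(l < 3) x 0 l * H c j l x.
    by rewrite mulr_sumr; apply: eq_bigr => l _; rewrite pE; ring.
  have -> : \sum_(l < 3) x 0 j * x 0 l * H c j l x = x 0 j * \sum_(l < 3) x 0 l * H c j l x.
    by rewrite mulr_sumr; apply: eq_bigr => l _; ring.
  by rewrite pE; ring.
have -> : 2 * W ^+ 2 = W * (2 * W) by ring.
congr (W * _); move: S; rewrite /W /lap_comp /laplacian sqnE !sumr3.
by rewrite (hess_sym c 1 0) (hess_sym c 2%:R 0) (hess_sym c 2%:R 1) /= => S; lra.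
Qed.

Definition dev c x : R := u c x - k c.
Local Notation v := dev.
Definition osc_field j x : R := V x * \sum_(c < 3) v c x * p c j x.
Definition osc_deriv j l x : R :=
  (\sum_(c < 3) \sum_(m < 3) 2 * p c m x * H c m l x) * (\sum_(c < 3) v c x * p c j x) +
  V x * \sum_(c < 3) ((p c l x - 0) * p c j x + v c x * H c j l x).

Lemma C1_osc j : C1 (osc_field j) (osc_deriv j).
Proof.
exact: C1_mul (C1_sum (fun c => C1_grad2 (Cp c)))
  (C1_sum (fun c => C1_mul (C1_sub (Cu c) (C1_cst (k c))) (Cp c j))).
Qed.

(** With [A_j = v . d_j u], the divergence is [grad V . A + V^2 + V (v . Laplacian u)]. The first
    term is at least [- V^2 / 4 - hess2 / 7] and the last at least [- V^2 / 4 - 3 hess2 / 28]; the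
    value 28 makes these add up to [- V^2 / 2 - hess2 / 4]. *)
Lemma osc_divergence x : inball x -> \sum_(c < 3) v c x ^+ 2 <= 28^-1 ->
  V x ^+ 2 <= 2 * \sum_(j < 3) osc_deriv j j x + 2^-1 * hess2 x.
Proof.
move=> x1 vs; have V0 := energy_density_ge0 x.
pose A j := \sum_(c < 3) v c x * p c j x.
have A2 : \sum_(j < 3) A j ^+ 2 <= 28^-1 * V x.
  apply: (@le_trans _ _ (\sum_(j < 3) 28^-1 * \sum_(c < 3) p c j x ^+ 2)).
    apply: ler_sum => j _; apply: le_trans (cauchy_schwarz _ _) _.
    by rewrite ler_wpM2r // sumr_ge0 // => c _; exact: sqr_ge0.
  by rewrite -mulr_sumr exchange_big.
have L2 : (\sum_(c < 3) v c x * lap_comp c x) ^+ 2 <= 28^-1 * (3 * hess2 x).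
  apply: le_trans (cauchy_schwarz _ _) _.
  have l0 : 0 <= \sum_(c < 3) lap_comp c x ^+ 2 by apply: sumr_ge0 => c _; exact: sqr_ge0.
  apply: ler_pM => //; first by apply: sumr_ge0 => c _; exact: sqr_ge0.
  rewrite /hess2 mulr_sumr; apply: ler_sum => c _.
  rewrite /lap_comp /laplacian !sumr3.
  move: (H c 0 0 x) (H c 1 1 x) (H c 2%:R 2%:R x) (H c 0 1 x) (H c 0 2%:R x) (H c 1 0 x)
    (H c 1 2%:R x) (H c 2%:R 0 x) (H c 2%:R 1 x) => h00 h11 h22 h01 h02 h10 h12 h20 h21.
  have := sqr_ge0 (h00 - h11); have := sqr_ge0 (h00 - h22); have := sqr_ge0 (h11 - h22).
  have := sqr_ge0 h01; have := sqr_ge0 h02; have := sqr_ge0 h10; have := sqr_ge0 h12.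
  have := sqr_ge0 h20; have := sqr_ge0 h21; lra.
have -> : \sum_(j < 3) osc_deriv j j x =
    \sum_(j < 3) (\sum_(c < 3) \sum_(m < 3) 2 * p c m x * H c m j x) * A j +
    V x * (V x + \sum_(c < 3) v c x * lap_comp c x).
  rewrite /osc_deriv big_split /= -mulr_sumr; congr (_ + V x * _).
  rewrite exchange_big energy_densityE -big_split; apply: eq_bigr => c _ /=.
  rewrite /grad2 /lap_comp /laplacian mulr_sumr -big_split; apply: eq_bigr => j _ /=.
  by rewrite subr0 expr2.
have P3 : - (\sum_(j < 3) (\sum_(c < 3) \sum_(m < 3) 2 * p c m x * H c m j x) * A j) <=
    7 * (V x * \sum_(j < 3) A j ^+ 2) + 7^-1 * hess2 x.
  have -> : hess2 x = \sum_(j < 3) \sum_(c < 3) \sum_(m < 3) H c m j x ^+ 2.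
    rewrite /hess2 [RHS]exchange_big; apply: eq_bigr => c _ /=; exact: exchange_big.
  rewrite -sumrN !mulr_sumr -big_split; apply: ler_sum => j _ /=.
  rewrite energy_densityE mulr_suml !mulr_suml -sumrN !mulr_sumr -big_split; apply: ler_sum => c _ /=.
  rewrite /grad2 !mulr_suml -sumrN !mulr_sumr -big_split; apply: ler_sum => m _ /=.
  have := sqr_ge0 (7 * (p c m x * A j) + H c m j x); nra.
have P4 := ler_wpM2l V0 A2.
have := sqr_ge0 (2^-1 * V x + \sum_(c < 3) v c x * lap_comp c x).
move: P3 P4 L2; move: (\sum_(c < 3) v c x * _) (\sum_(j < 3) A j ^+ 2) (\sum_(j < 3) _ * A j) => S1 S2 S3.
nra.
Qed.

(** Reilly's identity bounds the integral of [hess2] by that of [tau2 + V^2], and [osc_divergence]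
    returns half of [hess2] for [V^2]; its field has no flux because [v = 0] on the sphere. *)
Lemma hessian_bound eps : upint (fun x => (inball x)%:R * tau2 x) (eps ^+ 2) ->
  (forall x, inball x -> \sum_(c < 3) v c x ^+ 2 <= 28^-1) ->
  upint (fun x => (inball x)%:R * hess2 x) (2 * eps ^+ 2).
Proof.
move=> ET vs.
have D1 c := divergence_le (fun i => C1_opp (C1_reilly c i)) _.
have {}D1 c : upint (fun x => (inball x)%:R * \sum_(j < 3) - reilly_deriv c j j x) 0.
  apply: D1 => x x1; rewrite -oppr_ge0 -sumrN.
  by under eq_bigr => i _ do rewrite mulrN opprK; exact: reilly_boundary.
have D2 : upint (fun x => (inball x)%:R * \sum_(j < 3) osc_deriv j j x) 0.
  apply: (divergence_le C1_osc) => x x1; rewrite big1 // => j _; rewrite /osc_field.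
  by rewrite [X in V x * X]big1 ?mulr0 // => c _; rewrite /v u_bdry // subrr mul0r.
have h2 : 0 <= 2 :> R by []. have h4 : 0 <= 4 :> R by [].
have B := upint_add (upint_scale h2 ET) (upint_add (upint_scale h4 D2) (upint_scale h2 (upint_sum D1))).
apply: upint_weak (upint_le _ B) => [|x _]; first by rewrite sumr3; lra.
case: (boolP (inball x)) => x1; rewrite /= ?mulr0n ?mulr1n; last first.
  by rewrite !mul0r !mulr0 !add0r big1 ?mulr0 // => c _; rewrite mul0r.
have -> : \sum_(c < 3) 1 * \sum_(j < 3) - reilly_deriv c j j x = hess2 x - (tau2 x + V x ^+ 2).
  rewrite -(tau2E x1) /hess2 -sumrB; apply: eq_bigr => c _.
  by rewrite mul1r sumrN reilly_divergence opprB.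
rewrite !mul1r.
by have := osc_divergence x1 (vs x x1); lra.
Qed.

End map_estimates.

(** * Mean value inequality *)

Section mean_value.
Context {R : realType} (a : 'rV[R]_3) (sg : R).
Hypothesis sg0 : 0 < sg.
Implicit Types x : 'rV[R]_3.
Local Notation z := (rel a).

(** Its cube enters [bump], which thereby has continuous second derivatives across the edge of its
    support. *)
Definition cut x : R := pos (1 - sqr_dist a x / sg ^+ 2).

Lemma cut_sqr_dist x : cut x * sqr_dist a x = sg ^+ 2 * (cut x - cut x ^+ 2).
Proof.
rewrite -pos_mul -/(cut x); move: (cut x) => Y; field.
by rewrite gt_eqF.
Qed.

Lemma cut_ge0 x : 0 <= cut x. Proof. exact: pos_ge0. Qed.

Lemma cut_le1 x : cut x <= 1.
Proof.
rewrite /cut /pos ge_max ler01 andbT gerBl divr_ge0 ?sqr_dist_ge0 //; exact: sqr_ge0.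
Qed.

Lemma cut_gt0 x : (0 < cut x) = (sqr_dist a x < sg ^+ 2).
Proof. by rewrite /cut pos_gt0 subr_gt0 ltr_pdivrMr ?exprn_gt0 // mul1r. Qed.

Lemma C1_cut_arg : C1 (fun x => 1 - sqr_dist a x / sg ^+ 2) (fun j x => - (2 * z j x / sg ^+ 2)).
Proof.
apply: (C1_ext (C1_sub (C1_cst 1) (C1_mul (C1_sqr_dist a) (C1_cst (sg ^+ 2)^-1)))) => // j x.
by rewrite mulr0 addr0 sub0r.
Qed.

Variable rho : R.
Hypothesis rho0 : 0 < rho.
Local Notation w := (kern a rho).
Local Notation kap := (6 / sg ^+ 2 : R).

(* [w] is a regularised fundamental solution with pole [a]. *)
Definition bump x : R := w x * cut x ^+ 3.
Definition bump_slope x : R := w x ^+ 3 * cut x ^+ 3 + kap * (w x * cut x ^+ 2).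
Definition bump_grad j x : R := - (z j x * bump_slope x).
Definition bump_hess j l x : R := - ((j == l)%:R * bump_slope x - z j x * (z l x *
  (3 * w x ^+ 5 * cut x ^+ 3 + 2 * kap * w x ^+ 3 * cut x ^+ 2 + 4 * kap / sg ^+ 2 * w x * cut x))).

Lemma C1_bump : C1 bump bump_grad.
Proof.
apply: (C1_ext (C1_mul (C1_kern a rho0) (C1_pos3 C1_cut_arg))) => // j x.
by rewrite /bump_grad /bump_slope /cut; field; rewrite gt_eqF.
Qed.

Lemma C1_bump_slope : C1 bump_slope (fun l x => - (z l x *
  (3 * w x ^+ 5 * cut x ^+ 3 + 2 * kap * w x ^+ 3 * cut x ^+ 2 + 4 * kap / sg ^+ 2 * w x * cut x))).
Proof.
have C := C1_add (C1_mul (C1_exp 2 (C1_kern a rho0)) (C1_pos3 C1_cut_arg))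
   (C1_mul (C1_cst kap) (C1_mul (C1_kern a rho0) (C1_pos2 C1_cut_arg))).
apply: (C1_ext C) => // l x.
by rewrite /cut; field; rewrite gt_eqF.
Qed.

Lemma C1_bump_grad j : C1 (bump_grad j) (bump_hess j).
Proof.
apply: (C1_ext (C1_opp (C1_mul (C1_rel a j) C1_bump_slope))) => // l x.
by rewrite /bump_hess; ring.
Qed.

(** The first term is a regularised negative Dirac mass at [a]; the rest is produced by the
    cutoff. *)
Lemma bump_laplacian x : \sum_(j < 3) bump_hess j j x = - (3 * rho ^+ 2 * w x ^+ 5 * cut x ^+ 3) +
  kap * w x * (- 3 * cut x ^+ 2 + 2 * (w x ^+ 2 * sqr_dist a x) * cut x ^+ 2 + 4 * (cut x - cut x ^+ 2)).
Proof.
have wE : w x ^+ 3 = w x ^+ 5 * (sqr_dist a x + rho ^+ 2).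
  by rewrite (exprD _ 3 2) -mulrA kern_sqr // mulr1.
transitivity (- 3 * bump_slope x + sqr_dist a x *
  (3 * w x ^+ 5 * cut x ^+ 3 + 2 * kap * w x ^+ 3 * cut x ^+ 2) +
   4 * kap / sg ^+ 2 * w x * (cut x * sqr_dist a x)).
  by rewrite /bump_hess /sqr_dist !sumr3 /= !mulr1n; ring.
rewrite cut_sqr_dist /bump_slope; have E := congr1 (fun t => t * cut x ^+ 3) wE.
have -> : 4 * kap / sg ^+ 2 * w x * (sg ^+ 2 * (cut x - cut x ^+ 2)) = 4 * kap * w x * (cut x - cut x ^+ 2).
  by field; rewrite gt_eqF.
move: E; move: (cut x) (w x) (sqr_dist a x) kap => Y W s K E; lra.
Qed.

(** With [Y = cut x] the bracket is at most [Y (4 - 5 Y)], which is nonpositive near the pole, where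
    [Y >= 4/5]. Elsewhere [|z|^2 >= sg^2 / 5], so [sg w <= 5/2], while [Y (4 - 5 Y) <= 4/5]. An
    upper bound is enough because it multiplies [f >= 0]. *)
Lemma bump_error_le x : kap * w x * (- 3 * cut x ^+ 2 + 2 * (w x ^+ 2 * sqr_dist a x) * cut x ^+ 2
   + 4 * (cut x - cut x ^+ 2)) <= 12 / sg ^+ 3 * (sqr_dist a x < sg ^+ 2)%R%:R.
Proof.
have k0 : 0 < kap by rewrite divr_gt0 // exprn_gt0.
have w0 : 0 < w x by exact: kern_gt0.
have kw0 : 0 <= kap * w x by apply: mulr_ge0; exact: ltW.
have Y0 := cut_ge0 x.
have := cut_gt0 x; case: (sqr_dist a x < sg ^+ 2) => E; last first.
  have -> : cut x = 0 by apply/eqP; rewrite eq_le Y0 leNgt E.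
  by rewrite (_ : _ * (_ + _) = 0) ?mulr0 //; ring.
rewrite /= mulr1n mulr1.
have s1 : w x ^+ 2 * sqr_dist a x <= 1 by exact: kern_dist_le1.
have sY := cut_sqr_dist x.
set Y := cut x in E Y0 sY *; set s := sqr_dist a x in s1 sY *.
apply: (@le_trans _ _ (kap * w x * (Y * (4 - 5 * Y)))).
  rewrite ler_wpM2l //.
  have := ler_wpM2r (sqr_ge0 Y) s1; nra.
have [Y1|Y1] := lerP (4 / 5) Y.
  apply: (@le_trans _ _ 0); last by rewrite divr_ge0 // exprn_ge0 // ltW.
  rewrite mulr_ge0_le0 // mulr_ge0_le0 //; lra.
have sE : s = sg ^+ 2 * (1 - Y).
  by apply: (mulfI (lt0r_neq0 E)); rewrite sY; ring.
have sgw : sg * w x <= 5 / 2.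
  have : (sg * w x) ^+ 2 <= (5 / 2) ^+ 2.
    have h : w x ^+ 2 * sg ^+ 2 * (1 - Y) <= 1 by rewrite -mulrA -sE.
    have : 0 <= w x ^+ 2 * sg ^+ 2 by rewrite mulr_ge0 ?sqr_ge0.
    rewrite exprMn; nra.
  by rewrite ler_sqr ?nnegrE // mulr_ge0 // ltW.
have YY : Y * (4 - 5 * Y) <= 4 / 5 by have := sqr_ge0 (5 * Y - 2); lra.
have -> : kap * w x * (Y * (4 - 5 * Y)) = 6 / sg ^+ 3 * ((sg * w x) * (Y * (4 - 5 * Y))).
  by field; rewrite gt_eqF.
have -> : 12 / sg ^+ 3 = 6 / sg ^+ 3 * (5 / 2 * (4 / 5)).
  by field; rewrite gt_eqF.
rewrite ler_wpM2l ?divr_ge0 ?exprn_ge0 ?(ltW sg0) //.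
by apply: ler_pM => //; apply: mulr_ge0; try exact: ltW; lra.
Qed.

Variables (f : 'rV[R]_3 -> R) (q : 'I_3 -> 'rV[R]_3 -> R) (Hf : 'I_3 -> 'I_3 -> 'rV[R]_3 -> R)
  (t : 'rV[R]_3 -> R) (eps m : R).
Hypotheses (Cf : C1 f q) (Cq : forall j, C1 (q j) (Hf j)).
Hypothesis f0 : forall x, 0 <= f x.
Hypothesis f_bdry : forall x, sqn x = 1 -> sqr_dist a x < sg ^+ 2 -> f x = 0 /\ forall j, q j x = 0.
Hypothesis f_sub : forall x, inball x -> sqr_dist a x < sg ^+ 2 -> - laplacian Hf x <= t x.
Hypotheses (eps0 : 0 < eps) (Et : upint (fun x => (inball x)%:R * t x ^+ 2) (eps ^+ 2)).
Hypothesis Em : upint (fun x => (inball x)%:R * ((sqr_dist a x < sg ^+ 2)%R%:R * f x)) m.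

(** Green's formula for [f] and [bump]: on the sphere either [f] and its gradient vanish or [bump]
    and its gradient do. Young's inequality with weight [eps] splits [bump t] into a multiple of
    [w^2], bounded by [upint_W1], and one of [t^2]. *)
Lemma bump_average : upint (fun x => (inball x)%:R * (3 * rho ^+ 2 * w x ^+ 5 * cut x ^+ 3 * f x))
  (2 * 384 * eps + eps / 2 + 12 / sg ^+ 3 * m).
Proof.
pose F j x := bump x * q j x - f x * bump_grad j x.
have CF j := C1_sub (C1_mul C1_bump (Cq j)) (C1_mul Cf (C1_bump_grad j)).
have D := divergence_le CF _.
have {}D : upint (fun x => (inball x)%:R * (bump x * laplacian Hf x - f x * \sum_(j < 3) bump_hess j j x)) 0.
  apply: upint_ext (D _) _ => [x x1|x]; last first.
    congr (_ * _); rewrite /laplacian !mulr_sumr -sumrB; apply: eq_bigr => j _; ring.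
  rewrite big1 // => j _; have := cut_gt0 x; case: (boolP (sqr_dist a x < sg ^+ 2)) => h E.
    have [f00 q00] := f_bdry x1 h; by rewrite f00 q00; ring.
  have -> : bump x = 0 by rewrite /bump (_ : cut x = 0) ?expr0n ?mulr0 //; apply/eqP; rewrite eq_le cut_ge0 leNgt E.
  have -> : bump_grad j x = 0.
    rewrite /bump_grad /bump_slope (_ : cut x = 0) ?expr0n ?mulr0 ?addr0 ?mulr0 ?oppr0 //.
    by apply/eqP; rewrite eq_le cut_ge0 leNgt E.
  by rewrite !(mulr0, mul0r) subrr mulr0.
have e2 : 0 <= eps / 2 by rewrite divr_ge0 // ltW.
have ei : 0 <= (2 * eps)^-1 by rewrite invr_ge0 mulr_ge0 // ltW.
have s3 : 0 <= 12 / sg ^+ 3 by rewrite divr_ge0 // exprn_ge0 // ltW.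
have B := upint_add (upint_add D (upint_scale e2 (upint_W1 a rho0)))
   (upint_add (upint_scale ei Et) (upint_scale s3 Em)).
apply: upint_weak (upint_le _ B) => [|x _].
  have -> : (2 * eps)^-1 * eps ^+ 2 = eps / 2 by field; rewrite gt_eqF.
  lra.
case: (boolP (inball x)) => x1; rewrite /= ?mulr0n ?mulr1n ?mul0r ?mul1r ?mulr0 ?addr0 //.
rewrite bump_laplacian; have := ler_wpM2r (f0 x) (bump_error_le x).
set E := kap * w x * _; set i := (sqr_dist a x < sg ^+ 2)%R%:R => hE.
have W1w : W1 a rho x = w x ^+ 2.
  by rewrite /W1 /kern exprVn sqr_sqrtr // ltW // kern_den.
have w0 : 0 < w x by exact: kern_gt0.
have b0 : 0 <= bump x by rewrite mulr_ge0 ?(ltW w0) // exprn_ge0 // cut_ge0.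
have bw : bump x <= w x.
  rewrite /bump -[leRHS]mulr1 ler_wpM2l ?(ltW w0) // exprn_ile1 ?cut_ge0 ?cut_le1 //.
have h1 : - (bump x * laplacian Hf x) <= bump x * t x.
  have := cut_gt0 x; case: (boolP (sqr_dist a x < sg ^+ 2)) => h Ec.
    by rewrite -mulrN ler_wpM2l // f_sub.
  have -> : bump x = 0 by rewrite /bump (_ : cut x = 0) ?expr0n ?mulr0 //; apply/eqP; rewrite eq_le cut_ge0 leNgt Ec.
  by rewrite !mul0r oppr0.
have h2 : bump x * t x <= eps / 2 * w x ^+ 2 + (2 * eps)^-1 * t x ^+ 2.
  apply: (@le_trans _ _ (eps / 2 * bump x ^+ 2 + (2 * eps)^-1 * t x ^+ 2)).
    rewrite -subr_ge0.
    have -> : eps / 2 * bump x ^+ 2 + (2 * eps)^-1 * t x ^+ 2 - bump x * t x =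
       (2 * eps)^-1 * (eps * bump x - t x) ^+ 2 by field; rewrite gt_eqF.
    by rewrite mulr_ge0 ?sqr_ge0.
  rewrite lerD2r ler_wpM2l // ler_sqr ?nnegrE //; exact: ltW.
rewrite W1w.
have -> : 12 / sg ^+ 3 * (i * f x) = 12 / sg ^+ 3 * i * f x by ring.
move: hE h1 h2; move: (3 * rho ^+ 2 * w x ^+ 5 * cut x ^+ 3) (12 / sg ^+ 3 * i * f x) => g1 g2.
move: (eps / 2 * w x ^+ 2) ((2 * eps)^-1 * t x ^+ 2) (bump x * t x) => g3 g4 g5.
move: (bump x * _) E (f x) => g6 g7 g8 *; lra.
Qed.

End mean_value.

Section mean_value_limit.
Context {R : realType}.
Implicit Types x : 'rV[R]_3.

Lemma upint_ge0 (f : 'rV[R]_3 -> R) c : (forall x, 0 <= f x) -> upint f c -> 0 <= c.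
Proof.
move=> f0 H; have H0 : upint (fun=> 0 : R) c by apply: upint_le H => x _.
by have := upint_cst_le H0; rewrite mulr0.
Qed.

(** On a small cube [Q(a, rho)] one has [w >= 1 / (2 rho)] and [cut >= 2/3], so by [(2/3)^3 >= 1/4]
    the regularised Dirac mass has density at least [3 / (128 rho^3)], on a volume of at least
    [rho^3]. *)
Lemma sub_mean_value (a : 'rV[R]_3) (sg : R) f q Hf (t : 'rV[R]_3 -> R) (eps m : R) :
  0 < sg -> inball a -> C1 f q -> (forall j, C1 (q j) (Hf j)) -> (forall x, 0 <= f x) ->
  (forall x, sqn x = 1 -> sqr_dist a x < sg ^+ 2 -> f x = 0 /\ forall j, q j x = 0) ->
  (forall x, inball x -> sqr_dist a x < sg ^+ 2 -> - laplacian Hf x <= t x) ->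
  0 < eps -> upint (fun x => (inball x)%:R * t x ^+ 2) (eps ^+ 2) ->
  upint (fun x => (inball x)%:R * ((sqr_dist a x < sg ^+ 2)%R%:R * f x)) m ->
  f a <= 128 / 3 * (2 * 384 * eps + eps / 2 + 12 / sg ^+ 3 * m).
Proof.
move=> sg0 a1 Cf Cq f0 fb fs eps0 Et Em.
have m0 : 0 <= m by apply: upint_ge0 Em => x; rewrite !mulr_ge0.
have M0 : 0 <= 12 / sg ^+ 3 * m by rewrite mulr_ge0 // divr_ge0 // exprn_ge0 // ltW.
apply/ler_addgt0Pr => e e0.
have [b0|b0] := lerP (f a) e; first by lra.
have g0 : 0 < (1 - sqn a) / 2 by rewrite divr_gt0 // subr_gt0.
have [d d0 dP] := cts_near a (C1_continuous Cf) e0.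
have [r r0 rP] := cts_near a (C1_continuous C1_sqn) g0.
have [rho [rho0 rs rd rr r4]] : exists rho : R, [/\ 0 < rho, rho <= sg / 3, rho <= d, rho <= r & rho <= 1].
  exists (Num.min (Num.min (sg / 3) 1) (Num.min d r)); split.
  - by rewrite !lt_min d0 r0 ltr01 divr_gt0.
  - by rewrite !ge_min lexx.
  - by rewrite !ge_min lexx !orbT.
  - by rewrite !ge_min lexx !orbT.
  - by rewrite !ge_min lexx !orbT.
have B := bump_average sg0 rho0 Cf Cq f0 fb fs eps0 Et Em.
pose b := (f a - e) * (3 / 128) / rho ^+ 3.
have bp : 0 <= b by rewrite !mulr_ge0 ?invr_ge0 ?exprn_ge0 ?subr_ge0 // ltW.
have a4 i : `|a 0 i| + rho <= 4.
  have : `|a 0 i| <= 1 by apply: coord_le; rewrite ?expr1n // ltW.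
  lra.
have : b * rho ^+ 3 <= 2 * 384 * eps + eps / 2 + 12 / sg ^+ 3 * m.
  apply: (@upint_cube_ge _ a rho b) => //; apply: upint_le B => x _.
  have w0 := kern_gt0 a rho0 x; set w := kern a rho x in w0 *.
  have Y0 : 0 <= cut a sg x by exact: cut_ge0.
  case: (boolP (incube a rho x)) => Q; rewrite /= ?mulr0n ?mulr1n ?mulr0 ?mulr1; last first.
    by rewrite !mulr_ge0 ?exprn_ge0 // ltW.
  have Qd i : `|a 0 i - x 0 i| <= rho by rewrite distrC; move/incubeP: Q.
  have x1 : inball x.
    have := rP x (fun i => le_trans (Qd i) rr); move: a1; rewrite /inball ler_norml => ? /andP[]; lra.
  have fx : f a - e <= f x.
    by have := dP x (fun i => le_trans (Qd i) rd); rewrite ler_norml => /andP[]; lra.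
  rewrite x1 mul1r.
  have sq := sqr_dist_incube Q.
  have wE := kern_sqr a rho0 x; rewrite -/w in wE.
  have rw : 1 <= 2 * rho * w.
    rewrite -(@ler_sqr R) ?nnegrE ?expr1n //; last by rewrite !mulr_ge0 // ltW.
    rewrite -[leLHS]wE; have -> : (2 * rho * w) ^+ 2 = w ^+ 2 * (4 * rho ^+ 2) by ring.
    by rewrite ler_wpM2l ?sqr_ge0 //; lra.
  have Y3 : 2 / 3 <= cut a sg x.
    rewrite /cut /pos le_max; apply/orP; left.
    have : sqr_dist a x / sg ^+ 2 <= 3^-1.
      rewrite ler_pdivrMr ?exprn_gt0 //; apply: le_trans sq _.
      have : rho ^+ 2 <= (sg / 3) ^+ 2 by rewrite ler_sqr ?nnegrE // ?divr_ge0 // ltW.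
      by rewrite expr_div_n; lra.
    lra.
  have -> : 3 * rho ^+ 2 * w ^+ 5 * cut a sg x ^+ 3 * f x =
    (3 / 32 / rho ^+ 3) * ((2 * rho * w) ^+ 5 * cut a sg x ^+ 3) * f x.
    by field; rewrite gt_eqF.
  have -> : b = 3 / 32 / rho ^+ 3 * (1 * 4^-1) * (f a - e).
    by rewrite /b; field; rewrite gt_eqF.
  have c0 : 0 <= 3 / 32 / rho ^+ 3 by rewrite divr_ge0 // exprn_ge0 // ltW.
  apply: ler_pM => //; [exact: mulr_ge0 | by rewrite subr_ge0 ltW |].
  apply: ler_wpM2l => //; apply: ler_pM => //.
    by rewrite exprn_ege1.
  apply: (@le_trans _ _ ((2 / 3) ^+ 3)); last by rewrite lerXn2r ?nnegrE //; lra.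
  by rewrite expr_div_n; lra.
rewrite /b divfK ?gt_eqF ?exprn_gt0 //; lra.
Qed.

End mean_value_limit.

(** * Smallness of the oscillation *)

Section oscillation.
Context {R : realType}.
Implicit Types x y : 'rV[R]_3.
Variables (u : 'I_3 -> 'rV[R]_3 -> R) (p : 'I_3 -> 'I_3 -> 'rV[R]_3 -> R)
  (H : 'I_3 -> 'I_3 -> 'I_3 -> 'rV[R]_3 -> R) (k : 'I_3 -> R).
Hypotheses (Cu : forall c, C1 (u c) (p c)) (Cp : forall c i, C1 (p c i) (H c i)).
Hypothesis u_unit : forall x, inball x -> \sum_(c < 3) u c x ^+ 2 = 1.
Hypothesis u_bdry : forall c x, sqn x = 1 -> u c x = k c.
Hypothesis k_unit : \sum_(c < 3) k c ^+ 2 = 1.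
Variable eps : R.
Hypotheses (eps0 : 0 < eps)
  (EV : upint (fun x => (inball x)%:R * energy_density p x) (2 * eps ^+ 2))
  (ET : upint (fun x => (inball x)%:R * tau2 u p H x) (eps ^+ 2)).
Local Notation v := (extv u k).
Local Notation D2 := (dist2 u k).

Lemma map_mean_value a (sg : R) (cc : 'I_3 -> R) m : 0 < sg -> inball a ->
  \sum_(c < 3) cc c ^+ 2 <= 1 ->
  (forall x, sqn x = 1 -> sqr_dist a x < sg ^+ 2 -> forall c, cc c = k c) ->
  (forall x, inball x -> sqr_dist a x < sg ^+ 2 -> 0 <= \sum_(c < 3) cc c * u c x) ->
  upint (fun x => (inball x)%:R * ((sqr_dist a x < sg ^+ 2)%R%:R * \sum_(c < 3) (u c x - cc c) ^+ 2)) m ->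
  \sum_(c < 3) (u c a - cc c) ^+ 2 <= 256 * 257 * eps + 512 * (m / sg ^+ 3).
Proof.
move=> sg0 a1 cc1 ccb ccp Em.
pose f x := 2^-1 * \sum_(c < 3) (u c x - cc c) ^+ 2.
pose q j x := \sum_(c < 3) (u c x - cc c) * p c j x.
pose Hf j l x := \sum_(c < 3) (p c l x * p c j x + (u c x - cc c) * H c j l x).
(* Since [u . Laplacian u = - V], the energy density cancels in the Laplacian of [f], leaving
   [- Laplacian f = t - V (cc . u)]. *)
pose t x := \sum_(c < 3) cc c * tau u p H c x.
have Cv c := C1_sub (Cu c) (C1_cst (cc c)).
have Cf : C1 f q.
  apply: C1_ext (C1_mul (C1_cst 2^-1) (C1_sum (fun c => C1_exp 1 (Cv c)))) _ _ => // j x.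
  rewrite mul0r add0r mulr_sumr; apply: eq_bigr => c _; by rewrite subr0 expr1; field.
have Cq j : C1 (q j) (Hf j).
  apply: C1_ext (C1_sum (fun c => C1_mul (Cv c) (Cp c j))) _ _ => // l x.
  by apply: eq_bigr => c _; rewrite subr0.
have f0 x : 0 <= f x by rewrite mulr_ge0 // sumr_ge0 // => c _; exact: sqr_ge0.
have fb x : sqn x = 1 -> sqr_dist a x < sg ^+ 2 -> f x = 0 /\ forall j, q j x = 0.
  move=> x1 xa; have E c : u c x - cc c = 0 by rewrite (ccb x x1 xa) u_bdry // subrr.
  split=> [|j]; first by rewrite /f big1 ?mulr0 // => c _; rewrite E expr0n.
  by rewrite /q big1 // => c _; rewrite E mul0r.
have fs x : inball x -> sqr_dist a x < sg ^+ 2 -> - laplacian Hf x <= t x.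
  move=> x1 xa; have V0 := energy_density_ge0 p x.
  have -> : laplacian Hf x = energy_density p x + \sum_(c < 3) (u c x - cc c) * lap_comp H c x.
    rewrite /laplacian exchange_big /energy_density -big_split; apply: eq_bigr => c _ /=.
    rewrite /lap_comp /laplacian mulr_sumr -big_split; apply: eq_bigr => j _ /=; by rewrite expr2.
  have -> : \sum_(c < 3) (u c x - cc c) * lap_comp H c x =
      \sum_(c < 3) u c x * lap_comp H c x - \sum_(c < 3) cc c * lap_comp H c x.
    by rewrite -sumrB; apply: eq_bigr => c _; rewrite mulrBl.
  have -> : t x = \sum_(c < 3) cc c * lap_comp H c x + energy_density p x * \sum_(c < 3) cc c * u c x.
    rewrite mulr_sumr -big_split; apply: eq_bigr => c _ /=; rewrite /tau; ring.
  rewrite (u_lap Cu Cp u_unit x1).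
  have := mulr_ge0 V0 (ccp x x1 xa); lra.
have Et : upint (fun x => (inball x)%:R * t x ^+ 2) (eps ^+ 2).
  apply: upint_le ET => x _; rewrite ler_wpM2l // -[leRHS]mul1r.
  apply: le_trans (cauchy_schwarz _ _) _; rewrite ler_wpM2r // sumr_ge0 // => c _; exact: sqr_ge0.
have Ef : upint (fun x => (inball x)%:R * ((sqr_dist a x < sg ^+ 2)%R%:R * f x)) (2^-1 * m).
  have h2 : 0 <= 2^-1 :> R by [].
  by apply: upint_ext (upint_scale h2 Em) _ => x; rewrite /f; ring.
have := sub_mean_value sg0 a1 Cf Cq f0 fb fs eps0 Et Ef.
rewrite /f (_ : 12 / sg ^+ 3 * (2^-1 * m) = 6 * (m / sg ^+ 3)); last by field; rewrite gt_eqF.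
have := eps0; lra.
Qed.

Lemma extv_in c x : inball x -> v c x = u c x.
Proof. by rewrite /extv /ext => ->. Qed.

Lemma extv_out c x : ~~ inball x -> v c x = k c.
Proof. by rewrite /extv /ext => /negbTE ->. Qed.

Lemma extv_unit x : \sum_(c < 3) v c x ^+ 2 = 1.
Proof.
case: (boolP (inball x)) => x1; last by rewrite -k_unit; apply: eq_bigr => c _; rewrite extv_out.
by rewrite -(u_unit x1); apply: eq_bigr => c _; rewrite extv_in.
Qed.

Lemma dist2_dot x y : 2 * \sum_(c < 3) v c y * v c x = 2 - D2 x y.
Proof.
have -> : D2 x y = \sum_(c < 3) v c x ^+ 2 + \sum_(c < 3) v c y ^+ 2 - 2 * \sum_(c < 3) v c y * v c x.
  by rewrite /dist2 !sumr3; ring.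
by rewrite !extv_unit; ring.
Qed.

Lemma dist2_sym x y : D2 x y = D2 y x.
Proof. by apply: eq_bigr => c _; rewrite -opprB sqrrN. Qed.

Lemma dist2_ge0 x y : 0 <= D2 x y.
Proof. by apply: sumr_ge0 => c _; exact: sqr_ge0. Qed.

Definition osc_le (r D : R) := forall x y, (forall i, `|x 0 i - y 0 i| <= r) -> D2 x y <= D.

Lemma osc_double r D : osc_le r D -> osc_le (2 * r) (4 * D).
Proof.
move=> H0 x y xy; pose z := 2^-1 *: (x + y).
have E i : x 0 i - z 0 i = 2^-1 * (x 0 i - y 0 i) /\ z 0 i - y 0 i = 2^-1 * (x 0 i - y 0 i).
  by rewrite !mxE; split; field.
have h i : `|2^-1 * (x 0 i - y 0 i)| <= r.
  by rewrite normrM gtr0_norm //; have := xy i; lra.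
have h1 : D2 x z <= D by apply: H0 => i; rewrite (E i).1.
have h2 : D2 z y <= D by apply: H0 => i; rewrite (E i).2.
by have := dist2_triangle u k x z y; lra.
Qed.

Lemma sqr_dist_coord a x (s : R) i : 0 <= s -> sqr_dist a x < s ^+ 2 -> `|x 0 i - a 0 i| <= s.
Proof.
move=> s0 xa; have -> : x 0 i - a 0 i = (x - a) 0 i by rewrite !mxE.
apply: coord_le => //; apply: ltW; rewrite (_ : sqn _ = sqr_dist a x) //.
by apply: eq_bigr => j _; rewrite !mxE.
Qed.

Lemma inball_coord x i : inball x -> `|x 0 i| <= 1.
Proof. by move=> x1; apply: coord_le; rewrite ?expr1n // ltW. Qed.

Section doubling_step.
Variable sg : R.
Hypotheses (sg0 : 0 < sg) (sg2 : sg <= 2^-1) (osc1 : osc_le (4 * sg) 1).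

Lemma dot_ge0 x y : (forall i, `|x 0 i - y 0 i| <= 4 * sg) -> 0 <= \sum_(c < 3) v c y * v c x.
Proof. by move=> /osc1; have := dist2_dot x y; lra. Qed.

(** The comparison vector is [v(y)], with [y] the Poincare base point of [Q(a, 2 sg)]. The balls of
    radius [sg] around [a] and [b] lie in this cube, within [4 sg] of [y] in each coordinate, so
    [osc1] supplies the sign for the mean value inequality. *)
Lemma interior_oscillation a b : inball a -> inball b -> (forall i, `|a 0 i - b 0 i| <= sg) ->
  (forall x, sqn x = 1 -> sg ^+ 2 <= sqr_dist a x) ->
  (forall x, sqn x = 1 -> sg ^+ 2 <= sqr_dist b x) ->
  D2 a b <= 4 * (256 * 257 * eps + 512 * (54 * 168 * eps ^+ 2)).
Proof.
move=> a1 b1 ab aB bB; have s0 := ltW sg0; have ss : 0 < 2 * sg by rewrite mulr_gt0.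
have aQ i : `|a 0 i| + 2 * sg <= 4 by have := inball_coord i a1; have := sg2; lra.
have [y /incubeP yQ B] := poincare Cu u_bdry ss aQ (energy_growth Cu Cp u_unit u_bdry EV ET ss (ltW a1)).
have main q : inball q -> (forall i, `|q 0 i - a 0 i| <= sg) -> (forall x, sqn x = 1 -> sg ^+ 2 <= sqr_dist q x) ->
    D2 q y <= 256 * 257 * eps + 512 * (54 * 168 * eps ^+ 2).
  move=> q1 qa qB.
  have near x : sqr_dist q x < sg ^+ 2 -> forall i, `|x 0 i - a 0 i| <= 2 * sg.
    move=> xq i; have h1 := sqr_dist_coord i s0 xq; have h2 := qa i.
    move: h1 h2; rewrite !ler_norml => /andP[? ?] /andP[? ?]; apply/andP; split; lra.
  have := @map_mean_value q sg (fun c => v c y) (54 * (2 * sg) ^+ 2 * (21 * (2 * sg) * eps ^+ 2)) sg0 q1 _ _ _ _.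
  rewrite (_ : _ / sg ^+ 3 = 54 * 168 * eps ^+ 2); last by field; rewrite gt_eqF.
  rewrite (_ : \sum_(c < 3) (u c q - v c y) ^+ 2 = D2 q y); last by apply: eq_bigr => c _; rewrite [v c q]extv_in.
  apply.
  - by rewrite extv_unit.
  - by move=> x x1; rewrite ltNge qB.
  - move=> x x1 xq; rewrite (eq_bigr (fun c => v c y * v c x)); last by move=> c _; rewrite [v c x]extv_in.
    apply: dot_ge0 => i; have := near x xq i; have := yQ i.
    rewrite !ler_norml => /andP[? ?] /andP[? ?]; apply/andP; split; lra.
  apply: upint_le B => x _.
  have D0 := dist2_ge0 x y.
  case: (boolP (inball x)) => x1; rewrite /= ?mulr0n ?mulr1n ?mul0r ?mul1r; last by rewrite mulr_ge0.
  case: (boolP (sqr_dist q x < _)) => xq; rewrite /= ?mulr0n ?mulr1n ?mul0r ?mul1r; last by rewrite mulr_ge0.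
  have -> : incube a (2 * sg) x by apply/incubeP; exact: near.
  by rewrite mul1r /dist2; apply: ler_sum => c _; rewrite [v c x]extv_in.
have Ha : D2 a y <= 256 * 257 * eps + 512 * (54 * 168 * eps ^+ 2).
  by apply: main => // i; rewrite subrr normr0.
have Hb : D2 b y <= 256 * 257 * eps + 512 * (54 * 168 * eps ^+ 2).
  by apply: main => // i; rewrite distrC.
by have := dist2_triangle u k a y b; rewrite (dist2_sym y b); lra.
Qed.

(** Near the sphere the comparison vector has to be [k]. The cube [Q(z, sg)] lies in [Q(q, 5 sg)]
    and outside the ball, where the extension equals [k]; hence Poincare's inequality on the large
    cube also bounds [|k - v(y)|^2]. *)
Lemma boundary_oscillation q x0 : inball q -> sqn x0 = 1 -> (forall i, `|q 0 i - x0 0 i| <= 2 * sg) ->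
  \sum_(c < 3) (u c q - k c) ^+ 2 <= 256 * 257 * eps + 512 * (56 * (54 * 25 * 105) * eps ^+ 2).
Proof.
move=> q1 x01 qx; have s0 := ltW sg0; have s5 : 0 < 5 * sg by rewrite mulr_gt0.
have x0n : ~~ inball x0 by rewrite /inball x01 ltxx.
have qQ i : `|q 0 i| + 5 * sg <= 4 by have := inball_coord i q1; have := sg2; lra.
have [y /incubeP yQ B] := poincare Cu u_bdry s5 qQ (energy_growth Cu Cp u_unit u_bdry EV ET s5 (ltW q1)).
set M := 54 * _ * _ in B.
have ME : M = 54 * 25 * 105 * eps ^+ 2 * sg ^+ 3 by rewrite /M; ring.
(* A cube of half-side [sg] has Euclidean radius [sqrt 3 sg < 2 sg], so the shift by [2 sg] clears
   the ball. *)
pose z := (1 + 2 * sg) *: x0.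
have x0i i : `|x0 0 i| <= 1 by apply: coord_le; rewrite ?expr1n ?x01.
have zx i : `|z 0 i - x0 0 i| <= 2 * sg.
  rewrite !mxE (_ : _ - _ = 2 * sg * x0 0 i); last by ring.
  rewrite normrM ger0_norm ?mulr_ge0 // -[leRHS]mulr1 ler_wpM2l // mulr_ge0 //.
have z_in x : incube z sg x -> incube q (5 * sg) x /\ ~~ inball x.
  move=> /incubeP xz; split.
    apply/incubeP => i; move: (xz i) (zx i) (qx i).
    rewrite !ler_norml => /andP[? ?] /andP[? ?] /andP[? ?]; apply/andP; split; lra.
  rewrite /inball -leNgt.
  have CS := cauchy_schwarz (fun i => x0 0 i) (fun i => x 0 i - z 0 i).
  have dz : \sum_(i < 3) (x 0 i - z 0 i) ^+ 2 <= 3 * sg ^+ 2.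
    have -> : \sum_(i < 3) (x 0 i - z 0 i) ^+ 2 = sqn (x - z) by apply: eq_bigr => i _; rewrite !mxE.
    by apply: sqn_box => i; rewrite !mxE; have := xz i; rewrite !mxE.
  have x01' : \sum_(i < 3) x0 0 i ^+ 2 = 1 := x01.
  rewrite x01' mul1r in CS.
  set P := \sum_(i < 3) x0 0 i * _ in CS.
  have PE : P = \sum_(i < 3) x0 0 i * x 0 i - (1 + 2 * sg).
    have -> : 1 + 2 * sg = \sum_(i < 3) (1 + 2 * sg) * x0 0 i ^+ 2 by rewrite -mulr_sumr x01' mulr1.
    by rewrite -sumrB; apply: eq_bigr => i _; rewrite /z !mxE; ring.
  have CS2 := cauchy_schwarz (fun i => x0 0 i) (fun i => x 0 i); rewrite x01' mul1r in CS2.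
  apply: le_trans CS2.
  have Pge : - (2 * sg) <= P.
    rewrite leNgt; apply/negP => Plt; have : P ^+ 2 <= 3 * sg ^+ 2 by exact: le_trans CS dz.
    nra.
  rewrite exprn_ege1 //; lra.
pose kap := \sum_(c < 3) (k c - v c y) ^+ 2.
have kap0 : 0 <= kap by apply: sumr_ge0 => c _; exact: sqr_ge0.
have kapM : kap * sg ^+ 3 <= M.
  apply: (@upint_cube_ge _ z) => //.
    by move=> i; have s2 := sg2; move: (zx i) (x0i i); rewrite -lerBrDr !ler_norml => /andP[? ?] /andP[? ?]; apply/andP; split; lra.
  apply: upint_le B => x _; case: (boolP (incube z sg x)) => xz; rewrite /= ?mulr0n ?mulr1n ?mulr0 ?mulr1.
    have [-> xn] := z_in x xz; rewrite mul1r /dist2 /kap le_eqVlt; apply/orP; left; apply/eqP.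
    by apply: eq_bigr => c _; rewrite [v c x]extv_out.
  by rewrite mulr_ge0 ?dist2_ge0.
have k27 : 0 <= 2 * kap by rewrite mulr_ge0.
have h2 : 0 <= 2 :> R by [].
have s3 : 0 < sg ^+ 3 by rewrite exprn_gt0.
have B2 := upint_add (upint_scale h2 B) (upint_scale k27 (upint_cube q sg0)).
(* [56 = 2 + 2 * 27]: the triangle inequality through [v(y)], and the volume bound [27 sg^3]. *)
have := @map_mean_value q sg k (56 * M) sg0 q1 _ _ _ _.
rewrite (_ : _ / sg ^+ 3 = 56 * (54 * 25 * 105) * eps ^+ 2); last by rewrite ME; field; rewrite gt_eqF.
apply.
- by rewrite k_unit.
- by [].
- move=> x x1 xq; rewrite (eq_bigr (fun c => v c x0 * v c x)); last first.
    by move=> c _; rewrite [v c x]extv_in // [v c x0]extv_out.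
  apply: dot_ge0 => i; move: (sqr_dist_coord i s0 xq) (qx i).
  rewrite !ler_norml => /andP[? ?] /andP[? ?]; apply/andP; split; lra.
apply: upint_weak (upint_le _ B2) => [|x _]; first by move: kapM; move: (sg ^+ 3) (kap) (M) => s K M'; lra.
have D0 := dist2_ge0 x y.
have R0 : 0 <= 2 * ((incube q (5 * sg) x)%:R * D2 x y) + 2 * kap * (incube q sg x)%:R.
  by rewrite addr_ge0 // mulr_ge0 // mulr_ge0.
case: (boolP (inball x)) => x1; rewrite /= ?mulr0n ?mulr1n ?mul0r ?mul1r //.
case: (boolP (sqr_dist q x < _)) => xq; rewrite /= ?mulr0n ?mulr1n ?mul0r ?mul1r //.
have near i := sqr_dist_coord i s0 xq.
have -> : incube q sg x by apply/incubeP.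
have -> : incube q (5 * sg) x by apply/incubeP => i; have := near i; lra.
rewrite mul1r mulr1 /dist2 /kap !mulr_sumr -big_split; apply: ler_sum => c _ /=.
rewrite [v c x]extv_in //; have := sqr_ge0 (u c x - v c y - (v c y - k c)); nra.
Qed.

Hypothesis eps_small : eps <= (256 * 256 * 256 * 256)^-1.

Lemma small_oscillation : osc_le sg (4 ^- 5).
Proof.
have e0 := eps0; have sgp := sg0; have e2 : eps ^+ 2 <= (256 * 256 * 256 * 256)^-1 * eps by rewrite expr2 ler_wpM2r // ltW.
(* Two points, each within [4^-6] of [k] in square, are within [4 * 4^-6 = 4^-5] of each other. *)
have near_bdry (q : 'rV[R]_3) x0 : sqn x0 = 1 -> (forall i, `|q 0 i - x0 0 i| <= 2 * sg) ->
    \sum_(c < 3) (v c q - k c) ^+ 2 <= 4 ^- 6.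
  move=> x01 qx; case: (boolP (inball q)) => q1; last first.
    by rewrite big1 => [|c _]; rewrite ?invr_ge0 ?exprn_ge0 // extv_out // subrr expr0n.
  rewrite (eq_bigr (fun c => (u c q - k c) ^+ 2)); last by move=> c _; rewrite extv_in.
  apply: le_trans (boundary_oscillation q1 x01 qx) _; have := eps_small; lra.
have near_two (a b x0 : 'rV[R]_3) : sqn x0 = 1 -> (forall i, `|a 0 i - b 0 i| <= sg) ->
    (forall i, `|a 0 i - x0 0 i| <= sg) -> D2 a b <= 4 ^- 5.
  move=> x01 ab ax.
  have h1 : \sum_(c < 3) (v c a - k c) ^+ 2 <= 4 ^- 6.
    by apply: near_bdry x01 _ => i; apply: le_trans (ax i) _; lra.
  have h2 : \sum_(c < 3) (v c b - k c) ^+ 2 <= 4 ^- 6.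
    apply: near_bdry x01 _ => i; move: (ax i) (ab i).
    rewrite !ler_norml => /andP[? ?] /andP[? ?]; apply/andP; split; lra.
  apply: (@le_trans _ _ (2 * \sum_(c < 3) (v c a - k c) ^+ 2 + 2 * \sum_(c < 3) (v c b - k c) ^+ 2)).
    rewrite /dist2 !mulr_sumr -big_split; apply: ler_sum => c _ /=.
    have := sqr_ge0 (v c a - k c + (v c b - k c)); nra.
  lra.
(* The projection of the outer point serves as [x0]: it is no farther from [b] than [a] is, that is
   at most [sqrt 3 sg]. *)
have exit (a b : 'rV[R]_3) : ~~ inball a -> inball b -> (forall i, `|a 0 i - b 0 i| <= sg) ->
    D2 a b <= 4 ^- 5.
  move=> a1 b1 ab; have sa : 1 <= sqn a by rewrite leNgt.
  have h : \sum_(c < 3) (v c b - k c) ^+ 2 <= 4 ^- 6.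
    apply: (near_bdry b (proj1 a)) => [|i]; first by rewrite sqn_proj1 //; lra.
    have -> : b 0 i - proj1 a 0 i = (b - proj1 a) 0 i by rewrite !mxE.
    apply: coord_le; first by rewrite mulr_ge0 // ltW.
    apply: le_trans (proj1_contract (ltW b1) sa) _.
    apply: (@le_trans _ _ (3 * sg ^+ 2)); last by have := sqr_ge0 sg; nra.
    by apply: sqn_box => j; rewrite !mxE distrC.
  rewrite dist2_sym (_ : D2 b a = \sum_(c < 3) (v c b - k c) ^+ 2); last first.
    by apply: eq_bigr => c _; rewrite [v c a]extv_out.
  lra.
move=> a b ab.
have ba i : `|b 0 i - a 0 i| <= sg by rewrite distrC.
case: (boolP (inball a)) => a1; case: (boolP (inball b)) => b1.
- have [[x0 [x01 xa]]|na] := pselect (exists x, sqn x = 1 /\ sqr_dist a x < sg ^+ 2).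
    apply: near_two x01 ab _ => i; rewrite distrC; exact: sqr_dist_coord (ltW sg0) xa.
  have [[x0 [x01 xb]]|nb] := pselect (exists x, sqn x = 1 /\ sqr_dist b x < sg ^+ 2).
    rewrite dist2_sym; apply: near_two x01 ba _ => i; rewrite distrC; exact: sqr_dist_coord (ltW sg0) xb.
  apply: le_trans (interior_oscillation a1 b1 ab _ _) _.
  + by move=> x x1; rewrite leNgt; apply/negP => xa; apply: na; exists x.
  + by move=> x x1; rewrite leNgt; apply/negP => xa; apply: nb; exists x.
  have := eps_small; lra.
- by rewrite dist2_sym; apply: exit.
- exact: exit.
rewrite /dist2 big1 => [|c _]; rewrite ?invr_ge0 ?exprn_ge0 //.
by rewrite !extv_out // subrr expr0n.
Qed.

End doubling_step.

Hypothesis eps_small : eps <= (256 * 256 * 256 * 256)^-1.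

(** Each step goes from a fine scale to one twice as coarse. Three doublings turn [4^-5] at scale
    [s] into [4^-2] at scale [8 s], so the hypothesis, known at [4 s], is recovered at [8 s]. *)
Lemma osc_half n : osc_le (2 / 2 ^+ n) 1 -> osc_le 2^-1 (4 ^- 5).
Proof.
elim: n => [|n IH] O1.
  by apply: small_oscillation => //; have -> : 4 * 2^-1 = 2 / 2 ^+ 0 :> R by rewrite expr0; field.
apply: IH; have p2 : 0 < 2 ^+ n :> R by rewrite exprn_gt0.
have p2' : 1 <= 2 ^+ n :> R by rewrite exprn_ege1 // ler1n.
pose s : R := (2 ^+ n)^-1 / 4.
have s0 : 0 < s by rewrite divr_gt0 ?invr_gt0.
have s2 : s <= 2^-1 by have := invf_le1 p2; rewrite p2' /s => i1; lra.
have E4 : 4 * s = 2 / 2 ^+ n.+1 by rewrite /s exprS; field; rewrite gt_eqF.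
have := osc_double (osc_double (osc_double (small_oscillation s0 s2 _ eps_small))).
rewrite E4 => /(_ O1) O8 x y xy; apply: le_trans (O8 x y _) _; last by lra.
by have -> : 2 * (2 * (2 * s)) = 2 / 2 ^+ n by rewrite /s; field; rewrite gt_eqF.
Qed.

(** The Lipschitz constant fixes the starting scale. At the end, two doublings from [1/2] give
    [4^-3] at scale 2, which reaches from any point of the ball to [(1,1,1)], where the extension is
    [k]. *)
Lemma dev_small x : inball x -> \sum_(c < 3) dev u k c x ^+ 2 <= 28^-1.
Proof.
move=> x1; have [L L0 Lip] := extv_lip Cu u_bdry.
have [n nP] : exists n, 4 * L <= 2 ^+ n.
  exists (Num.bound (4 * L)); apply: le_trans (ltW (archi_boundP _)) _; first by rewrite mulr_ge0 // ltW.
  by rewrite -natrX ler_nat ltnW // ltn_expl.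
have p2 : 0 < 2 ^+ n :> R by rewrite exprn_gt0.
have O1 : osc_le (2 / 2 ^+ n) 1.
  move=> y z yz; apply: (@le_trans _ _ (\sum_(c < 3) 4^-1)); last by rewrite sumr3; lra.
  apply: ler_sum => c _; rewrite -real_normK ?num_real //.
  have h : `|v c y - v c z| <= 2^-1.
    apply: le_trans (Lip c y z _ yz) _; rewrite mulrA ler_pdivrMr //; lra.
  have := normr_ge0 (v c y - v c z); nra.
have := osc_double (osc_double (osc_half O1)) => O2.
have one_out : ~~ inball (const_mx 1 : 'rV[R]_3).
  by rewrite /inball sqnE !mxE -leNgt; lra.
apply: (@le_trans _ _ (D2 x (const_mx 1))); last first.
  apply: le_trans (O2 _ _ _) _ => [i|]; last by lra.
  by have := inball_coord i x1; rewrite mxE !ler_norml => /andP[? ?]; apply/andP; split; lra.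
by apply: ler_sum => c _; rewrite [v c x]extv_in // extv_out.
Qed.

End oscillation.

(** * Morrey estimate and conclusion *)

Section morrey.
Context {R : realType}.
Implicit Types x y a b : 'rV[R]_3.
Variables (u : 'I_3 -> 'rV[R]_3 -> R) (p : 'I_3 -> 'I_3 -> 'rV[R]_3 -> R) (k : 'I_3 -> R).
Hypothesis Cu : forall c, C1 (u c) (p c).
Hypothesis u_bdry : forall c x, sqn x = 1 -> u c x = k c.
Variable G : R.
Hypothesis growth : forall a s, 0 < s ->
  upint (fun x => (incube a s x)%:R * ((inball x)%:R * energy_density p x)) (G * s ^+ 2).
Local Notation D2 := (dist2 u k).

(** The value at [y] stands in for the mean over [Q(a,s)]. The bound [s^4] against a volume of order
    [s^3] leaves [s], the square of the modulus of exponent 1/2. *)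
Definition center a s y :=
  incube a s y /\ upint (fun x => (incube a s x)%:R * D2 x y) (54 * G * s ^+ 4).

Lemma center_exists a s : 0 < s -> (forall i, `|a 0 i| + s <= 4) -> exists y, center a s y.
Proof.
move=> s0 aQ; have [y yQ B] := poincare Cu u_bdry s0 aQ (growth a s0).
by exists y; split=> //; apply: upint_weak B; rewrite le_eqVlt; apply/orP; left; apply/eqP; ring.
Qed.

Lemma center_step a b s y y' : 0 < s -> (forall i, `|b 0 i| + s <= 4) ->
  (forall i, `|a 0 i - b 0 i| <= s) -> center a (2 * s) y -> center b s y' ->
  D2 y y' <= 34 * (54 * G) * s.
Proof.
move=> s0 bQ ab [_ By] [_ By'].
have h2 : 0 <= 2 :> R by [].
have s3 : 0 < s ^+ 3 by rewrite exprn_gt0.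
have : D2 y y' * s ^+ 3 <= 34 * (54 * G) * s * s ^+ 3.
  apply: (@upint_cube_ge _ b) => //; first exact: dist2_ge0.
  apply: upint_weak (upint_le _ (upint_add (upint_scale h2 By) (upint_scale h2 By'))) => [|x _].
    by rewrite le_eqVlt; apply/orP; left; apply/eqP; ring.
  have d1 := dist2_ge0 u k x y; have d2 := dist2_ge0 u k x y'.
  case: (boolP (incube b s x)) => xb; rewrite /= ?mulr0n ?mulr1n ?mulr0 ?mulr1 ?mul0r ?mul1r.
    have -> : incube a (2 * s) x.
      apply/incubeP => i; move/incubeP: xb => /(_ i); move: (ab i).
      rewrite !ler_norml => /andP[? ?] /andP[? ?]; apply/andP; split; lra.
    by rewrite mul1r; have := dist2_triangle u k y x y'; rewrite (dist2_sym u k y x).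
  by rewrite addr_ge0 // !mulr_ge0.
by rewrite ler_pM2r.
Qed.

(** With the symmetric factor 2, halving [s] would give the ratio 1 and the iteration over scales
    would not close; the factor [3/2] gives [3/4]. *)
Lemma dist2_triangle_skew x y z : D2 x z <= 3 / 2 * D2 x y + 3 * D2 y z.
Proof.
rewrite /dist2 !mulr_sumr -big_split; apply: ler_sum => c _ /=.
have := sqr_ge0 (extv u k c x - extv u k c y - 2 * (extv u k c y - extv u k c z)); nra.
Qed.

Hypothesis G0 : 0 <= G.

(** The constant solves [3/2 * 204/2 + 3 * 34/2 = 204]. The Lipschitz bound is used only after [n]
    halvings, and its contribution vanishes as [n] grows. *)
Lemma center_dist_approx n L a s y :
  (forall c x y d, (forall i, `|x 0 i - y 0 i| <= d) -> `|extv u k c x - extv u k c y| <= L * d) ->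
  0 < s -> (forall i, `|a 0 i| + s <= 4) -> center a s y ->
  D2 a y <= 204 * (54 * G) * s + 3 * (L * s) ^+ 2 / 2 ^+ n.
Proof.
move=> Lip; elim: n s y => [|n IH] s y s0 aQ cy.
  rewrite expr0 divr1 (_ : 3 * _ = \sum_(c < 3) (L * s) ^+ 2); last by rewrite sumr3; ring.
  rewrite -[leLHS]add0r lerD ?mulr_ge0 ?(ltW s0) //; apply: ler_sum => c _.
  have [/incubeP Q _] := cy.
  have h : `|extv u k c a - extv u k c y| <= L * s by apply: Lip => i; rewrite distrC.
  rewrite -real_normK ?num_real // ler_sqr ?nnegrE //; exact: le_trans (normr_ge0 _) h.
have h0 : 0 < s / 2 by rewrite divr_gt0.
have hQ i : `|a 0 i| + s / 2 <= 4 by have := aQ i; lra.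
have [y' cy'] := center_exists h0 hQ.
have aa i : `|a 0 i - a 0 i| <= s / 2 by rewrite subrr normr0 ltW.
have st : center a (2 * (s / 2)) y by rewrite mulrC divfK.
have d1 := center_step h0 hQ aa st cy'.
have d2 := IH _ _ h0 hQ cy'.
have d3 := dist2_triangle_skew a y' y.
rewrite (dist2_sym u k y' y) in d3.
have q0 : 0 <= 3 * (L * s) ^+ 2 / 2 ^+ n.+1 by rewrite divr_ge0 ?exprn_ge0 // mulr_ge0 // sqr_ge0.
have E : 3 * (L * (s / 2)) ^+ 2 / 2 ^+ n = 3 * (L * s) ^+ 2 / 2 ^+ n.+1 / 2.
  have : 2 ^+ n != 0 :> R by rewrite expf_neq0 // pnatr_eq0.
  by rewrite [2 ^+ n.+1]exprS; move: (2 ^+ n) => t t0; field.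
rewrite E in d2; move: d1 d2 d3 q0; move: (3 * _ / _) (D2 _ _) (D2 _ _) (D2 _ _) (54 * G) => X d4 d5 d6 g.
have -> : 204 * g * s = 204 * (g * s) by ring.
have -> : 204 * g * (s / 2) = 102 * (g * s) by field.
have -> : 34 * g * (s / 2) = 17 * (g * s) by field.
lra.
Qed.

Lemma center_dist a s y : 0 < s -> (forall i, `|a 0 i| + s <= 4) -> center a s y ->
  D2 a y <= 204 * (54 * G) * s.
Proof.
move=> s0 aQ cy; have [L L0 Lip] := extv_lip Cu u_bdry.
apply/ler_addgt0Pr => e e0.
pose n := Num.bound (e^-1 * (3 * (L * s) ^+ 2)).
apply: le_trans (center_dist_approx n Lip s0 aQ cy) _.
rewrite lerD2l ler_pdivrMr ?exprn_gt0 // -ler_pdivrMl //.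
apply: le_trans (ltW (archi_boundP _)) _; first by rewrite mulr_ge0 ?invr_ge0 ?(ltW e0) // mulr_ge0 // sqr_ge0.
by rewrite -/n -natrX ler_nat ltnW // ltn_expl.
Qed.

Lemma morrey a b s : 0 < s -> s <= 1 -> inball a -> inball b -> (forall i, `|a 0 i - b 0 i| <= s) ->
  D2 a b <= 1768 * (54 * G) * s.
Proof.
move=> s0 s1 a1 b1 ab; have ss : 0 < 2 * s by rewrite mulr_gt0.
have aQ i : `|a 0 i| + 2 * s <= 4 by have := inball_coord i a1; lra.
have bQ i : `|b 0 i| + s <= 4 by have := inball_coord i b1; lra.
have [y cy] := center_exists ss aQ; have [y' cy'] := center_exists s0 bQ.
have d1 := center_dist ss aQ cy; have d2 := center_dist s0 bQ cy'.
have d3 := center_step s0 bQ ab cy cy'.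
have t1 := dist2_triangle u k a y b; have t2 := dist2_triangle u k y y' b.
rewrite (dist2_sym u k y' b) in t2; move: d1 d2 d3 t1 t2.
move: (D2 _ _) (D2 _ _) (D2 _ _) (D2 _ _) (D2 _ _) (54 * G) => x1 x2 x3 x4 x5 g; lra.
Qed.

End morrey.

Section holder.
Context {R : realType}.
Implicit Types x y : 'rV[R]_3.
Variables (u : 'I_3 -> 'rV[R]_3 -> R) (p : 'I_3 -> 'I_3 -> 'rV[R]_3 -> R)
  (H : 'I_3 -> 'I_3 -> 'I_3 -> 'rV[R]_3 -> R)
  (T : 'I_3 -> 'I_3 -> 'I_3 -> 'I_3 -> 'rV[R]_3 -> R) (k : 'I_3 -> R).

Lemma holder_half (eps : R) :
  (forall c, C1 (u c) (p c)) -> (forall c i, C1 (p c i) (H c i)) ->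
  (forall c i j, C1 (H c i j) (T c i j)) ->
  (forall x, inball x -> \sum_(c < 3) u c x ^+ 2 = 1) ->
  (forall c x, sqn x = 1 -> u c x = k c) -> \sum_(c < 3) k c ^+ 2 = 1 ->
  0 < eps -> eps <= (256 * 256 * 256 * 256)^-1 ->
  upint (fun x => (inball x)%:R * energy_density p x) (2 * eps ^+ 2) ->
  upint (fun x => (inball x)%:R * tau2 u p H x) (eps ^+ 2) ->
  forall x y, inball x -> inball y -> \sum_(c < 3) (u c x - u c y) ^+ 2 <= 4 * enorm (x - y).
Proof.
move=> Cu Cp CH u_unit u_bdry k_unit eps0 eps1 EV ET x y x1 y1.
have dev1 := dev_small Cu Cp u_unit u_bdry k_unit eps0 EV ET eps1.
have EK := hessian_bound Cu Cp CH u_unit u_bdry ET dev1.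
have K0 : 0 <= 2 * eps ^+ 2 by rewrite mulr_ge0 // sqr_ge0.
(* [23 = 7 + 8 * 2], from [hardy_growth] with [K = 2 eps^2]. *)
pose G := 14 * 23 * eps ^+ 2.
have G0 : 0 <= G by rewrite mulr_ge0 // sqr_ge0.
have gr a s (s0 : 0 < s) := hardy_growth Cp EV a s0 K0 EK.
have {}gr a s : 0 < s ->
    upint (fun x => (incube a s x)%:R * ((inball x)%:R * energy_density p x)) (G * s ^+ 2).
  move=> s0; apply: upint_weak (gr a s s0).
  by rewrite le_eqVlt; apply/orP; left; apply/eqP; rewrite /G; ring.
have e2 : eps ^+ 2 <= (256 * 256 * 256 * 256)^-1 * eps by rewrite expr2 ler_wpM2r // ltW.
have [->|xy] := eqVneq x y.
  rewrite subrr (_ : enorm 0 = 0); last first.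
    by rewrite /enorm big1 ?sqrtr0 // => i _; rewrite mxE expr0n.
  by rewrite mulr0 big1 // => c _; rewrite subrr expr0n.
set r := enorm (x - y).
have r2 : r ^+ 2 = sqn (x - y) by rewrite sqr_sqrtr // sumr_ge0 // => i _; exact: sqr_ge0.
have rge : 0 <= r by exact: sqrtr_ge0.
have xyr i : `|x 0 i - y 0 i| <= r.
  have -> : x 0 i - y 0 i = (x - y) 0 i by rewrite !mxE.
  by apply: coord_le => //; rewrite r2.
have r0 : 0 < r.
  rewrite lt_def rge andbT; apply/eqP => r00; case/eqP: xy; apply/rowP => i.
  by have := xyr i; rewrite r00 normr_le0 subr_eq0 => /eqP.
have [r1|r1] := lerP r 1.
  have := morrey Cu u_bdry gr G0 r0 r1 x1 y1 xyr.
  rewrite (_ : dist2 u k x y = \sum_(c < 3) (u c x - u c y) ^+ 2); last first.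
    by apply: eq_bigr => c _; rewrite !extv_in.
  move=> /le_trans; apply; rewrite ler_wpM2r // /G; lra.
apply: (@le_trans _ _ (2 * \sum_(c < 3) u c x ^+ 2 + 2 * \sum_(c < 3) u c y ^+ 2)).
  rewrite !mulr_sumr -big_split; apply: ler_sum => c _ /=.
  have := sqr_ge0 (u c x + u c y); nra.
by rewrite !u_unit //; lra.
Qed.

End holder.

(** * From the vector-valued map to its components *)

Section smooth_map.
Context {R : realType}.
Implicit Types x y : 'rV[R]_3.
Variable d : 'rV[R]_3 -> 'rV[R]_3.
Hypothesis sd : smooth3 d.

(** The head of the list is the derivative taken last, so the second derivative [H c i j] is the
    component for [[:: j; i]]. *)
Definition component (l : seq 'I_3) (c : 'I_3) x : R := iter_pd l d x 0 c.

Lemma C1_component l c : C1 (component l c) (fun j => component (j :: l) c).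
Proof.
have cts l' : continuous (component l' c).
  by move=> x; apply: (@continuous_comp _ _ _ (iter_pd l' d) (fun v : 'rV[R]_3 => v 0 c));
    [exact: (sd l').1|exact: coord_continuous].
split=> [|j|j x]; [exact: cts|exact: cts|].
have dl := (sd l).2 j x.
apply: DeriveDef; first by move/derivable_mxP: dl; apply.
by rewrite /component /= /pd derive_mx // mxE.
Qed.

Local Notation u := (fun c => component [::] c).
Local Notation p := (fun c i => component [:: i] c).
Local Notation H := (fun c i j => component [:: j; i] c).

Lemma enorm_sqr x : enorm x ^+ 2 = \sum_(i < 3) x 0 i ^+ 2.
Proof. by rewrite sqr_sqrtr // sumr_ge0 // => i _; exact: sqr_ge0. Qed.

Lemma sqn_eq1 x : sqn x = 1 -> enorm x = 1.
Proof. by rewrite /enorm => E; rewrite [X in Num.sqrt X]E sqrtr1. Qed.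

Lemma grad_sqE x : grad_sq d x = energy_density p x.
Proof. by rewrite /energy_density exchange_big; apply: eq_bigr => j _; rewrite enorm_sqr. Qed.

Lemma tension_sqr x : enorm (tension d x) ^+ 2 = tau2 u p H x.
Proof.
rewrite enorm_sqr; apply: eq_bigr => c _; congr (_ ^+ 2).
by rewrite !mxE grad_sqE summxE.
Qed.

Lemma energy_density_continuous : continuous (energy_density p).
Proof. exact: C1_continuous (C1_sum (fun c => C1_sum (fun j => C1_exp 1 (C1_component [:: j] c)))). Qed.

Lemma tau2_continuous : continuous (tau2 u p H).
Proof.
have CV := C1_sum (fun c => C1_sum (fun j => C1_exp 1 (C1_component [:: j] c))).
have Ct c := C1_add (C1_sum (fun i => C1_component [:: i; i] c)) (C1_mul CV (C1_component [::] c)).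
exact: C1_continuous (C1_sum (fun c => C1_exp 1 (Ct c))).
Qed.

Lemma upint_energy (eps : R) : (energy d <= (eps ^+ 2)%:E)%E ->
  upint (fun x => (inball x)%:R * energy_density p x) (2 * eps ^+ 2).
Proof.
move=> Ed; apply: int_ball_upint energy_density_continuous (energy_density_ge0 _) _.
have h2 : (0 : R) < 2 by [].
by move: Ed; rewrite /energy (lee_pdivrMl _ _ h2) (funext grad_sqE) -EFinM.
Qed.

Lemma upint_tension (eps : R) :
  (int_ball (fun x => (enorm (tension d x) ^+ 2)%R) <= (eps ^+ 2)%:E)%E ->
  upint (fun x => (inball x)%:R * tau2 u p H x) (eps ^+ 2).
Proof.
move=> Et; apply: int_ball_upint tau2_continuous _ _ => [x|].
  by apply: sumr_ge0 => c _; exact: sqr_ge0.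
by move: Et; rewrite (funext tension_sqr).
Qed.

Lemma smooth_map_holder (eps : R) : 0 < eps -> eps <= (256 * 256 * 256 * 256)^-1 ->
  (forall x, enorm x < 1 -> enorm (d x) = 1) -> (forall x, enorm x = 1 -> d x = e3) ->
  (energy d <= (eps ^+ 2)%:E)%E ->
  (int_ball (fun x => (enorm (tension d x) ^+ 2)%R) <= (eps ^+ 2)%:E)%E ->
  forall x y, enorm x < 1 -> enorm y < 1 -> enorm (d x - d y) ^+ 2 <= 4 * enorm (x - y).
Proof.
move=> eps0 eps1 unit bdry Ed Et x y; rewrite !enorm_lt1 => x1 y1.
have EV := upint_energy Ed; have ET := upint_tension Et.
have := holder_half (T := fun c i j l => component [:: l; j; i] c) (k := fun c => (e3 : 'rV[R]_3) 0 c)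
  (fun c => C1_component [::] c) (fun c i => C1_component [:: i] c) (fun c i j => C1_component [:: j; i] c)
  _ _ _ eps0 eps1 EV ET x1 y1.
rewrite enorm_sqr (_ : \sum_(i < 3) (d x - d y) 0 i ^+ 2 = \sum_(c < 3) (component [::] c x - component [::] c y) ^+ 2); last first.
  by apply: eq_bigr => c _; rewrite !mxE.
apply.
- by move=> z z1; rewrite -[LHS]enorm_sqr unit ?expr1n // enorm_lt1.
- by move=> c z /sqn_eq1 z1; rewrite /component /= bdry.
- by rewrite sumr3 !mxE /= !expr0n expr1n !add0r.
Qed.

End smooth_map.

Unset Implicit Arguments.
Theorem theorem6p2 (R : realType) :
  exists (eps C : R), 0 < eps /\ 0 < C /\
  forall d : 'rV[R]_3 -> 'rV[R]_3,
    smooth3 d ->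
    (forall x, enorm x < 1 -> enorm (d x) = 1) ->
    (forall x, enorm x = 1 -> d x = e3) ->
    (energy d <= (eps ^+ 2)%:E)%E ->
    (int_ball (fun x => (enorm (tension d x) ^+ 2)%R) <= (eps ^+ 2)%:E)%E ->
    forall x y, enorm x < 1 -> enorm y < 1 -> x != y ->
      enorm (d x - d y) / Num.sqrt (enorm (x - y)) <= C * Num.sqrt eps.
Proof.
(* This value brings the bounds of [interior_oscillation] and [boundary_oscillation] below [4^-5]
   and [4^-6]. *)
pose eps : R := (256 * 256 * 256 * 256)^-1.
have eps0 : 0 < eps by rewrite /eps; lra.
have se : 0 < Num.sqrt eps by rewrite sqrtr_gt0.
(* As [eps] is fixed, [C] may depend on it; the choice makes the right-hand side equal to 2. *)
exists eps, (2 / Num.sqrt eps); do 2!split=> //; first by rewrite divr_gt0.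
move=> d sd unit bdry Ed Et x y x1 y1 xy.
have h := smooth_map_holder sd eps0 (lexx _) unit bdry Ed Et x1 y1.
rewrite divfK ?gt_eqF //; set r := enorm (x - y) in h *.
have r0 : 0 <= r by exact: sqrtr_ge0.
have [->|rn] := eqVneq r 0; first by rewrite sqrtr0 invr0 mulr0.
have rp : 0 < r by rewrite lt_def rn.
have s0 : 0 < Num.sqrt r by rewrite sqrtr_gt0.
have : enorm (d x - d y) <= 2 * Num.sqrt r.
  rewrite -(@ler_sqr R) ?nnegrE ?sqrtr_ge0 ?mulr_ge0 ?sqrtr_ge0 //.
  have E : (2 * Num.sqrt r) ^+ 2 = 4 * r by rewrite exprMn sqr_sqrtr //; ring.
  by rewrite E.
by rewrite -ler_pdivrMr.
Qed.
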